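(* Let $\{G_\alpha\}_{\alpha<\eta}$ be an infinite family of non-trivial compact groups (indexed by an infinite cardinal $\eta$) and let $G=\prod_{\alpha<\eta}G_\alpha$. Then the Fourier algebra $A(G)$ has an $F\ell^1(\eta)$-base of type 2 with constants $K_1=K_2=1$.
   Context: $A(G)$ is the Fourier algebra of $G$ (Eymard); for compact $G$ it is unital. For a Banach algebra $A$, $M_r(A)$ is the algebra of bounded operators $R$ on $A$ with $R(ab)=aR(b)$, with product $R_1R_2=R_2\circ R_1$; for $a\in A$, $R\in M_r(A)$ one writes $aR=R(a)\in A$. For compact $G$, $M_r(A(G))=B(G)=A(G)$ acting by multiplication. $\langle E\rangle$ denotes linear span; cardinals are identified with initial ordinals. $F\ell^1(\eta)$-base of type 2 (with constants $K_1,K_2>0$) in a Banach algebra $A$ with a bounded approximate identity: a bounded set $\mathscr L=\bigcup_{\alpha<\eta}A_\alpha a_\alpha$ such that (i) $\{A_\alpha\}_{\alpha<\eta}$ is an increasing family of nonempty subsets of $A$ with $\bigcup_{\alpha<\eta}A_\alpha$ bounded (by $1$, say) and with closed linear span equal to $A$; (ii) $\{a_\alpha:\alpha<\eta\}$ is a bounded subset of $M_r(A)$; (iii) the spans $\langle A_\alpha a_\alpha\rangle$, $\alpha<\eta$, have zero pairwise intersections; (iv) $\sum_{n=1}^p\|x_n\|\le K_1\|\sum_{n=1}^px_n\|$ whenever $p\in\mathbb N$, $x_n\in\langle A_{\alpha_n}a_{\alpha_n}\rangle$ and $\alpha_1,\dots,\alpha_p<\eta$ are distinct; (v) $\|a\|\le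 K_2\|aa_\alpha\|$ for every $a\in\langle A_\alpha\rangle$ and $\alpha<\eta$. *)

(* Defs.v *)
From HB Require Import structures.
From mathcomp Require Import all_boot all_order all_algebra complex.
From mathcomp Require Import all_classical all_reals all_analysis.
From mathcomp Require wochoice.

Set Implicit Arguments.
Unset Strict Implicit.
Unset Printing Implicit Defensive.

Import Order.TTheory GRing.Theory Num.Theory.
Import numFieldNormedType.Exports.

Local Open Scope classical_set_scope.
Local Open Scope ring_scope.
Local Open Scope complex_scope.

HB.mixin Record isTopologicalGroup G of Group G & Topological G := {
  mulg_continuous : continuous (fun xy : G * G => (xy.1 * xy.2)%g) ;
  invg_continuous : continuous (fun x : G => x^-1%g)
}.

#[short(type="topologicalGroupType")]
HB.structure Definition TopologicalGroup :=
  {G of isTopologicalGroup G & Group G & Topological G}.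

Section ProductGroup.
Variables (I : Type) (G : I -> topologicalGroupType).
Implicit Types x y z : prod_topology G.

Let pone : prod_topology G := fun i => 1%g.
Let pinv x : prod_topology G := fun i => (x i)^-1%g.
Let pmul x y : prod_topology G := fun i => (x i * y i)%g.

Let pmulA : associative pmul.
Proof. by move=> x y z; apply: functional_extensionality_dep => i; apply: mulgA. Qed.

Let pmul1g : left_id pone pmul.
Proof. by move=> x; apply: functional_extensionality_dep => i; apply: mul1g. Qed.

Let pmulg1 : right_id pone pmul.
Proof. by move=> x; apply: functional_extensionality_dep => i; apply: mulg1. Qed.

Let pmulVg : left_inverse pone pinv pmul.
Proof. by move=> x; apply: functional_extensionality_dep => i; apply: mulVg. Qed.

Let pmulgV : right_inverse pone pinv pmul.
Proof. by move=> x; apply: functional_extensionality_dep => i; apply: mulgV. Qed.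

HB.instance Definition _ := isGroup.Build (prod_topology G)
  pmulA pmul1g pmulg1 pmulVg pmulgV.

Lemma continuous_into_prod (T : topologicalType) (f : T -> prod_topology G) :
  (forall i, continuous (fun t => f t i)) -> continuous f.
Proof.
move=> fc t; apply/cvg_sup => i N [V [[W oW <-] WfN] WN].
apply: filterS WN _.
by apply: fc; apply: open_nbhs_nbhs.
Qed.

Lemma continuous_coord i : continuous (fun x : prod_topology G => x i).
Proof.
move=> x; have /cvg_sup/(_ i) xx : nbhs x --> (x : prod_topology G) by [].
by move=> W /(@initial_continuous _ _ (fun f : prod_topology G => f i) x) /xx.
Qed.

Let pmul_continuous :
  continuous (fun xy : prod_topology G * prod_topology G => (xy.1 * xy.2)%g).
Proof.
apply: continuous_into_prod => i xy.
have h : (fun z : prod_topology G * prod_topology G => (z.1 i, z.2 i)) @ xy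
    --> (xy.1 i, xy.2 i).
  apply: cvg_pair.
    exact: (@cvg_comp _ _ _ fst (fun x : prod_topology G => x i) _ (nbhs xy.1) _
    cvg_fst (@continuous_coord i _)).
  exact: (@cvg_comp _ _ _ snd (fun x : prod_topology G => x i) _ (nbhs xy.2) _
    cvg_snd (@continuous_coord i _)).
exact: cvg_comp h (@mulg_continuous (G i) _).
Qed.

Let pinv_continuous : continuous (fun x : prod_topology G => x^-1%g).
Proof.
apply: continuous_into_prod => i x.
exact: (cvg_comp _ _ (@continuous_coord i x) (@invg_continuous (G i) _)).
Qed.

HB.instance Definition _ := isTopologicalGroup.Build (prod_topology G)
  pmul_continuous pinv_continuous.

End ProductGroup.

Definition compact_group (G : topologicalGroupType) : Prop :=
  compact [set: G] /\ hausdorff_space G.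

HB.mixin Record isHilbert (R : realType) H of CompleteNormedModule R[i] H := {
  inner : {dot H for Num.conj} ;
  inner_norm : forall x : H, inner x x = `|x| ^+ 2
}.

#[short(type="hilbertType")]
HB.structure Definition Hilbert (R : realType) :=
  {H of isHilbert R H & CompleteNormedModule R[i] H}.

Section Fourier.
Variables (R : realType) (G : topologicalGroupType).
Local Notation C := R[i].

(* Strongly continuous unitary representations; each [pi g] is surjective, hence
   unitary, because it is invertible with inverse [pi g^-1]. *)
Record unitary_rep (H : hilbertType R) (pi : G -> H -> H) : Prop := UnitaryRep {
  rep_linear : forall g, linear (pi g) ;
  rep_isometry : forall g x y, inner (pi g x) (pi g y) = inner x y ;
  rep1 : forall x, pi 1%g x = x ;
  repM : forall g h x, pi (g * h)%g x = pi g (pi h x) ;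
  rep_continuous : forall x, continuous (fun g => pi g x)
}.

Definition is_coefficient (u : G -> C) (H : hilbertType R)
    (pi : G -> H -> H) (x y : H) : Prop :=
  unitary_rep pi /\ u = (fun g => inner (pi g x) y).

(* B(G) is the span of the continuous positive definite functions, i.e. the set of
   coefficients of unitary representations; by Eymard, the norm of B(G) as the dual
   of C^*(G) is the infimum of |x||y| over all ways to write u as a coefficient. *)
Definition fourier_stieltjes : set (G -> C) :=
  [set u | exists (H : hilbertType R) (pi : G -> H -> H) (x y : H),
    is_coefficient u pi x y].

Definition fs_norm (u : G -> C) : R :=
  inf [set r | exists (H : hilbertType R) (pi : G -> H -> H) (x y : H),
    is_coefficient u pi x y /\ r%:C = `|x| * `|y|].

Definition compactly_supported (u : G -> C) : Prop :=
  continuous (u : G -> C^o) /\ compact (closure [set g | u g != 0]).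

(* A(G) is the closure of B(G) `&` C_c(G) in B(G); it carries the norm of B(G). *)
Definition fourier : set (G -> C) :=
  [set u | fourier_stieltjes u /\
    forall e : R, 0 < e -> exists v : G -> C,
      [/\ fourier_stieltjes v, compactly_supported v & fs_norm (u - v) < e]].

End Fourier.

(* A normed algebra is given here by a subset [carrier] of an ambient complex vector
   space, with a product and a norm that are only meaningful on that subset. *)
Record normed_algebra (R : realType) (X : lmodType R[i]) := NormedAlgebra {
  carrier : set X ;
  amul : X -> X -> X ;
  anorm : X -> R
}.

Section BanachAlgebra.
Variables (R : realType) (X : lmodType R[i]) (A : normed_algebra X).
Local Notation C := R[i].
Local Notation "a ** b" := (amul A a b) (at level 40, left associativity).
Local Notation N := (anorm A).

Record banach_algebra : Prop := BanachAlgebra {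
  carrier0 : carrier A 0 ;
  carrierD : forall a b, carrier A a -> carrier A b -> carrier A (a + b) ;
  carrierZ : forall (c : C) a, carrier A a -> carrier A (c *: a) ;
  carrierM : forall a b, carrier A a -> carrier A b -> carrier A (a ** b) ;
  amulA : forall a b c, carrier A a -> carrier A b -> carrier A c ->
    a ** (b ** c) = a ** b ** c ;
  amul_linearl : forall (k : C) a b c,
    carrier A a -> carrier A b -> carrier A c ->
    (k *: a + b) ** c = k *: (a ** c) + b ** c ;
  amul_linearr : forall (k : C) a b c,
    carrier A a -> carrier A b -> carrier A c ->
    c ** (k *: a + b) = k *: (c ** a) + c ** b ;
  anorm_eq0 : forall a, carrier A a -> N a = 0 -> a = 0 ;
  anormZ : forall (c : C) a, carrier A a -> (N (c *: a))%:C = `|c| * (N a)%:C ;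
  anormD : forall a b, carrier A a -> carrier A b -> N (a + b) <= N a + N b ;
  anormM : forall a b, carrier A a -> carrier A b -> N (a ** b) <= N a * N b ;
  acomplete : forall s : nat -> X, (forall n, carrier A (s n)) ->
    (forall e, 0 < e -> exists n0, forall m n, (n0 <= m)%N -> (n0 <= n)%N ->
      N (s m - s n) < e) ->
    exists2 l, carrier A l & (fun n => N (s n - l)) @ \oo --> (0 : R)
}.

Definition bounded_in (E : set X) : Prop :=
  exists M : R, forall a, E a -> N a <= M.

(* The net of an approximate identity is given by its filter of tails. *)
Definition has_bounded_approximate_identity : Prop :=
  exists (E : set X) (F : set_system X),
    [/\ E `<=` carrier A, bounded_in E, ProperFilter F, F E &
      forall a, carrier A a ->
        (fun e => N (e ** a - a)) @ F --> (0 : R) /\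
        (fun e => N (a ** e - a)) @ F --> (0 : R)].

Definition op_bound (T : X -> X) (M : R) : Prop :=
  forall a, carrier A a -> N (T a) <= M * N a.

(* M_r(A); only the values of [T] on the carrier matter, and the module action
   [a T] of the multiplier on [a] is [T a]. *)
Record right_multiplier (T : X -> X) : Prop := RightMultiplier {
  rmult_carrier : forall a, carrier A a -> carrier A (T a) ;
  rmult_linear : forall (k : C) a b, carrier A a -> carrier A b ->
    T (k *: a + b) = k *: T a + T b ;
  rmult_bounded : exists M, op_bound T M ;
  rmultM : forall a b, carrier A a -> carrier A b -> T (a ** b) = a ** T b
}.

Definition linear_span (E : set X) : set X :=
  [set x | exists (n : nat) (c : 'I_n -> C) (v : 'I_n -> X),
    (forall i, E (v i)) /\ x = \sum_(i < n) c i *: v i].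

(* The cardinal eta is the ordered index type [I]; [S] is the family A_alpha and
   [T] the family a_alpha. *)
Record Fl1_base_data (d : Order.disp_t) (I : orderType d) (K1 K2 : R)
    (S : I -> set X) (T : I -> X -> X) : Prop := Fl1BaseData {
  Fl1_sub : forall i, S i `<=` carrier A ;
  Fl1_nonempty : forall i, S i !=set0 ;
  Fl1_increasing : forall i j, (i <= j)%O -> S i `<=` S j ;
  Fl1_unit_ball : forall i a, S i a -> N a <= 1 ;
  Fl1_total : forall a, carrier A a -> forall e : R, 0 < e ->
    exists2 b, linear_span (\bigcup_i S i) b & N (a - b) < e ;
  Fl1_multiplier : forall i, right_multiplier (T i) ;
  Fl1_multiplier_bounded : exists M : R, forall i, op_bound (T i) M ;
  Fl1_disjoint : forall i j, i != j ->
    linear_span (T i @` S i) `&` linear_span (T j @` S j) = [set 0] ;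
  Fl1_lower_l1 : forall (p : nat) (al : 'I_p -> I) (x : 'I_p -> X),
    injective al -> (forall n, linear_span (T (al n) @` S (al n)) (x n)) ->
    \sum_(n < p) N (x n) <= K1 * N (\sum_(n < p) x n) ;
  Fl1_lower_mult : forall i a, linear_span (S i) a -> N a <= K2 * N (T i a)
}.

Definition Fl1_base_type2 (d : Order.disp_t) (I : orderType d) (K1 K2 : R)
    (L : set X) : Prop :=
  [/\ banach_algebra, has_bounded_approximate_identity, 0 < K1 /\ 0 < K2,
     bounded_in L &
     exists (S : I -> set X) (T : I -> X -> X),
       Fl1_base_data K1 K2 S T /\ L = \bigcup_i (T i @` S i)].

End BanachAlgebra.

Definition fourier_algebra (R : realType) (G : topologicalGroupType) :
    normed_algebra (G -> R[i]) :=
  NormedAlgebra (@fourier R G) (fun u v => u * v) (@fs_norm R G).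

(* [I] is (order isomorphic to) an infinite cardinal, i.e. an infinite initial
   ordinal. *)
Definition infinite_cardinal (d : Order.disp_t) (I : orderType d) : Prop :=
  [/\ wochoice.well_order (<=%O : rel I), infinite_set [set: I] &
     forall i : I, ~ ([set: I] #<= [set j | (j < i)%O])%card].

(* Main.v *)
(** If [G] is compact, then [A(G) = B(G)], and [u] has norm at most [r] when it is the
    off-diagonal entry of a continuous positive definite 2 x 2 block function whose
    diagonal is at most [r] at the identity.  The Banach algebra axioms thus reduce to
    the stability of positive semidefinite kernels under sums, Schur products and limits.

    Let [A_i] be the functions of the unit ball of [A(G)] that depend only on the
    coordinates [j < i], and [a_i] a positive definite function with [a_i(1) = 1] and mean
    zero on the factor [G_i].  If [K] is a normal subgroup, the orthogonal projection
    onto the [K]-fixed vectors of a unitary representation commutes with it, and splits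
    [<pi(g) x, y>] into a [K]-invariant part and a part of mean zero over [K].  If [z] and
    [t] are the projections of [x] and [y], then
    [|z||t| + |x - z||y - t| <= |x||y|], so that the norms of the two parts add up.
    - For [K = G_i] this gives [|f + b a_i| = |f| + |b a_i|] whenever [f] and [b] depend
      only on the coordinates below [i]; the l1 lower bound follows by peeling off the
      largest index.
    - If [K] fixes [x] up to [e], then [u] is within [e |y|] of a [K]-invariant function.
      Taking for [K] the kernel of the projection onto finitely many coordinates, the
      union of the [A_i] spans a dense subspace, because [eta] has no largest element.
    - Restricting to the subgroup [g_i = 1] gives [|b| <= |b a_i|].
    The functions [a_i] come from the invariant mean on [C(G_i)], which is obtained by
    averaging translates. *)

From HB Require Import structures.
Require Import Defs.
From mathcomp Require Import all_boot all_order all_algebra complex.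
From mathcomp Require Import all_classical all_reals all_analysis.
From mathcomp Require Import ring lra.

Set Implicit Arguments.
Unset Strict Implicit.
Unset Printing Implicit Defensive.

Import Order.TTheory GRing.Theory Num.Theory.
Import numFieldNormedType.Exports.

Local Open Scope classical_set_scope.
Local Open Scope ring_scope.
Local Open Scope complex_scope.

(** The norm of A(G) is an infimum over all unitary representations and is not shown to be attained.
    Upper bounds therefore come from exhibiting a block function, lower bounds from examining an
    arbitrary one. Passing from a block function back to vectors is the GNS construction; its
    Hilbert space is built as a space of functions on [G * bool], where null vectors are already
    zero and limits are pointwise limits, so that neither a quotient nor an abstract completion
    occurs. No Haar measure on a subgroup is used. The projection of a vector onto the fixed vectors
    is a limit of finite convex combinations of its translates, and mean zero over [K] says that
    such combinations tend uniformly to zero. Two requirements are met at once by composing two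
    combinations, since the second does not spoil what the first achieved. The constants 1 are
    reached because the splitting is orthogonal in both vectors: |z||t| + |x - z||y - t| is at most
    half the sum of |x|^2 and |y|^2. *)

Local Notation "z ^*" := (Num.conj z) : complex_scope.

(** * Real-valued norms, limits of sequences, and positive 2 x 2 forms *)

Section RealNorm.
Variable R : realType.
Local Notation C := R[i].

(** Norms over [R[i]] take values in [R[i]]; the real part moves estimates to the ordered field [R],
    where [lra] and [nra] apply. *)
Definition rnorm (V : normedZmodType C) (v : V) : R := complex.Re `|v|.

Lemma rnormE (V : normedZmodType C) (v : V) : `|v| = (rnorm v)%:C.
Proof. by rewrite RRe_real// normr_real. Qed.

Lemma rnorm_ge0 (V : normedZmodType C) (v : V) : 0 <= rnorm v.
Proof. by rewrite -ler0c -rnormE. Qed.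

Lemma rnormD (V : normedZmodType C) (v w : V) : rnorm (v + w) <= rnorm v + rnorm w.
Proof. by rewrite -lecR rmorphD /= -!rnormE ler_normD. Qed.

Lemma rnormN (V : normedZmodType C) (v : V) : rnorm (- v) = rnorm v.
Proof. by rewrite /rnorm normrN. Qed.

Lemma rnormB (V : normedZmodType C) (v w : V) : rnorm (v - w) <= rnorm v + rnorm w.
Proof. by rewrite -(rnormN w) rnormD. Qed.

Lemma rnorm_distC (V : normedZmodType C) (v w : V) : rnorm (v - w) = rnorm (w - v).
Proof. by rewrite /rnorm distrC. Qed.

Lemma ball_rnorm (V : normedModType C) (v w : V) (e : R) :
  ball v e%:C w -> rnorm (v - w) < e.
Proof. by rewrite -ball_normE /= rnormE ltcR. Qed.

Lemma rnorm0 (V : normedZmodType C) : rnorm (0 : V) = 0.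
Proof. by rewrite /rnorm normr0. Qed.

Lemma rnorm0_eq0 (V : normedZmodType C) (v : V) : rnorm v = 0 -> v = 0.
Proof. by move=> v0; apply: normr0_eq0; rewrite rnormE v0. Qed.

Lemma rnormM (z w : C) : rnorm (z * w) = rnorm z * rnorm w.
Proof. by apply: complexI; rewrite rmorphM /= -!rnormE normrM. Qed.

Lemma rnormZ (V : normedModType C) (z : C) (v : V) :
  rnorm (z *: v) = rnorm z * rnorm v.
Proof. by apply: complexI; rewrite rmorphM /= -!rnormE normrZ. Qed.

Lemma rnorm_real (r : R) : rnorm r%:C = `|r|.
Proof. by rewrite /rnorm normc_def /= expr0n addr0 sqrtr_sqr. Qed.

Lemma rnorm_conj (z : C) : rnorm z^* = rnorm z.
Proof. by rewrite /rnorm norm_conjC. Qed.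

Lemma rnorm1 : rnorm (1 : C) = 1.
Proof. by rewrite -[1]/(1%:C) rnorm_real normr1. Qed.

Lemma ler_Re_rnorm (z : C) : complex.Re z <= rnorm z.
Proof. by rewrite -lecR -rnormE (le_trans _ (normc_ge_Re z))// lecR ler_norm. Qed.

Lemma ler_normRe_rnorm (z : C) : `|complex.Re z| <= rnorm z.
Proof. by rewrite -lecR -rnormE normc_ge_Re. Qed.

Lemma rnorm_sqr (z : C) : rnorm z ^+ 2 = complex.Re z ^+ 2 + complex.Im z ^+ 2.
Proof. by apply: complexI; rewrite rmorphXn /= -rnormE add_Re2_Im2. Qed.

Lemma mul_conjE (z : C) : z * z^* = (rnorm z ^+ 2)%:C.
Proof. by rewrite -normCK rnormE rmorphXn. Qed.

Lemma ler_normIm_rnorm (z : C) : `|complex.Im z| <= rnorm z.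
Proof.
rewrite -ler_sqr ?nnegrE ?rnorm_ge0// rnorm_sqr -normrX ger0_norm ?sqr_ge0//.
by rewrite lerDr sqr_ge0.
Qed.

Lemma rnorm_le_Re_Im (z : C) : rnorm z <= `|complex.Re z| + `|complex.Im z|.
Proof.
rewrite -ler_sqr ?nnegrE ?rnorm_ge0 ?addr_ge0// rnorm_sqr sqrrD !real_normK ?num_real//.
have : 0 <= `|complex.Re z| * `|complex.Im z| by rewrite mulr_ge0.
lra.
Qed.

Lemma rnorm_sum (V : normedZmodType C) (I : Type) (s : seq I) (F : I -> V) :
  rnorm (\sum_(i <- s) F i) <= \sum_(i <- s) rnorm (F i).
Proof.
elim: s => [|i s IH]; first by rewrite !big_nil rnorm0.
by rewrite !big_cons (le_trans (rnormD _ _))// lerD2l.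
Qed.

Lemma eq_rnorm_small (z w : C) : (forall e : R, 0 < e -> rnorm (z - w) <= e) -> z = w.
Proof.
move=> h; apply/eqP; rewrite -subr_eq0; apply/eqP/rnorm0_eq0/eqP.
rewrite eq_le rnorm_ge0 andbT; apply/ler_addgt0Pl => e e0; rewrite addr0.
exact: h.
Qed.

Definition cauchy_seq (V : normedZmodType C) (u : nat -> V) : Prop :=
  forall e : R, 0 < e -> exists N, forall m n, (N <= m)%N -> (N <= n)%N ->
    rnorm (u m - u n) <= e.

Definition seq_lim (V : normedZmodType C) (u : nat -> V) (l : V) : Prop :=
  forall e : R, 0 < e -> exists N, forall n, (N <= n)%N -> rnorm (u n - l) <= e.

Lemma cauchy_real_cvg (u : nat -> R) :
  (forall e : R, 0 < e -> exists N, forall m n, (N <= m)%N -> (N <= n)%N ->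
    `|u m - u n| <= e) ->
  exists l, forall e : R, 0 < e -> exists N, forall n, (N <= n)%N -> `|u n - l| <= e.
Proof.
move=> uc; have /cvg_ex[l ul] : cvgn u.
  apply: cauchy_cvg; apply/cauchy_exP => e e0.
  have [N hN] := uc (e / 2) (divr_gt0 e0 (ltr0n _ 2)).
  exists (u N); exists N => // n /= Nn; rewrite /ball /=.
  by rewrite (le_lt_trans (hN _ _ _ _))//; lra.
exists l => e e0; move/cvgrPdist_le: ul => /(_ _ e0)[N _ hN].
by exists N => n Nn; rewrite distrC; apply: hN.
Qed.

Lemma cauchy_complex_cvg (u : nat -> C) : cauchy_seq u -> exists l, seq_lim u l.
Proof.
move=> uc.
have [|a ha] := @cauchy_real_cvg (fun n => complex.Re (u n)).
  move=> e /uc[N hN]; exists N => m n mN nN.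
  by rewrite -raddfB (le_trans (ler_normRe_rnorm _))// hN.
have [|b hb] := @cauchy_real_cvg (fun n => complex.Im (u n)).
  move=> e /uc[N hN]; exists N => m n mN nN.
  by rewrite -raddfB (le_trans (ler_normIm_rnorm _))// hN.
exists (a +i* b) => e e0.
have e2 : 0 < e / 2 by lra.
have [N1 h1] := ha _ e2; have [N2 h2] := hb _ e2.
exists (maxn N1 N2) => n; rewrite geq_max => /andP[/h1 {}h1 /h2 {}h2].
rewrite (le_trans (rnorm_le_Re_Im _))// !raddfB /=; lra.
Qed.

Lemma seq_lim_unique (V : normedZmodType C) (u : nat -> V) l l' :
  seq_lim u l -> seq_lim u l' -> l = l'.
Proof.
move=> h h'; apply/eqP; rewrite -subr_eq0; apply/eqP/rnorm0_eq0/eqP.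
rewrite eq_le rnorm_ge0 andbT; apply/ler_addgt0Pl => e e0; rewrite addr0.
have e2 : 0 < e / 2 by lra.
have [N1 h1] := h _ e2; have [N2 h2] := h' _ e2.
have {}h1 := h1 _ (leq_maxl N1 N2); have {}h2 := h2 _ (leq_maxr N1 N2).
set n := maxn N1 N2 in h1 h2.
have -> : l - l' = (u n - l') - (u n - l) by rewrite opprB [RHS]addrC addrA subrK.
rewrite (le_trans (rnormB _ _))//; lra.
Qed.

Lemma ler_rnorm_lim (V : normedZmodType C) (u : nat -> V) l (M : R) :
  seq_lim u l ->
  (forall e : R, 0 < e -> exists N, forall n, (N <= n)%N -> rnorm (u n) <= M + e) ->
  rnorm l <= M.
Proof.
move=> ul uM; apply/ler_addgt0Pl => e e0.
have e2 : 0 < e / 2 by lra.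
have [N1 h1] := ul _ e2; have [N2 h2] := uM _ e2.
have {}h1 := h1 _ (leq_maxl N1 N2); have {}h2 := h2 _ (leq_maxr N1 N2).
set n := maxn N1 N2 in h1 h2.
have -> : l = u n - (u n - l) by rewrite opprB [RHS]addrC subrK.
rewrite (le_trans (rnormB _ _))//; lra.
Qed.

Lemma conj_conjc (z : C) : Num.conj z = conjc z. Proof. by []. Qed.

(** The common source of the Cauchy-Schwarz inequalities below. The vectors (1,0), (0,1), (1,1) and
    (1,i) force the matrix to be hermitian; minimizing over t along (-t b^*, 1) bounds |b|^2. *)
Lemma psd2 (a b b' c : C) :
  (forall z w : C, 0 <= z * z^* * a + z * w^* * b + w * z^* * b' + w * w^* * c) ->
  [/\ a = (complex.Re a)%:C, 0 <= complex.Re a, c = (complex.Re c)%:C,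
      0 <= complex.Re c & b' = b^* /\
      rnorm b ^+ 2 <= complex.Re a * complex.Re c].
Proof.
move=> h.
case: a b b' c h => [a1 a2] [b1 b2] [d1 d2] [c1 c2] h.
have E (x y z w : R) :
    0 <= (x +i* y) * conjc (x +i* y) * (a1 +i* a2) +
         (x +i* y) * conjc (z +i* w) * (b1 +i* b2) +
         (z +i* w) * conjc (x +i* y) * (d1 +i* d2) +
         (z +i* w) * conjc (z +i* w) * (c1 +i* c2).
  by rewrite -!conj_conjc; apply: h.
have := E 1 0 0 0; rewrite lecE /= => /andP[/eqP ha ha0].
have := E 0 0 1 0; rewrite lecE /= => /andP[/eqP hc hc0].
have {}ha : a2 = 0 by lra.
have {}hc : c2 = 0 by lra.
have := E 1 0 1 0; rewrite lecE /= => /andP[/eqP h1 _].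
have {}h1 : d2 = - b2 by lra.
have := E 1 0 0 1; rewrite lecE /= => /andP[/eqP h2 _].
have {}h2 : d1 = b1 by lra.
have {}ha0 : 0 <= a1 by lra.
have {}hc0 : 0 <= c1 by lra.
split => //=; rewrite ?ha ?hc //; split; first by rewrite h1 h2.
rewrite rnorm_sqr /=; set B := (b1 ^+ 2 + b2 ^+ 2).
have q (t : R) : 0 <= t ^+ 2 * B * a1 - 2 * t * B + c1.
  have := E (- t * b1) (t * b2) 1 0; rewrite lecE /= => /andP[_].
  by rewrite h1 h2 ha hc /B => H; apply: le_trans H _; lra.
have B0 : 0 <= B by rewrite addr_ge0// sqr_ge0.
have [a0|a0] := eqVneq a1 0.
  have [->|Bn0] := eqVneq B 0; first by rewrite a0; lra.
  have Bp : 0 < B by rewrite lt_def Bn0.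
  (* For a = 0 the form is affine in t, and this t would give it the value -c - 2. *)
  have := q ((c1 + 1) / B); rewrite a0 mulr0 add0r.
  rewrite (_ : 2 * ((c1 + 1) / B) * B = 2 * (c1 + 1)); last by field.
  lra.
have ap : 0 < a1 by rewrite lt_def a0.
have := q a1^-1.
rewrite (_ : _ - _ = - (B / a1)); last by field.
by rewrite addrC subr_ge0 ler_pdivrMr// mulrC.
Qed.
End RealNorm.

(** * Positive semidefinite kernels and their Hilbert spaces *)

Section Kernel.
Variables (R : realType) (X : Type).
Local Notation C := R[i].
Implicit Types (k : X -> X -> C) (v w : seq (C * X)) (f g : X -> C).

Definition kcomb k v : X -> C := fun y => \sum_(p <- v) p.1 * k p.2 y.

(** The value that the reproducing property imposes on the inner product of [f] with [kcomb k w]; it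
    makes sense for every function [f]. *)
Definition kpair f w : C := \sum_(q <- w) q.1^* * f q.2.

Definition psd k : Prop := forall v, 0 <= kpair (kcomb k v) v.

Definition kscale (c : C) v : seq (C * X) := [seq (c * p.1, p.2) | p <- v].

Lemma kcomb_nil k : kcomb k [::] = 0.
Proof. by apply/funext => y; rewrite /kcomb big_nil. Qed.

Lemma kcomb_cat k v w : kcomb k (v ++ w) = kcomb k v + kcomb k w.
Proof. by apply/funext => y; rewrite /kcomb big_cat. Qed.

Lemma kcomb_scale k c v : kcomb k (kscale c v) = c *: kcomb k v.
Proof.
apply/funext => y; rewrite -[RHS]/(c * kcomb k v y) /kcomb big_map mulr_sumr.
by apply: eq_bigr => p _; rewrite mulrA.
Qed.

Lemma kpair_cat f v w : kpair f (v ++ w) = kpair f v + kpair f w.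
Proof. by rewrite /kpair big_cat. Qed.

Lemma kpair_scale f c v : kpair f (kscale c v) = c^* * kpair f v.
Proof.
rewrite /kpair big_map mulr_sumr; apply: eq_bigr => p _ /=.
by rewrite rmorphM mulrA.
Qed.

Lemma kpairD f g v : kpair (f + g) v = kpair f v + kpair g v.
Proof. by rewrite /kpair -big_split; apply: eq_bigr => p _ /=; rewrite mulrDr. Qed.

Lemma kpairZ (c : C) f v : kpair (c *: f) v = c * kpair f v.
Proof.
rewrite /kpair mulr_sumr; apply: eq_bigr => p _.
by rewrite -[(c *: f) _]/(c * f p.2) mulrCA.
Qed.

Lemma kpairN f v : kpair (- f) v = - kpair f v.
Proof. by rewrite -scaleN1r kpairZ mulN1r. Qed.

Lemma kpairB f g v : kpair (f - g) v = kpair f v - kpair g v.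
Proof. by rewrite kpairD kpairN. Qed.

Lemma kpair0 v : kpair 0 v = 0.
Proof. by rewrite -(scale0r (0 : X -> C)) kpairZ mul0r. Qed.

Lemma kpair1 f x : kpair f [:: (1, x)] = f x.
Proof. by rewrite /kpair big_seq1 /= conjC1 mul1r. Qed.

Lemma kcomb1 k x : kcomb k [:: (1, x)] = k x.
Proof. by apply/funext => y; rewrite /kcomb big_seq1 mul1r. Qed.

Variables (k : X -> X -> C).

Definition kform v w := kpair (kcomb k v) w.
Hypothesis kpsd : psd k.

Lemma kform_psd2 v w :
  [/\ kform v v = (complex.Re (kform v v))%:C, 0 <= complex.Re (kform v v),
      kform w w = (complex.Re (kform w w))%:C, 0 <= complex.Re (kform w w) &
      kform w v = (kform v w)^* /\
      rnorm (kform v w) ^+ 2 <= complex.Re (kform v v) * complex.Re (kform w w)].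
Proof.
apply: psd2 => z t; have := kpsd (kscale z v ++ kscale t w).
rewrite kcomb_cat !kcomb_scale kpair_cat !kpairD !kpair_scale !kpairZ.
rewrite -!/(kform _ _) => h; apply: le_trans h _.
by rewrite le_eqVlt; apply/orP; left; apply/eqP; ring.
Qed.

Definition knorm v : R := Num.sqrt (complex.Re (kform v v)).

Lemma knorm_ge0 v : 0 <= knorm v. Proof. exact: sqrtr_ge0. Qed.

Lemma kform_self v : kform v v = (knorm v ^+ 2)%:C.
Proof. by have [h1 h2 _ _ _] := kform_psd2 v v; rewrite sqr_sqrtr. Qed.

Lemma kform_conj v w : kform w v = (kform v w)^*.
Proof. by have [_ _ _ _ []] := kform_psd2 v w. Qed.

Lemma kform_cs v w : rnorm (kform v w) <= knorm v * knorm w.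
Proof.
have [_ h1 _ h2 [_ h]] := kform_psd2 v w.
rewrite -ler_sqr ?nnegrE ?rnorm_ge0 ?mulr_ge0 ?knorm_ge0//.
by rewrite exprMn !sqr_sqrtr.
Qed.

Lemma kernel_conj x y : k y x = (k x y)^*.
Proof.
by have := kform_conj [:: (1, x)] [:: (1, y)]; rewrite /kform !kpair1 !kcomb1.
Qed.

Lemma kernel_self x : k x x = (complex.Re (k x x))%:C /\ 0 <= complex.Re (k x x).
Proof.
have [h1 h2 _ _ _] := kform_psd2 [:: (1, x)] [:: (1, x)].
by move: h1 h2; rewrite /kform !kpair1 !kcomb1.
Qed.

Lemma kernel_cs x y : rnorm (k x y) ^+ 2 <= complex.Re (k x x) * complex.Re (k y y).
Proof.
have [_ _ _ _ [_]] := kform_psd2 [:: (1, x)] [:: (1, y)].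
by rewrite /kform !kpair1 !kcomb1.
Qed.

(* [f] acts as an antilinear functional of norm at most [M]; this dual norm stands for
   the norm of [f] before the inner product is available. *)
Definition kbound f (M : R) := 0 <= M /\ forall w, rnorm (kpair f w) <= M * knorm w.

Lemma kbound_comb v : kbound (kcomb k v) (knorm v).
Proof. by split => [|w]; [exact: knorm_ge0|exact: kform_cs]. Qed.

Lemma kboundD f g M N : kbound f M -> kbound g N -> kbound (f + g) (M + N).
Proof.
move=> [M0 hf] [N0 hg]; split => [|w]; first exact: addr_ge0.
by rewrite kpairD (le_trans (rnormD _ _))// mulrDl lerD.
Qed.

Lemma kboundZ (c : C) f M : kbound f M -> kbound (c *: f) (rnorm c * M).
Proof.
move=> [M0 hf]; split => [|w]; first by rewrite mulr_ge0 ?rnorm_ge0.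
by rewrite kpairZ rnormM -mulrA ler_wpM2l ?rnorm_ge0.
Qed.

Lemma kboundN f M : kbound f M -> kbound (- f) M.
Proof.
by move=> [M0 hf]; split => [//|w]; rewrite kpairN rnormN.
Qed.

Lemma kboundW f M N : M <= N -> kbound f M -> kbound f N.
Proof.
move=> MN [M0 hf]; split => [|w]; first exact: le_trans MN.
by rewrite (le_trans (hf w))// ler_wpM2r ?knorm_ge0.
Qed.

Lemma knorm_le v M : kbound (kcomb k v) M -> knorm v <= M.
Proof.
move=> [M0 /(_ v)]; rewrite -/(kform v v) kform_self rnorm_real.
rewrite ger0_norm ?sqr_ge0// expr2.
have [->|v0] := eqVneq (knorm v) 0; first by [].
by rewrite ler_pM2r// lt_def v0 knorm_ge0.
Qed.

(** The completion of the span of the kernel functions, realized among functions: the dual norm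
    controls point values, so limits are again functions. *)
Definition rkhs_set f : Prop :=
  forall e : R, 0 < e -> exists v, kbound (f - kcomb k v) e.

Lemma rkhs_set_bound f : rkhs_set f -> exists M, kbound f M.
Proof.
move=> /(_ 1 ltr01)[v hv]; exists (1 + knorm v).
by rewrite -(subrK (kcomb k v) f); apply: kboundD (kbound_comb v).
Qed.

Lemma rkhs_set_comb v : rkhs_set (kcomb k v).
Proof.
move=> e e0; exists v; rewrite subrr; split => [|w]; first exact: ltW.
by rewrite kpair0 rnorm0 mulr_ge0 ?knorm_ge0 ?ltW.
Qed.

Lemma rkhs_set_lin (c : C) f g : rkhs_set f -> rkhs_set g -> rkhs_set (c *: f + g).
Proof.
move=> hf hg e e0.
have c0 : 0 < rnorm c + 1 by rewrite ltr_wpDl ?rnorm_ge0.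
have [v hv] := hf (e / 2 / (rnorm c + 1)) (divr_gt0 (divr_gt0 e0 (ltr0n _ 2)) c0).
have [w hw] := hg (e / 2) (divr_gt0 e0 (ltr0n _ 2)).
exists (kscale c v ++ w); rewrite kcomb_cat kcomb_scale opprD addrACA -scalerBr.
rewrite [e]splitr; apply: kboundD hw; apply: kboundW (kboundZ c hv).
rewrite mulrA ler_pdivrMr// mulrC ler_wpM2l ?ltW// ?divr_gt0//; lra.
Qed.

(* [c] is the limit of [kpair f v] as [kcomb k v] tends to [g], that is, the inner
   product of [f] and [g]. *)
Definition is_kinner f g (c : C) : Prop :=
  forall M v (e : R), kbound f M -> kbound (g - kcomb k v) e ->
  rnorm (kpair f v - c) <= M * e.

Lemma kpair_dist f M v w e d g : kbound f M -> kbound (g - kcomb k v) e ->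
  kbound (g - kcomb k w) d -> rnorm (kpair f v - kpair f w) <= M * (e + d).
Proof.
move=> fM gv gw.
have -> : kpair f v - kpair f w = kpair f (v ++ kscale (-1) w).
  by rewrite kpair_cat kpair_scale rmorphN rmorph1 mulN1r.
have [M0 h] := fM; rewrite (le_trans (h _))// ler_wpM2l//.
apply: knorm_le; rewrite kcomb_cat kcomb_scale scaleN1r.
have -> : kcomb k v - kcomb k w = - (g - kcomb k v) + (g - kcomb k w).
  by rewrite opprB addrA subrK.
by apply: kboundD gw; apply: kboundN.
Qed.

Lemma is_kinner_ex f g : rkhs_set f -> rkhs_set g -> exists c, is_kinner f g c.
Proof.
move=> /rkhs_set_bound[M fM] hg.
have e_gt0 n : 0 < (n.+1%:R : R)^-1 by rewrite invr_gt0.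
have [w hw] := choice (fun n => hg _ (e_gt0 n)).
have M0 := fM.1.
have [e e0|c hc] := @cauchy_complex_cvg R (fun n => kpair f (w n)).
  (* The added 1 keeps the denominator positive when [M] is 0; the same device recurs in most
     estimates below. *)
  have M1 : 0 < e / (2 * (M + 1)) by rewrite divr_gt0//; lra.
  have [N hN] : exists N, forall n, (N <= n)%N -> (n.+1%:R : R)^-1 <= e / (2 * (M + 1)).
    exists (Num.truncn (e / (2 * (M + 1)))^-1) => n Nn.
    rewrite invf_ple ?posrE// (le_trans (ltW (truncnS_gt _)))//.
    by rewrite ler_nat ltnS.
  exists N => m n Nm Nn.
  rewrite (le_trans (kpair_dist fM (hw m) (hw n)))//.
  have h1 := hN _ Nm; have h2 := hN _ Nn.
  rewrite (le_trans (_ : _ <= M * (e / (2 * (M + 1)) + e / (2 * (M + 1)))))//.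
    by rewrite ler_wpM2l// lerD.
  rewrite (_ : M * (_ + _) = e * (M / (M + 1))); last by field; lra.
  by rewrite ler_piMr ?(ltW e0)// ler_pdivrMr; lra.
exists c => M' v e fM' gv; have M'0 := fM'.1; have e0 := gv.1.
apply: (@ler_rnorm_lim _ C (fun n => kpair f v - kpair f (w n))).
  move=> d /hc[N hN]; exists N => n /hN.
  by rewrite (_ : _ - _ - _ = - (kpair f (w n) - c)) ?rnormN//; ring.
move=> d d0.
have M1 : 0 < d / (M' + 1) by rewrite divr_gt0//; lra.
exists (Num.truncn (d / (M' + 1))^-1) => n Nn.
have : (n.+1%:R : R)^-1 <= d / (M' + 1).
  rewrite invf_ple ?posrE// (le_trans (ltW (truncnS_gt _)))//.
  by rewrite ler_nat ltnS.
rewrite ler_pdivlMr; last lra.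
move=> h; rewrite (le_trans (kpair_dist fM' gv (hw n)))// mulrDr lerD2l.
apply: le_trans h; rewrite mulrC ler_wpM2l//; last lra.
Qed.

End Kernel.

Section KernelInner.
Variables (R : realType) (X : Type).
Local Notation C := R[i].
Implicit Types (v w : seq (C * X)) (f g : X -> C).
Variable k : X -> X -> C.
Hypothesis kpsd : psd k.

Local Notation kbound := (kbound k).
Local Notation rkhs_set := (rkhs_set k).
Local Notation kcomb := (kcomb k).

Definition kinner f g : C := xget 0 [set c | is_kinner k f g c].

Lemma kinnerP f g : rkhs_set f -> rkhs_set g -> is_kinner k f g (kinner f g).
Proof. by move=> hf hg; have [c hc] := is_kinner_ex kpsd hf hg; apply: (xgetI 0 hc). Qed.

(** Uniqueness of the limit that defines [kinner]. The constant [M] is free, so each identity can be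
    proved with the error bound that is natural for it. *)
Lemma kinner_eq f g c (M : R) : rkhs_set f -> rkhs_set g -> 0 <= M ->
  (forall v e, kbound (g - kcomb v) e -> rnorm (kpair f v - c) <= M * e) ->
  kinner f g = c.
Proof.
move=> hf hg M0 hc; have [N fN] := rkhs_set_bound kpsd hf.
have N0 := fN.1; apply: eq_rnorm_small => e e0.
have MN : 0 < M + N + 1 by lra.
have [v hv] := hg _ (divr_gt0 e0 MN).
have -> : kinner f g - c = (kpair f v - c) - (kpair f v - kinner f g) by ring.
rewrite (le_trans (rnormB _ _))//.
rewrite (le_trans (lerD (hc _ _ hv) (kinnerP hf hg fN hv)))// -mulrDl mulrCA.
by rewrite ler_piMr ?(ltW e0)// ler_pdivrMr//; lra.
Qed.

Lemma kinner_linear (c : C) f f' g : rkhs_set f -> rkhs_set f' -> rkhs_set g ->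
  kinner (c *: f + f') g = c * kinner f g + kinner f' g.
Proof.
move=> hf hf' hg.
have [N fN] := rkhs_set_bound kpsd hf; have [N' fN'] := rkhs_set_bound kpsd hf'.
have N0 := fN.1; have N0' := fN'.1.
apply: (@kinner_eq _ _ _ (rnorm c * N + N')) => //.
- exact: rkhs_set_lin.
- by rewrite addr_ge0// mulr_ge0 ?rnorm_ge0.
move=> v e hv; rewrite kpairD kpairZ.
have -> : c * kpair f v + kpair f' v - (c * kinner f g + kinner f' g) =
  c * (kpair f v - kinner f g) + (kpair f' v - kinner f' g) by ring.
rewrite (le_trans (rnormD _ _))// rnormM mulrDl -mulrA.
apply: lerD; last exact: (kinnerP hf' hg fN' hv).
by rewrite ler_wpM2l ?rnorm_ge0//; exact: (kinnerP hf hg fN hv).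
Qed.

Lemma kinner_comb f w : rkhs_set f -> kinner f (kcomb w) = kpair f w.
Proof.
move=> hf; have [N fN] := rkhs_set_bound kpsd hf.
apply: (@kinner_eq _ _ _ N) => //; [exact: rkhs_set_comb|exact: fN.1|].
move=> v e hv; rewrite -[e]addr0; apply: (kpair_dist kpsd fN hv).
rewrite subrr; split => // u; rewrite kpair0 rnorm0 mul0r//.
Qed.

Lemma kinner_conj f g : rkhs_set f -> rkhs_set g -> kinner g f = (kinner f g)^*.
Proof.
move=> hf hg.
have [M fM] := rkhs_set_bound kpsd hf; have [N gN] := rkhs_set_bound kpsd hg.
have M0 := fM.1; have N0 := gN.1.
apply: eq_rnorm_small => e e0.
have D0 : 0 < 2 * (M + N + 1) + e by lra.
(* The four errors below add up to at most d (2 M + 2 N + 2 d). The summand [e] in the denominator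
   ensures d <= 1, and then the total is at most [e]. *)
pose d := e / (2 * (M + N + 1) + e).
have d0 : 0 < d by exact: divr_gt0.
have d1 : d <= 1 by rewrite ler_pdivrMr//; lra.
have de : d * (2 * (M + N + 1)) <= e.
  by rewrite /d mulrAC ler_pdivrMr// ler_wpM2l ?ltW//; lra.
have [v hv] := hf _ d0; have [w hw] := hg _ d0.
have vM : knorm k v <= M + d.
  apply: (knorm_le kpsd).
  by rewrite -(subKr f (kcomb v)); apply: kboundD fM (kboundN hv).
have wN : knorm k w <= N + d.
  apply: (knorm_le kpsd).
  by rewrite -(subKr g (kcomb w)); apply: kboundD gN (kboundN hw).
have h1 := kinnerP hg hf gN hv; have h2 := kinnerP hf hg fM hw.
have h3 := hv.2 w; have h4 := hw.2 v.
rewrite kpairB -/(kform k v w) in h3.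
rewrite kpairB -/(kform k w v) (kform_conj kpsd v w) in h4.
have -> : kinner g f - (kinner f g)^* =
    - (kpair g v - kinner g f) + (kpair g v - (kform k v w)^*)
    - (kpair f w - kform k v w)^* + (kpair f w - kinner f g)^*.
  by rewrite !rmorphB /=; ring.
rewrite (le_trans (rnormD _ _))// rnorm_conj.
rewrite (le_trans (lerD (rnormB _ _) (lexx _)))// rnorm_conj.
rewrite (le_trans (lerD (lerD (rnormD _ _) (lexx _)) (lexx _)))// rnormN.
have := ler_wpM2l (ltW d0) vM; have := ler_wpM2l (ltW d0) wN.
nra.
Qed.

Lemma kinner_bound f g M N : rkhs_set f -> rkhs_set g -> kbound f M -> kbound g N ->
  rnorm (kinner f g) <= M * N.
Proof.
move=> hf hg fM gN; have M0 := fM.1; apply/ler_addgt0Pl => e e0.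
have D0 : 0 < 2 * M + 1 by lra.
have d0 : 0 < e / (2 * M + 1) by exact: divr_gt0.
have [v hv] := hg _ d0; set d := e / _ in d0 hv.
have vN : knorm k v <= N + d.
  apply: (knorm_le kpsd).
  by rewrite -(subKr g (kcomb v)); apply: kboundD gN (kboundN hv).
have -> : kinner f g = kpair f v - (kpair f v - kinner f g) by ring.
rewrite (le_trans (rnormB _ _))//.
have h1 := kinnerP hf hg fM hv; have h2 := fM.2 v.
have h3 := ler_wpM2l M0 vN.
have : d * (2 * M) <= e by rewrite /d mulrAC ler_pdivrMr// ler_wpM2l ?ltW//; lra.
nra.
Qed.

Lemma kinner_ge0 f : rkhs_set f -> 0 <= complex.Re (kinner f f).
Proof.
move=> hf; have [M fM] := rkhs_set_bound kpsd hf; have M0 := fM.1.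
rewrite -oppr_le0; apply/ler_addgt0Pl => e e0; rewrite addr0.
have D0 : 0 < 2 * M + 1 + e by lra.
pose d := e / (2 * M + 1 + e).
have d0 : 0 < d by exact: divr_gt0.
have d1 : d <= 1 by rewrite ler_pdivrMr//; lra.
have de : d * (2 * M + 1) <= e.
  by rewrite /d mulrAC ler_pdivrMr// ler_wpM2l ?ltW//; lra.
have [v hv] := hf _ d0.
have vM : knorm k v <= M + d.
  apply: (knorm_le kpsd).
  by rewrite -(subKr f (kcomb v)); apply: kboundD fM (kboundN hv).
have h1 := kinnerP hf hf fM hv; have h2 := hv.2 v.
have := le_trans (ler_normRe_rnorm _) h1; have := le_trans (ler_normRe_rnorm _) h2.
rewrite kpairB -/(kform k v v) (kform_self kpsd) !raddfB /= !ler_norml.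
have := sqr_ge0 (knorm k v); have := ler_wpM2l (ltW d0) vM.
move=> ? ? /andP[? ?] /andP[? ?]; nra.
Qed.

Lemma kinner_self f : rkhs_set f -> kinner f f = (complex.Re (kinner f f))%:C.
Proof.
move=> hf; apply/esym/RRe_real/CrealP.
by rewrite -kinner_conj.
Qed.

Definition rkhs_norm f : R := Num.sqrt (complex.Re (kinner f f)).

Lemma rkhs_norm_ge0 f : 0 <= rkhs_norm f. Proof. exact: sqrtr_ge0. Qed.

Lemma kinner_normE f : rkhs_set f -> kinner f f = (rkhs_norm f ^+ 2)%:C.
Proof. by move=> hf; rewrite sqr_sqrtr ?kinner_ge0// -kinner_self. Qed.

Lemma kinner_linearr (c : C) f f' g : rkhs_set f -> rkhs_set f' -> rkhs_set g ->
  kinner g (c *: f + f') = c^* * kinner g f + kinner g f'.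
Proof.
move=> hf hf' hg; rewrite kinner_conj//; last exact: rkhs_set_lin.
by rewrite kinner_linear// rmorphD rmorphM /= -!kinner_conj.
Qed.

Lemma rkhs_set0 : rkhs_set 0.
Proof. by rewrite -(kcomb_nil k); apply: rkhs_set_comb. Qed.

Lemma kinner0l g : rkhs_set g -> kinner 0 g = 0.
Proof.
move=> hg; apply: (@kinner_eq _ _ _ 0) => // [|v e _]; first exact: rkhs_set0.
by rewrite kpair0 subr0 rnorm0 mul0r.
Qed.

Lemma rkhs_setZ (c : C) f : rkhs_set f -> rkhs_set (c *: f).
Proof. by move=> hf; rewrite -[_ *: _]addr0; apply: rkhs_set_lin => //; apply: rkhs_set0. Qed.

Lemma kinnerZl (c : C) f g : rkhs_set f -> rkhs_set g ->
  kinner (c *: f) g = c * kinner f g.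
Proof.
by move=> hf hg; have := kinner_linear c hf rkhs_set0 hg; rewrite addr0 kinner0l// addr0.
Qed.

Lemma kinnerZr (c : C) f g : rkhs_set f -> rkhs_set g ->
  kinner g (c *: f) = c^* * kinner g f.
Proof.
move=> hf hg; rewrite kinner_conj ?kinnerZl//; last exact: rkhs_setZ.
by rewrite rmorphM /= -kinner_conj.
Qed.

Lemma kinner_cs f g : rkhs_set f -> rkhs_set g ->
  rnorm (kinner f g) <= rkhs_norm f * rkhs_norm g.
Proof.
move=> hf hg.
have [|_ a0 _ c0 [_ h]] := @psd2 R (kinner f f) (kinner f g) (kinner g f) (kinner g g).
  move=> z w; have := kinner_ge0 (rkhs_set_lin z hf (rkhs_setZ w hg)).
  have hz : rkhs_set (z *: f + w *: g) by apply: rkhs_set_lin (rkhs_setZ _ _).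
  rewrite -ler0c -kinner_self//.
  have wg := rkhs_setZ w hg.
  rewrite kinner_linear// !kinner_linearr// !kinnerZl// !kinnerZr// => H.
  apply: le_trans H _.
  by rewrite le_eqVlt; apply/orP; left; apply/eqP; ring.
rewrite -ler_sqr ?nnegrE ?rnorm_ge0 ?mulr_ge0 ?rkhs_norm_ge0//.
by rewrite exprMn !sqr_sqrtr.
Qed.

(** Together with [kbound_rkhs_norm], this identifies the Hilbert norm with the least constant in
    [kbound]. *)
Lemma rkhs_norm_le f M : rkhs_set f -> kbound f M -> rkhs_norm f <= M.
Proof.
move=> hf fM; rewrite -ler_sqr ?nnegrE ?rkhs_norm_ge0 ?fM.1//.
have := kinner_bound hf hf fM fM; rewrite kinner_normE// rnorm_real ger0_norm ?sqr_ge0//.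
Qed.

Lemma rkhs_norm_comb v : rkhs_norm (kcomb v) = knorm k v.
Proof. by rewrite /rkhs_norm kinner_comb//; exact: rkhs_set_comb. Qed.

Lemma kbound_rkhs_norm f : rkhs_set f -> kbound f (rkhs_norm f).
Proof.
move=> hf; split => [|w]; first exact: rkhs_norm_ge0.
by rewrite -kinner_comb// -rkhs_norm_comb kinner_cs//; exact: rkhs_set_comb.
Qed.

Lemma kpair_seq_lim (u : nat -> X -> C) f w : (forall x, seq_lim (u^~ x) (f x)) ->
  seq_lim (fun n => kpair (u n) w) (kpair f w).
Proof.
move=> h; elim: w => [|[c x] w IH] e e0.
  by exists 0%N => n _; rewrite /kpair !big_nil subrr rnorm0 ltW.
have c1 : 0 < rnorm c + 1 by rewrite ltr_wpDl ?rnorm_ge0.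
have e2 : 0 < e / 2 by lra.
have [N1 h1] := h x _ (divr_gt0 e2 c1); have [N2 h2] := IH _ e2.
exists (maxn N1 N2) => n; rewrite geq_max => /andP[/h1 {}h1 /h2 {}h2].
rewrite /kpair !big_cons /= -!/(kpair _ _).
have -> : c^* * u n x + kpair (u n) w - (c^* * f x + kpair f w) =
   c^* * (u n x - f x) + (kpair (u n) w - kpair f w) by ring.
rewrite (le_trans (rnormD _ _))// rnormM rnorm_conj.
rewrite [e]splitr lerD//.
rewrite (le_trans (ler_wpM2l (rnorm_ge0 _) h1))// mulrCA ler_piMr ?(ltW e2)//.
by rewrite ler_pdivrMr//; lra.
Qed.

(** Evaluation at a point is bounded, so a Cauchy sequence converges pointwise. For a fixed test
    combination only finitely many points matter, hence the dual bounds pass to the pointwise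
    limit. *)
Lemma rkhs_complete (u : nat -> X -> C) : (forall n, rkhs_set (u n)) ->
  (forall e : R, 0 < e -> exists N, forall m n, (N <= m)%N -> (N <= n)%N ->
    rkhs_norm (u m - u n) <= e) ->
  exists2 f, rkhs_set f & forall e : R, 0 < e -> exists N, forall n, (N <= n)%N ->
    rkhs_norm (f - u n) <= e.
Proof.
move=> hu uc.
have hB m n : rkhs_set (u m - u n).
  by rewrite -scaleN1r addrC; apply: rkhs_set_lin.
have [f hf] : exists f : X -> C, forall x, seq_lim (u^~ x) (f x).
  suff /choice[f] : forall x, exists l, seq_lim (u^~ x) l by exists f.
  move=> x; apply: cauchy_complex_cvg => e e0.
  have K1 : 0 < knorm k [:: (1, x)] + 1 by rewrite ltr_wpDl ?knorm_ge0.
  have [N hN] := uc _ (divr_gt0 e0 K1); exists N => m n mN nN.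
  have := (kbound_rkhs_norm (hB m n)).2 [:: (1, x)]; rewrite kpair1 => /le_trans; apply.
  rewrite (le_trans (ler_wpM2r (knorm_ge0 _ _) (hN _ _ mN nN)))// -mulrA ler_piMr ?(ltW e0)//.
  by rewrite mulrC ler_pdivrMr//; lra.
have hlim (e : R) : 0 < e -> exists N, forall n, (N <= n)%N -> kbound (f - u n) e.
  move=> e0; have [N hN] := uc _ e0; exists N => n Nn; split; first exact: ltW.
  move=> w; apply: (@ler_rnorm_lim _ C (fun m => kpair (u m) w - kpair (u n) w)).
    move=> d /(kpair_seq_lim w hf)[N' h']; exists N' => m /h'.
    by rewrite kpairB (_ : _ - _ - _ = kpair (u m) w - kpair f w)//; ring.
  move=> d d0; exists N => m Nm; rewrite -kpairB.
  rewrite (le_trans ((kbound_rkhs_norm (hB m n)).2 w))//.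
  by rewrite (le_trans (ler_wpM2r (knorm_ge0 _ _) (hN _ _ Nm Nn)))// lerDl ltW.
have hfk : rkhs_set f.
  move=> e e0; have e2 : 0 < e / 2 by lra.
  have [N hN] := hlim _ e2; have [v hv] := hu N _ e2; exists v.
  have -> : f - kcomb v = (f - u N) + (u N - kcomb v) by rewrite addrA subrK.
  by rewrite [e]splitr; apply: kboundD hv; apply: hN.
exists f => // e /hlim[N hN]; exists N => n /hN; apply: rkhs_norm_le.
by rewrite addrC -scaleN1r; apply: rkhs_set_lin.
Qed.

End KernelInner.

Section RKHS.
Variables (R : realType) (X : Type) (k : X -> X -> R[i]) (kpsd : psd k).
Local Notation C := R[i].

Definition rkhs_pred : {pred X -> C} := fun f => `[< rkhs_set k f >].

Lemma rkhs_submod : submod_closed rkhs_pred.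
Proof.
split => [|c f g /asboolP hf /asboolP hg]; apply/asboolP; first exact: rkhs_set0.
exact: rkhs_set_lin.
Qed.

HB.instance Definition _ := GRing.isSubmodClosed.Build C (X -> C) rkhs_pred rkhs_submod.

Record rkhs := Rkhs { rkhs_fun : X -> C; rkhs_mem : rkhs_fun \in rkhs_pred }.

HB.instance Definition _ := [isSub for rkhs_fun].
HB.instance Definition _ := [Choice of rkhs by <:].
HB.instance Definition _ := [SubChoice_isSubLmodule of rkhs by <:].

Lemma rkhs_inset (f : rkhs) : rkhs_set k (rkhs_fun f).
Proof. by case: f => f /= /asboolP. Qed.

End RKHS.

Section HilbertRKHS.
Variables (R : realType) (X : Type) (k : X -> X -> R[i]) (kpsd : psd k).
Local Notation C := R[i].

(* A copy of [rkhs k] that carries the positivity of [k], on which the norm axioms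
   depend. *)
Definition rkhs_type (_ : psd k) : Type := rkhs k.
Local Notation H := (rkhs_type kpsd).
HB.instance Definition _ := GRing.Lmodule.on H.

Definition hnorm (f : H) : C := (rkhs_norm k (rkhs_fun f))%:C.

Lemma hnormD (f g : H) : hnorm (f + g) <= hnorm f + hnorm g.
Proof.
rewrite /hnorm -rmorphD lecR; apply: rkhs_norm_le => //; first exact: rkhs_inset.
by apply: kboundD; apply: kbound_rkhs_norm => //; apply: rkhs_inset.
Qed.

Lemma hnormZ (c : C) (f : H) : hnorm (c *: f) = `|c| * hnorm f.
Proof.
have hf := rkhs_inset f.
have hcf : rkhs_set k (c *: rkhs_fun f) by apply: rkhs_setZ.
have E : kinner k (c *: rkhs_fun f) (c *: rkhs_fun f) =
    c * c^* * kinner k (rkhs_fun f) (rkhs_fun f).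
  by rewrite kinnerZl// kinnerZr// mulrA.
have e1 : rkhs_norm k (c *: rkhs_fun f) ^+ 2 = (rnorm c * rkhs_norm k (rkhs_fun f)) ^+ 2.
  apply: complexI; rewrite -(kinner_normE kpsd hcf) E (kinner_normE kpsd hf) mul_conjE exprMn.
  exact: (esym (rmorphM _ _ _)).
rewrite /hnorm rnormE -rmorphM; congr _%:C.
by apply/eqP; rewrite -(@eqrXn2 _ 2) ?mulr_ge0 ?rnorm_ge0 ?rkhs_norm_ge0//; apply/eqP.
Qed.

Lemma hnorm0_eq0 (f : H) : hnorm f = 0 -> f = 0.
Proof.
move=> /complexI f0; apply: val_inj => /=; apply/funext => x.
have := (kbound_rkhs_norm kpsd (rkhs_inset f)).2 [:: (1, x)].
rewrite f0 mul0r kpair1 => h.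
by apply: rnorm0_eq0; apply/eqP; rewrite eq_le h rnorm_ge0.
Qed.

HB.instance Definition _ := Lmodule_isNormed.Build C H hnormD hnormZ hnorm0_eq0.

Lemma rnorm_rkhs (f : H) : rnorm f = rkhs_norm k (rkhs_fun f).
Proof. by []. Qed.

(** Completeness is asked for filters, while [rkhs_complete] is sequential. The centers of balls of
    radius 1/(n+1) that belong to [F] form a Cauchy sequence, since two members of a proper filter
    meet; [F] converges to its limit. *)
Lemma rkhs_cauchy_cvg (F : set_system H) : ProperFilter F -> cauchy F -> cvg F.
Proof.
move=> FF /(@cauchyP C H F FF) Fc.
have e_gt0 n : 0 < (n.+1%:R : R)^-1 by rewrite invr_gt0.
have e_gt0C n : 0 < ((n.+1%:R : R)^-1)%:C by rewrite ltcR.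
have [u hu] := choice (fun n => Fc _ (e_gt0C n)).
have hu' n : F [set h : H | rnorm (u n - h) < n.+1%:R^-1].
  apply: filterS (hu n) => h.
  exact: (@ball_rnorm R H).
have hN (e : R) : 0 < e -> exists N, forall n, (N <= n)%N -> (n.+1%:R : R)^-1 <= e.
  move=> e0; exists (Num.truncn e^-1) => n Nn.
  rewrite invf_ple ?posrE// (le_trans (ltW (truncnS_gt _)))//.
  by rewrite ler_nat ltnS.
have [||f hf hlim] := @rkhs_complete R X k kpsd (fun n => rkhs_fun (u n)).
- by move=> n; apply: rkhs_inset.
- move=> e e0; have e2 : 0 < e / 2 by lra.
  have [N NP] := hN _ e2; exists N => m n Nm Nn.
  have [h [/= hm hn]] := filter_ex (filterI (hu' m) (hu' n)).
  change (rnorm (u m - u n) <= e).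
  have -> : u m - u n = (u m - h) - (u n - h) by rewrite opprB addrA subrK.
  rewrite (le_trans (rnormB _ _))//.
  rewrite [e in leRHS]splitr; apply: lerD; apply: ltW.
    exact: lt_le_trans hm (NP _ Nm).
  exact: lt_le_trans hn (NP _ Nn).
have hfP : f \in rkhs_pred k by apply/asboolP.
apply/cvg_ex; exists (Rkhs hfP : H); apply/cvgrPdist_lt => e e0.
have Ee : e = (complex.Re e)%:C by rewrite RRe_real// gtr0_real.
have {}e0 : 0 < complex.Re e by rewrite -ltcR -Ee.
rewrite Ee; have e2 : 0 < complex.Re e / 2 by lra.
have [N1 h1] := hlim _ e2; have [N2 h2] := hN _ e2.
have {}h1 := h1 _ (leq_maxl N1 N2); have {}h2 := h2 _ (leq_maxr N1 N2).
set n := maxn N1 N2 in h1 h2.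
apply: filterS (hu' n) => h /= hn; rewrite rnormE ltcR.
have -> : (Rkhs hfP : H) - h = ((Rkhs hfP : H) - u n) + (u n - h) by rewrite addrA subrK.
have {}h1 : rnorm ((Rkhs hfP : H) - u n) <= complex.Re e / 2 by exact: h1.
rewrite (le_lt_trans (rnormD _ _))// [complex.Re e in ltRHS]splitr.
apply: ler_ltD => //; exact: lt_le_trans hn h2.
Qed.

HB.instance Definition _ := Uniform_isComplete.Build H rkhs_cauchy_cvg.

Definition rkhs_inner (f g : H) : C := kinner k (rkhs_fun f) (rkhs_fun g).

Lemma rkhs_inner_linearl g : linear_for *%R (rkhs_inner^~ g).
Proof. by move=> c f f'; rewrite /rkhs_inner kinner_linear//; exact: rkhs_inset. Qed.

Lemma rkhs_inner_linearr f : linear_for (Num.conj \; *%R) (rkhs_inner f).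
Proof. by move=> c g g'; rewrite /rkhs_inner kinner_linearr//; exact: rkhs_inset. Qed.


HB.instance Definition _ := @bilinear_isBilinear.Build C H H C *%R (Num.conj \; *%R) rkhs_inner
  (rkhs_inner_linearl, rkhs_inner_linearr).

Lemma rkhs_inner_herm (f g : H) :
  rkhs_inner f g = (-1) ^+ false * Num.conj (rkhs_inner g f).
Proof. by rewrite mul1r /rkhs_inner -kinner_conj//; exact: rkhs_inset. Qed.

HB.instance Definition _ := @isHermitianSesquilinear.Build C H false Num.conj rkhs_inner
  rkhs_inner_herm.

Lemma rkhs_inner_norm (f : H) : rkhs_inner f f = `|f| ^+ 2.
Proof.
by rewrite /rkhs_inner kinner_normE ?rnormE ?rnorm_rkhs ?rmorphXn//; exact: rkhs_inset.
Qed.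

Lemma rkhs_inner_gt0 (f : H) : f != 0 -> 0 < rkhs_inner f f.
Proof. by move=> f0; rewrite rkhs_inner_norm exprn_gt0// normr_gt0. Qed.

HB.instance Definition _ := @isDotProduct.Build C H rkhs_inner rkhs_inner_gt0.

HB.instance Definition _ := @isHilbert.Build R H rkhs_inner rkhs_inner_norm.
End HilbertRKHS.

(** * Coefficients of unitary representations *)

Section HilbertTheory.
Variables (R : realType) (H : hilbertType R).
Local Notation C := R[i].
Implicit Types x y z : H.

Lemma innerDl x y z : inner (x + y) z = inner x z + inner y z.
Proof. exact: linearDl. Qed.

Lemma innerDr x y z : inner x (y + z) = inner x y + inner x z.
Proof. exact: linearDr. Qed.

Lemma innerZl (c : C) x z : inner (c *: x) z = c * inner x z.
Proof. exact: linearZl_LR. Qed.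

Lemma innerZr (c : C) x z : inner x (c *: z) = c^* * inner x z.
Proof. exact: linearZr_LR. Qed.

Lemma innerNl x z : inner (- x) z = - inner x z.
Proof. exact: linearNl. Qed.

Lemma innerNr x z : inner x (- z) = - inner x z.
Proof. exact: linearNr. Qed.

Lemma inner0l x : inner 0 x = 0.
Proof. exact: linear0l. Qed.

Lemma inner0r x : inner x 0 = 0.
Proof. exact: linear0r. Qed.

Lemma inner_conj x y : inner y x = (inner x y)^*.
Proof. by rewrite hermC expr0 mul1r. Qed.

Lemma inner_self x : inner x x = (rnorm x ^+ 2)%:C.
Proof. by rewrite inner_norm rnormE rmorphXn. Qed.

Lemma inner_suml (I : Type) (s : seq I) (F : I -> H) z :
  inner (\sum_(i <- s) F i) z = \sum_(i <- s) inner (F i) z.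
Proof.
elim: s => [|i s IH]; first by rewrite !big_nil inner0l.
by rewrite !big_cons innerDl IH.
Qed.

Lemma inner_sumr (I : Type) (s : seq I) (F : I -> H) z :
  inner z (\sum_(i <- s) F i) = \sum_(i <- s) inner z (F i).
Proof.
elim: s => [|i s IH]; first by rewrite !big_nil inner0r.
by rewrite !big_cons innerDr IH.
Qed.

Lemma rnorm_sqrD x y :
  rnorm (x + y) ^+ 2 = rnorm x ^+ 2 + rnorm y ^+ 2 + 2 * complex.Re (inner x y).
Proof.
have := inner_self (x + y); rewrite innerDl !innerDr !inner_self (inner_conj x y).
move/(congr1 (@complex.Re R)); rewrite !raddfD /=.
by case: (inner x y) => a b /= <-; ring.
Qed.

Lemma rnorm_sqrB x y :
  rnorm (x - y) ^+ 2 = rnorm x ^+ 2 + rnorm y ^+ 2 - 2 * complex.Re (inner x y).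
Proof. by rewrite rnorm_sqrD rnormN innerNr raddfN mulrN. Qed.

Lemma inner_cs x y : rnorm (inner x y) <= rnorm x * rnorm y.
Proof.
have [|_ _ _ _ [_]] := @psd2 R (inner x x) (inner x y) (inner y x) (inner y y).
  move=> z w; have := sqr_ge0 (rnorm (z *: x + w *: y)).
  rewrite -ler0c -inner_self innerDl !innerDr !innerZl !innerZr => h.
  by apply: le_trans h _; rewrite le_eqVlt; apply/orP; left; apply/eqP; ring.
rewrite !inner_self /= => h.
by rewrite -ler_sqr ?nnegrE ?rnorm_ge0 ?mulr_ge0 ?rnorm_ge0// exprMn.
Qed.

End HilbertTheory.

Section Blocks.
Variables (R : realType) (G : topologicalGroupType).
Local Notation C := R[i].
Implicit Types (u : G -> C) (Phi : bool -> bool -> G -> C) (r : R).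

Definition ccont u : Prop :=
  forall g (e : R), 0 < e -> \forall h \near g, rnorm (u h - u g) <= e.

(** If [Phi b c g] is the inner product of [pi g z_b] and [z_c], this is the Gram kernel of the
    vectors [pi g z_b]. *)
Definition bker Phi (p q : G * bool) : C := Phi p.2 q.2 (q.1^-1 * p.1)%g.

(* By the GNS construction below, these are the coefficients [g |-> <pi g x, y>] with
   [|x|^2 <= r] and [|y|^2 <= r]; in terms of [Phi] they are stable under sums,
   products and limits without any operation on Hilbert spaces. *)
Definition dominated u r : Prop := exists Phi,
  [/\ psd (bker Phi), forall b, ccont (Phi b b), Phi true false = u &
      forall b, complex.Re (Phi b b 1%g) <= r].

Lemma dominated0 : dominated 0 0.
Proof.
exists (fun _ _ _ => 0); split => //.
  move=> v; rewrite /kpair big1// => q _; rewrite /kcomb big1 ?mulr0// => p _.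
  by rewrite mulr0.
by move=> b g e e0; near=> h; rewrite subrr rnorm0 ltW.
Unshelve. all: by end_near. Qed.

Lemma dominatedW u r s : r <= s -> dominated u r -> dominated u s.
Proof.
move=> rs [Phi [h1 h2 h3 h4]]; exists Phi; split => // b.
exact: le_trans (h4 b) rs.
Qed.

Lemma coefficient_block u (H : hilbertType R) (pi : G -> H -> H) x y r :
  is_coefficient u pi x y -> rnorm x ^+ 2 <= r -> rnorm y ^+ 2 <= r -> dominated u r.
Proof.
move=> [[pl iso p1 pM pc] ->] xr yr.
pose z b := if b then x else y.
exists (fun b c g => inner (pi g (z b)) (z c)); split => //.
- move=> v; pose S := \sum_(p <- v) p.1 *: pi p.2.1 (z p.2.2).
  have -> : kpair (kcomb (bker (fun b c g => inner (pi g (z b)) (z c))) v) v = inner S S.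
    rewrite /kpair /S inner_sumr; apply: eq_bigr => q _.
    rewrite innerZr inner_suml; congr (_ * _).
    rewrite /kcomb; apply: eq_bigr => p _; rewrite innerZl /bker; congr (_ * _).
    by rewrite pM -(iso q.2.1) -pM mulgV p1.
  by rewrite inner_self ler0c sqr_ge0.
- move=> b g e e0; have z1 : 0 < rnorm (z b) + 1 by rewrite ltr_wpDl ?rnorm_ge0.
  have e1 := divr_gt0 e0 z1; rewrite -ltcR in e1.
  have /cvgrPdist_lt/(_ _ e1) := pc (z b) g; apply: filterS => h.
  rewrite rnormE ltcR rnorm_distC => hh; rewrite -innerNl -innerDl.
  rewrite (le_trans (inner_cs _ _))//.
  rewrite (le_trans (ler_wpM2r (rnorm_ge0 _) (ltW hh)))//.
  rewrite -mulrA ler_piMr ?(ltW e0)// mulrC ler_pdivrMr//; lra.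
- by move=> b; rewrite p1 inner_self /=; case: b.
Qed.

(** A block function bounds both vectors by the same [r]. Replacing x, y by t x, y / t with t^2 =
    |y|/|x| makes both squared norms equal to |x||y|; if one of the vectors is zero, so is [u]. *)
Lemma coefficient_dominated u (H : hilbertType R) (pi : G -> H -> H) x y :
  is_coefficient u pi x y -> dominated u (rnorm x * rnorm y).
Proof.
move=> upi; have [pr uE] := upi.
have [x0|x0] := eqVneq (rnorm x) 0.
  suff -> : u = 0 by rewrite x0 mul0r; apply: dominated0.
  rewrite uE (rnorm0_eq0 x0); apply/funext => g.
  have [pl _ _ _ _] := pr; have /= := pl g (-1) 0 0.
  by rewrite scaler0 addr0 scaleN1r addNr => ->; rewrite inner0l.
have [y0|y0] := eqVneq (rnorm y) 0.
  suff -> : u = 0 by rewrite y0 mulr0; apply: dominated0.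
  by rewrite uE (rnorm0_eq0 y0); apply/funext => g; rewrite inner0r.
have xp : 0 < rnorm x by rewrite lt_def x0 rnorm_ge0.
have yp : 0 < rnorm y by rewrite lt_def y0 rnorm_ge0.
pose t := Num.sqrt (rnorm y / rnorm x).
have tp : 0 < t by rewrite sqrtr_gt0 divr_gt0.
have t2 : t ^+ 2 = rnorm y / rnorm x by rewrite sqr_sqrtr ?divr_ge0 ?rnorm_ge0.
apply: (@coefficient_block u H pi (t%:C *: x) ((t^-1)%:C *: y)).
- split => //; rewrite uE; apply/funext => g.
  have [pl _ _ _ _] := pr; have /= h0 := pl g (-1) 0 0.
  have {}h0 : pi g 0 = 0 by rewrite scaler0 addr0 scaleN1r addNr in h0.
  rewrite -[t%:C *: x]addr0 pl h0 addr0 innerZl innerZr.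
  have -> : ((t^-1)%:C)^* = (t^-1)%:C by apply/CrealP/complex_realP; exists t^-1.
  by rewrite mulrA -rmorphM divff ?mul1r// gt_eqF.
- rewrite rnormZ rnorm_real (gtr0_norm tp) exprMn t2.
  by rewrite le_eqVlt; apply/orP; left; apply/eqP; field.
- rewrite rnormZ rnorm_real gtr0_norm ?invr_gt0// exprMn exprVn t2.
  by rewrite le_eqVlt; apply/orP; left; apply/eqP; field; rewrite x0 y0.
Qed.

End Blocks.

Section Translations.
Variable G : topologicalGroupType.

Lemma lmulg_continuous (a : G) : continuous (fun x => (a * x)%g).
Proof.
move=> x; apply: (@continuous_comp _ _ _ (fun x => (a, x)) (fun xy : G * G => (xy.1 * xy.2)%g)).
  by apply: cvg_pair; [exact: cvg_cst|exact: cvg_id].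
exact: mulg_continuous.
Qed.

Lemma rmulg_continuous (a : G) : continuous (fun x => (x * a)%g).
Proof.
move=> x; apply: (@continuous_comp _ _ _ (fun x => (x, a)) (fun xy : G * G => (xy.1 * xy.2)%g)).
  by apply: cvg_pair; [exact: cvg_id|exact: cvg_cst].
exact: mulg_continuous.
Qed.

End Translations.

(** * The GNS construction for a block function *)

Section GNS.
Variables (R : realType) (G : topologicalGroupType).
Local Notation C := R[i].
Variable Phi : bool -> bool -> G -> C.
Local Notation X := (G * bool)%type.
Local Notation k := (bker Phi).
Hypothesis kpsd : psd k.
Hypothesis Phic : forall b, ccont (Phi b b).
Local Notation H := (rkhs_type kpsd).
Implicit Types (v w : seq (C * X)) (g : G) (x : X).

Definition tpoint g x : X := ((g * x.1)%g, x.2).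
Definition tcomb g v : seq (C * X) := [seq (p.1, tpoint g p.2) | p <- v].
Definition tfun g (f : X -> C) : X -> C := fun x => f (tpoint g^-1%g x).

Lemma tpointK g x : tpoint g^-1%g (tpoint g x) = x.
Proof. by case: x => x b; rewrite /tpoint /= mulgA mulVg mul1g. Qed.

Lemma tpointVK g x : tpoint g (tpoint g^-1%g x) = x.
Proof. by case: x => x b; rewrite /tpoint /= mulgA mulgV mul1g. Qed.

Lemma tcombVK g v : tcomb g (tcomb g^-1%g v) = v.
Proof.
rewrite /tcomb -map_comp -[RHS]map_id; apply: eq_map => -[c x] /=.
by rewrite tpointVK.
Qed.

Lemma bker_inv g x y : k (tpoint g x) (tpoint g y) = k x y.
Proof. by rewrite /bker /= invgM -!mulgA (mulgA g^-1%g) mulVg mul1g. Qed.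

Lemma kpair_tfun g (f : X -> C) v : kpair (tfun g f) (tcomb g v) = kpair f v.
Proof. by rewrite /kpair big_map; apply: eq_bigr => p _; rewrite /tfun /= tpointK. Qed.

Lemma kcomb_tcomb g v : kcomb k (tcomb g v) = tfun g (kcomb k v).
Proof.
apply/funext => y; rewrite /tfun /kcomb big_map; apply: eq_bigr => p _ /=.
by rewrite -(bker_inv g _ (tpoint g^-1%g y)) tpointVK.
Qed.

Lemma knorm_tcomb g v : knorm k (tcomb g v) = knorm k v.
Proof. by rewrite /knorm /kform kcomb_tcomb kpair_tfun. Qed.

Lemma kbound_tfun g (f : X -> C) M : kbound k f M -> kbound k (tfun g f) M.
Proof.
move=> [M0 h]; split => // w.
by rewrite -(tcombVK g w) kpair_tfun knorm_tcomb.
Qed.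

Lemma rkhs_set_tfun g (f : X -> C) : rkhs_set k f -> rkhs_set k (tfun g f).
Proof.
move=> hf e /hf[v hv]; exists (tcomb g v).
by rewrite kcomb_tcomb; exact: (kbound_tfun g hv).
Qed.

Lemma tfun_mem g (f : H) : tfun g (rkhs_fun f) \in rkhs_pred k.
Proof. by apply/asboolP/rkhs_set_tfun/rkhs_inset. Qed.

Definition gns g (f : H) : H := Rkhs (tfun_mem g f).

Lemma gns_linear g : linear (gns g).
Proof. by move=> c f f'; apply: val_inj. Qed.

Lemma gns1 (f : H) : gns 1%g f = f.
Proof.
apply: val_inj; apply/funext => -[x b] /=.
by rewrite /tfun /tpoint /= invg1 mul1g.
Qed.

Lemma gnsM g h (f : H) : gns (g * h)%g f = gns g (gns h f).
Proof.
apply: val_inj; apply/funext => -[x b] /=.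
by rewrite /tfun /tpoint /= invgM mulgA.
Qed.

(** The kernel is invariant under left translation, so translating both a function and the
    combination paired with it changes nothing; [kinner_eq] carries this to the limit. *)
Lemma gns_isometry g (f f' : H) : inner (gns g f) (gns g f') = inner f f'.
Proof.
have hf := rkhs_inset f; have hf' := rkhs_inset f'.
have [M fM] := rkhs_set_bound kpsd hf.
apply: (kinner_eq kpsd (M := M)); [exact: rkhs_set_tfun|exact: rkhs_set_tfun|exact: fM.1|].
move=> v e hv; rewrite -(tcombVK g v) kpair_tfun.
apply: (kinnerP kpsd hf hf' fM).
have := kbound_tfun g^-1%g hv; congr kbound.
apply/funext => x; rewrite /tfun /= /tfun.
rewrite -[RHS]/(rkhs_fun f' x - kcomb k (tcomb g^-1%g v) x) kcomb_tcomb /tfun.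
by rewrite -[LHS]/(rkhs_fun f' (tpoint g^-1%g (tpoint g^-1^-1%g x)) - _) tpointVK.
Qed.

Lemma rnorm_gns g (f : H) : rnorm (gns g f) = rnorm f.
Proof.
have := gns_isometry g f f; rewrite !inner_self => /complexI/eqP.
by rewrite eqrXn2 ?rnorm_ge0// => /eqP.
Qed.

Definition hcomb v : H := Rkhs (asboolT (rkhs_set_comb k v)).

Lemma hcomb_cons c x v : hcomb ((c, x) :: v) = c *: hcomb [:: (1, x)] + hcomb v.
Proof.
apply: val_inj => /=; rewrite -cat1s kcomb_cat -kcomb_scale; congr (_ + _).
by rewrite /kscale /= mulr1.
Qed.

Lemma hcomb_nil : hcomb [::] = 0.
Proof. by apply: val_inj => /=; apply: kcomb_nil. Qed.

(** The reproducing property: it turns coefficients at kernel vectors into values of [k]. *)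
Lemma inner_hcomb1 (f : H) x : inner f (hcomb [:: (1, x)]) = rkhs_fun f x.
Proof.
rewrite -[LHS]/(kinner k (rkhs_fun f) (kcomb k [:: (1, x)])).
by rewrite kinner_comb ?kpair1//; exact: rkhs_inset.
Qed.

Lemma rkhs_fun_hcomb1 x y : rkhs_fun (hcomb [:: (1, x)]) y = k x y.
Proof. by rewrite /= kcomb1. Qed.

(** For a unitary representation, |pi g f - pi g0 f|^2 = 2 |f|^2 - 2 Re <pi g f, pi g0 f>. At a
    kernel vector this involves only a diagonal block, which is why [dominated] asks continuity of
    the diagonal alone. *)
Lemma gns_continuous_pt x g0 (e : R) : 0 < e ->
  \forall g \near g0, rnorm (gns g (hcomb [:: (1, x)]) - gns g0 (hcomb [:: (1, x)])) <= e.
Proof.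
move=> e0; set f := hcomb _.
have cj : {for g0, continuous (fun g => (x.1^-1 * (g0^-1 * g) * x.1)%g)}.
  apply: (@continuous_comp _ _ _ (fun g => (x.1^-1 * (g0^-1 * g))%g) (fun g => (g * x.1)%g)).
    apply: (@continuous_comp _ _ _ (fun g => (g0^-1 * g)%g) (fun g => (x.1^-1 * g)%g)).
      exact: lmulg_continuous.
    exact: lmulg_continuous.
  exact: rmulg_continuous.
have e2 : 0 < e ^+ 2 / 2 by rewrite divr_gt0 ?exprn_gt0.
have hnear : \forall g \near g0, rnorm (Phi x.2 x.2 (x.1^-1 * (g0^-1 * g) * x.1)%g -
    Phi x.2 x.2 (x.1^-1 * (g0^-1 * g0) * x.1)%g) <= e ^+ 2 / 2.
  exact: (cj _ (Phic x.2 (x.1^-1 * (g0^-1 * g0) * x.1)%g e2)).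
move: hnear; rewrite mulVg mulg1 mulVg; apply: filterS => g hg.
rewrite -ler_sqr ?nnegrE ?rnorm_ge0 ?(ltW e0)// rnorm_sqrB !rnorm_gns.
have -> : inner (gns g f) (gns g0 f) = Phi x.2 x.2 (x.1^-1 * (g0^-1 * g) * x.1)%g.
  rewrite -(gns_isometry g0^-1%g) -!gnsM mulVg gns1 inner_hcomb1 /= /tfun kcomb1 /bker /tpoint /=.
  by rewrite !invgM !invgK !mulgA.
have -> : rnorm f ^+ 2 = complex.Re (Phi x.2 x.2 1%g).
  have /(congr1 (@complex.Re R)) := inner_self f.
  by rewrite inner_hcomb1 rkhs_fun_hcomb1 /bker mulVg => ->.
have := le_trans (ler_normRe_rnorm _) hg; rewrite raddfB ler_norml => /andP[].
lra.
Qed.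

Lemma gns_continuous (f : H) : continuous (fun g => gns g f).
Proof.
move=> g0; apply/cvgrPdist_le => e e0.
have Ee : e = (complex.Re e)%:C by rewrite RRe_real// gtr0_real.
have {}e0 : 0 < complex.Re e by rewrite -ltcR -Ee.
rewrite Ee; move: (complex.Re e) e0 => {Ee}e e0.
suff : \forall g \near g0, rnorm (gns g f - gns g0 f) <= e.
  by apply: filterS => g hg; rewrite rnormE lecR rnorm_distC.
have hv v (d : R) : 0 < d ->
    \forall g \near g0, rnorm (gns g (hcomb v) - gns g0 (hcomb v)) <= d.
  elim: v d => [|[c x] v IH] d d0.
    have hz h : gns h (0 : H) = 0 by apply: val_inj.
    by near=> g; rewrite hcomb_nil !hz subrr rnorm0 ltW.
  have d2 : 0 < d / 2 by lra.
  have c1 : 0 < rnorm c + 1 by rewrite ltr_wpDl ?rnorm_ge0.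
  apply: filterS2 (gns_continuous_pt x g0 (divr_gt0 d2 c1)) (IH _ d2) => g h1 h2.
  rewrite hcomb_cons !gns_linear opprD addrACA -scalerBr.
  rewrite (le_trans (rnormD _ _))// [d]splitr; apply: lerD => //.
  rewrite rnormZ (le_trans (ler_wpM2l (rnorm_ge0 _) h1))// mulrCA ler_piMr ?(ltW d2)//.
  by rewrite ler_pdivrMr//; lra.
have e3 : 0 < e / 3 by lra.
have [v hfv] := rkhs_inset f e3.
have {}hfv : rnorm (f - hcomb v) <= e / 3.
  apply: rkhs_norm_le => //; exact: (rkhs_inset (f - hcomb v)).
apply: filterS (hv v _ e3) => g hg.
have -> : gns g f - gns g0 f = gns g (f - hcomb v) +
    ((gns g (hcomb v) - gns g0 (hcomb v)) - gns g0 (f - hcomb v)).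
  have hB h : gns h (f - hcomb v) = gns h f - gns h (hcomb v) by apply: val_inj.
  by rewrite !hB opprB [X in _ = _ + X]addrA subrK addrA subrK.
rewrite (le_trans (rnormD _ _))// rnorm_gns.
rewrite (le_trans (lerD (lexx _) (rnormB _ _)))// rnorm_gns.
rewrite (le_trans (lerD hfv (lerD hg hfv)))//; lra.
Unshelve. all: by end_near. Qed.

Lemma gns_unitary : unitary_rep gns.
Proof.
split; [exact: gns_linear|exact: gns_isometry|exact: gns1|exact: gnsM|exact: gns_continuous].
Qed.

End GNS.

Section FourierStieltjes.
Variables (R : realType) (G : topologicalGroupType).
Local Notation C := R[i].
Implicit Types (u v : G -> C) (r : R).

Lemma dominated_ge0 u r : dominated u r -> 0 <= r.
Proof.
move=> [Phi [h1 _ _ h2]]; apply: le_trans (h2 true).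
by have [_] := kernel_self h1 (1%g, true); rewrite /bker mulVg.
Qed.

Lemma dominated_coefficient u r : dominated u r ->
  exists (H : hilbertType R) (pi : G -> H -> H) (x y : H),
    [/\ is_coefficient u pi x y, rnorm x ^+ 2 <= r & rnorm y ^+ 2 <= r].
Proof.
move=> [Phi [h1 h2 h3 h4]].
pose x b := hcomb h1 [:: (1, (1%g : G, b))].
have nx b : rnorm (x b) ^+ 2 <= r.
  have /(congr1 (@complex.Re R)) := inner_self (x b).
  by rewrite inner_hcomb1 rkhs_fun_hcomb1 /bker mulVg => E; apply: le_trans (h4 b); rewrite E.
exists (rkhs_type h1), (gns (kpsd := h1)), (x true), (x false); split; [|exact: nx|exact: nx].
split; first exact: (gns_unitary h1 h2).
apply/funext => g; rewrite inner_hcomb1 /= /tfun kcomb1 /bker /tpoint /=.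
by rewrite h3 !mulg1 invgK.
Qed.

Lemma fs_norm_dominated u r : dominated u r -> fourier_stieltjes u /\ fs_norm u <= r.
Proof.
move=> ur; have r0 := dominated_ge0 ur.
have [H [pi [x [y [upi hx hy]]]]] := dominated_coefficient ur.
split; first by exists H, pi, x, y.
have xy : rnorm x * rnorm y <= r.
  rewrite -ler_sqr ?nnegrE ?mulr_ge0 ?rnorm_ge0// exprMn [r ^+ 2]expr2.
  by rewrite ler_pM ?sqr_ge0.
apply: le_trans xy; apply: ge_inf.
  by exists 0 => s [H' [pi' [x' [y' [_ E]]]]]; rewrite -ler0c E mulr_ge0.
by exists H, pi, x, y; split => //; rewrite !rnormE rmorphM.
Qed.

(** The inequality is strict because the infimum need not be attained. With [fs_norm_dominated] it
    makes [fs_norm u] the infimum of all [r] with [dominated u r]. *)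
Lemma fs_norm_lt u r : fourier_stieltjes u -> fs_norm u < r -> dominated u r.
Proof.
move=> [H [pi [x [y upi]]]] ur.
have [|s [H' [pi' [x' [y' [upi' E]]]]] sr] := inf_lt _ ur.
  by exists (rnorm x * rnorm y), H, pi, x, y; split => //; rewrite !rnormE rmorphM.
have := coefficient_dominated upi'; apply: dominatedW; apply: ltW.
suff -> : rnorm x' * rnorm y' = s by [].
by apply: complexI; rewrite E !rnormE rmorphM.
Qed.

(** The tool for lower bounds: it suffices to treat an arbitrary block function that bounds [u]. *)
Lemma fs_norm_leP u r : fourier_stieltjes u ->
  (forall s, dominated u s -> r <= s) -> r <= fs_norm u.
Proof.
move=> uB h; apply/ler_addgt0Pr => e e0; apply: h; apply: fs_norm_lt => //.
by rewrite ltrDl.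
Qed.

Lemma fs_norm_ge0 u : fourier_stieltjes u -> 0 <= fs_norm u.
Proof. by move=> uB; apply: fs_norm_leP => // s; apply: dominated_ge0. Qed.

End FourierStieltjes.

(** * The Banach algebra of coefficients *)

Section Schur.
Variables (R : realType) (X : Type).
Local Notation C := R[i].
Implicit Types (k : X -> X -> C) (v w : seq (C * X)).

Lemma kcombD k k' v : kcomb (fun x y => k x y + k' x y) v = kcomb k v + kcomb k' v.
Proof.
apply/funext => y; rewrite -[RHS]/(kcomb k v y + kcomb k' v y) /kcomb -big_split.
by apply: eq_bigr => p _; rewrite mulrDr.
Qed.

Lemma psdD k k' : psd k -> psd k' -> psd (fun x y => k x y + k' x y).
Proof. by move=> h h' v; rewrite kcombD kpairD addr_ge0. Qed.

Lemma psd0 : psd (fun _ _ : X => 0 : C).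
Proof.
move=> v; rewrite /kpair big1// => q _; rewrite /kcomb big1 ?mulr0// => p _.
by rewrite mulr0.
Qed.

Definition schur_compl k x0 x y : C := k x y - k x x0 * k x0 y / k x0 x0.

(** The new form at v is <v,v> - |<v,x0>|^2 / <x0,x0>, which is nonnegative by Cauchy-Schwarz. When
    [k x0 x0] is 0, the convention [0^-1 = 0] leaves [k] unchanged. *)
Lemma psd_schur_compl k x0 : psd k -> psd (schur_compl k x0).
Proof.
move=> kpsd v; have [F1 F2 G1 G2 [h1 h2]] := kform_psd2 kpsd v [:: (1, x0)].
pose A := kcomb k v x0.
have EA : kform k v [:: (1, x0)] = A by rewrite /kform kpair1.
have E0 : kform k [:: (1, x0)] [:: (1, x0)] = k x0 x0 by rewrite /kform kpair1 kcomb1.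
have EA' : kpair (k x0) v = A^* by rewrite -EA -h1 /kform kcomb1.
have -> : kcomb (schur_compl k x0) v = kcomb k v - (A / k x0 x0) *: k x0.
  apply/funext => y; rewrite -[RHS]/(kcomb k v y - (A / k x0 x0) * k x0 y).
  rewrite /A /kcomb !mulr_suml -sumrB; apply: eq_bigr => p _.
  by rewrite /schur_compl mulrBr !mulrA; congr (_ - _); ring.
rewrite kpairB kpairZ EA' -/(kform k v v) F1.
rewrite E0 in G1 G2 h2; rewrite EA in h2.
set a := complex.Re (k x0 x0) in G1 G2 h2; set f := complex.Re _ in F1 F2 h2 *.
rewrite G1 mulrAC mul_conjE -fmorph_div -rmorphB ler0c subr_ge0.
have [a0|a0] := eqVneq a 0; first by rewrite a0 invr0 mulr0.
by rewrite ler_pdivrMr// lt_def a0.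
Qed.

Lemma schur_compl0l k x0 y : psd k -> schur_compl k x0 x0 y = 0.
Proof.
move=> kpsd; rewrite /schur_compl; have [k0|k0] := eqVneq (k x0 x0) 0.
  have := kernel_cs kpsd x0 y; rewrite k0 /= mul0r => h.
  have -> : k x0 y = 0.
    apply: rnorm0_eq0; apply/eqP; rewrite -sqrf_eq0 eq_le h sqr_ge0//.
  by rewrite !mul0r subr0.
by rewrite mulrAC divff// mul1r subrr.
Qed.

Lemma schur_compl0r k x0 x : psd k -> schur_compl k x0 x x0 = 0.
Proof.
move=> kpsd; rewrite (kernel_conj (psd_schur_compl x0 kpsd) x0 x).
by rewrite schur_compl0l// conjC0.
Qed.

Lemma psd_reweight k (b : X -> C) : psd k -> psd (fun x y => k x y * (b x * (b y)^*)).
Proof.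
move=> kpsd v; have := kpsd [seq (p.1 * b p.2, p.2) | p <- v].
congr (0 <= _); rewrite /kpair big_map; apply: eq_bigr => q _ /=.
rewrite rmorphM -mulrA; congr (_ * _).
rewrite /kcomb big_map mulr_sumr; apply: eq_bigr => p _ /=; ring.
Qed.

(* Removing the rank-one part of [k'] through [x0] leaves a positive kernel that
   vanishes on the row and column of [x0]; hence induction on the list. *)
Lemma psdM k k' : psd k -> psd k' -> psd (fun x y => k x y * k' x y).
Proof.
move=> kpsd k'psd v; elim: v k' k'psd => [|[c x0] v IH] k' k'psd.
  by rewrite /kpair big_nil.
pose a := complex.Re (k' x0 x0).
have [Ea a0] := kernel_self k'psd x0; rewrite -/a in Ea a0.
(* With this [t], the product of [b x] and the conjugate of [b y] is exactly what [schur_compl]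
   subtracts; for a = 0 both vanish. *)
pose t := (Num.sqrt a)^-1.
have t2 : t * t = a^-1 by rewrite -invfM -expr2 sqr_sqrtr.
pose b x := k' x x0 * t%:C.
have Eb x y : k' x y = b x * (b y)^* + schur_compl k' x0 x y.
  rewrite /schur_compl /b (kernel_conj k'psd y x0) Ea -(fmorphV (real_complex R)) -t2.
  rewrite !rmorphM /= (_ : (t%:C)^* = t%:C); last by apply/CrealP/complex_realP; exists t.
  ring.
have -> : (fun x y => k x y * k' x y) =
  (fun x y => k x y * (b x * (b y)^*) + k x y * schur_compl k' x0 x y).
  by apply/funext => x; apply/funext => y; rewrite {1}Eb mulrDr.
rewrite kcombD kpairD addr_ge0//; first exact: psd_reweight.
have := IH _ (psd_schur_compl x0 k'psd); set k'' := fun x y => _.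
have k0l y : k'' x0 y = 0 by rewrite /k'' schur_compl0l ?mulr0.
have k0r x : k'' x x0 = 0 by rewrite /k'' schur_compl0r ?mulr0.
have Ev : kcomb k'' ((c, x0) :: v) = kcomb k'' v.
  by apply/funext => y; rewrite /kcomb big_cons /= k0l mulr0 add0r.
rewrite Ev /kpair big_cons /= -/(kpair _ _).
suff -> : kcomb k'' v x0 = 0 by rewrite mulr0 add0r.
by rewrite /kcomb big1// => p _; rewrite k0r mulr0.
Qed.

Lemma kcomb_seq_lim (F : nat -> X -> X -> C) k v y :
  (forall x y, seq_lim (fun n => F n x y) (k x y)) ->
  seq_lim (fun n => kcomb (F n) v y) (kcomb k v y).
Proof.
move=> h.
have E (k1 : X -> X -> C) : kcomb k1 v y = kpair (fun x => k1 x y) [seq (p.1^*, p.2) | p <- v].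
  by rewrite /kpair big_map; apply: eq_bigr => p _ /=; rewrite conjCK.
rewrite E; under eq_fun do rewrite E.
exact: kpair_seq_lim.
Qed.

Lemma seq_lim_ge0 (u : nat -> C) l : seq_lim u l -> (forall n, 0 <= u n) -> 0 <= l.
Proof.
move=> ul u0; have E n : u n = (complex.Re (u n))%:C by rewrite RRe_real// ger0_real.
have Iml : complex.Im l = 0.
  apply/eqP; rewrite -normr_le0; apply/ler_addgt0Pl => e e0; rewrite addr0.
  have [N /(_ N (leqnn N))] := ul _ e0; rewrite E => h.
  rewrite -normrN; apply: le_trans h; apply: le_trans (ler_normIm_rnorm _).
  by rewrite raddfB /= sub0r.
have Rel : 0 <= complex.Re l.
  rewrite -oppr_le0; apply/ler_addgt0Pl => e e0; rewrite addr0.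
  have [N /(_ N (leqnn N))] := ul _ e0; have := u0 N; rewrite E ler0c => h0 h.
  have := le_trans (ler_normRe_rnorm _) h; rewrite raddfB /= ler_norml; lra.
by case: l Iml Rel {ul} => x y /= -> ?; rewrite -[_ +i* 0]/(x%:C) ler0c.
Qed.

Lemma psd_seq_lim (F : nat -> X -> X -> C) k :
  (forall n, psd (F n)) -> (forall x y, seq_lim (fun n => F n x y) (k x y)) -> psd k.
Proof.
move=> Fpsd Fk v.
apply: (@seq_lim_ge0 (fun n => kpair (kcomb (F n) v) v)); last by move=> n; apply: Fpsd.
by apply: kpair_seq_lim => y; apply: kcomb_seq_lim.
Qed.

End Schur.

Section Dominated.
Variables (R : realType) (G : topologicalGroupType).
Local Notation C := R[i].
Implicit Types (u v : G -> C) (r s : R).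

Lemma ccontD u v : ccont u -> ccont v -> ccont (u + v).
Proof.
move=> uc vc g e e0; have e2 : 0 < e / 2 by lra.
apply: filterS2 (uc g _ e2) (vc g _ e2) => h h1 h2.
rewrite -[(u + v) h]/(u h + v h) -[(u + v) g]/(u g + v g) opprD addrACA [e]splitr.
by rewrite (le_trans (rnormD _ _))// lerD.
Qed.

Lemma ccontM u v : ccont u -> ccont v -> ccont (u * v).
Proof.
move=> uc vc g e e0.
have U0 : 0 < rnorm (u g) + 1 by rewrite ltr_wpDl ?rnorm_ge0.
have V0 : 0 < rnorm (v g) + 1 by rewrite ltr_wpDl ?rnorm_ge0.
have e2 : 0 < e / 2 by lra.
apply: filterS3 (uc g _ ltr01) (uc g _ (divr_gt0 e2 V0)) (vc g _ (divr_gt0 e2 U0)).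
move=> h h0 h1 h2.
rewrite -[(u * v) h]/(u h * v h) -[(u * v) g]/(u g * v g).
have -> : u h * v h - u g * v g = u h * (v h - v g) + (u h - u g) * v g by ring.
rewrite (le_trans (rnormD _ _))// !rnormM [e]splitr lerD//.
  have h3 : rnorm (u h) <= rnorm (u g) + 1.
    rewrite (_ : u h = u g + (u h - u g)) ?(le_trans (rnormD _ _)) ?lerD2l//.
    by rewrite addrC subrK.
  rewrite (le_trans (ler_pM (rnorm_ge0 _) (rnorm_ge0 _) h3 h2))//.
  by rewrite mulrC divfK// gt_eqF.
rewrite (le_trans (ler_wpM2r (rnorm_ge0 _) h1))//.
rewrite -mulrA ler_piMr ?(ltW e2)// mulrC ler_pdivrMr//; lra.
Qed.

Lemma dominatedD u v r s : dominated u r -> dominated v s -> dominated (u + v) (r + s).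
Proof.
move=> [P [p1 p2 p3 p4]] [Q [q1 q2 q3 q4]].
exists (fun b c => P b c + Q b c); split => [|b||b].
- exact: (psdD p1 q1).
- exact: ccontD.
- by rewrite p3 q3.
- change (complex.Re (P b b 1%g + Q b b 1%g) <= r + s).
  by rewrite raddfD; apply: (lerD (p4 b) (q4 b)).
Qed.

Lemma block_diag Phi b : psd (bker Phi) ->
  Phi b b 1%g = (complex.Re (Phi b b (1%g : G)))%:C :> C /\ 0 <= complex.Re (Phi b b 1%g).
Proof. by move=> h; have := kernel_self h (1%g, b); rewrite /bker mulVg. Qed.

Lemma dominatedM u v r s : dominated u r -> dominated v s -> dominated (u * v) (r * s).
Proof.
move=> [P [p1 p2 p3 p4]] [Q [q1 q2 q3 q4]].
exists (fun b c => P b c * Q b c); split => [|b||b].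
- exact: (psdM p1 q1).
- exact: ccontM.
- by rewrite p3 q3.
- change (complex.Re (P b b 1%g * Q b b 1%g) <= r * s).
  have [-> Pb] := block_diag b p1; have [-> Qb] := block_diag b q1.
  by rewrite -rmorphM /= ler_pM.
Qed.

(** Multiplying every entry of a block function by a complex number would destroy positivity, so the
    factor is moved onto the vector [y] of a representation. *)
Lemma dominatedZ (c : C) u r : dominated u r -> dominated (c *: u) (rnorm c * r).
Proof.
move=> ur; have r0 := dominated_ge0 ur.
have [H [pi [x [y [[upi uE] hx hy]]]]] := dominated_coefficient ur.
have : is_coefficient (c *: u) pi x (c^* *: y).
  by split => //; apply/funext => g; rewrite innerZr conjCK uE.
move=> /coefficient_dominated; apply: dominatedW.
rewrite rnormZ rnorm_conj mulrCA ler_wpM2l ?rnorm_ge0//.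
rewrite -ler_sqr ?nnegrE ?mulr_ge0 ?rnorm_ge0// exprMn [r ^+ 2]expr2.
by rewrite ler_pM ?sqr_ge0.
Qed.

(** Cauchy-Schwarz for the kernel at the points (g, b) and (1, c); the bound is uniform in g. *)
Lemma block_bound Phi b c g r : psd (bker Phi) ->
  (forall b, complex.Re (Phi b b (1%g : G)) <= r) ->
  rnorm (Phi b c g : C) <= r.
Proof.
move=> h hr; have r0 : 0 <= r by apply: le_trans (hr b); apply: (block_diag b h).2.
have := kernel_cs h (g, b) (1%g, c); rewrite /bker /= !mulVg invg1 mul1g => hh.
rewrite -ler_sqr ?nnegrE ?rnorm_ge0//; apply: le_trans hh _.
by rewrite [r ^+ 2]expr2 ler_pM// (block_diag _ h).2.
Qed.

Lemma dominated_bound u r g : dominated u r -> rnorm (u g) <= r.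
Proof. by move=> [P [p1 p2 <- p4]]; apply: block_bound. Qed.

Lemma coefficient_ccont u : fourier_stieltjes u -> ccont u.
Proof.
move=> [H [pi [x [y [[_ _ _ _ pc] ->]]]]] g e e0.
have y1 : 0 < rnorm y + 1 by rewrite ltr_wpDl ?rnorm_ge0.
have e1 := divr_gt0 e0 y1; rewrite -ltcR in e1.
have /cvgrPdist_lt/(_ _ e1) := pc x g; apply: filterS => h.
rewrite rnormE ltcR rnorm_distC => hh; rewrite -innerNl -innerDl.
rewrite (le_trans (inner_cs _ _))//.
rewrite (le_trans (ler_wpM2r (rnorm_ge0 _) (ltW hh)))//.
rewrite -mulrA ler_piMr ?(ltW e0)// mulrC ler_pdivrMr//; lra.
Qed.

Lemma exp_half_small (e : R) : 0 < e -> exists N, forall n, (N <= n)%N -> (2^-1 : R) ^+ n <= e.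
Proof.
move=> e0; exists (Num.truncn e^-1).+1 => n Nn.
rewrite exprVn invf_ple ?posrE ?exprn_gt0// (le_trans (ltW (truncnS_gt _)))//.
rewrite -natrX ler_nat (leq_trans Nn)//.
by rewrite ltnW// ltn_expl.
Qed.

(** The induction on [j] closes only for the sharper telescoping bound with 2^-M - 2^-(M + j). *)
Lemma geometric_tail (V : normedZmodType C) (f : nat -> V) (c : R) M j :
  (forall k, rnorm (f k) <= c * 2^-1 ^+ k) -> 0 <= c ->
  rnorm (\sum_(k < M + j) f k - \sum_(k < M) f k) <= 2 * c * 2^-1 ^+ M.
Proof.
move=> hf c0.
suff h : rnorm (\sum_(k < M + j) f k - \sum_(k < M) f k) <=
    2 * c * (2^-1 ^+ M - 2^-1 ^+ (M + j)).
  by apply: le_trans h _; rewrite ler_wpM2l ?mulr_ge0// lerBlDr lerDl exprn_ge0.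
elim: j => [|j IH]; first by rewrite addn0 !subrr mulr0 rnorm0.
rewrite addnS big_ord_recr /= addrAC (le_trans (rnormD _ _))//.
rewrite (le_trans (lerD IH (hf _)))// exprS; lra.
Qed.

Lemma geometric_cauchy (V : normedZmodType C) (f : nat -> V) (c : R) :
  (forall k, rnorm (f k) <= c * 2^-1 ^+ k) -> 0 <= c ->
  cauchy_seq (fun M => \sum_(k < M) f k).
Proof.
move=> hf c0 e e0; have c1 : 0 < 2 * c + 1 by lra.
have [N hN] := exp_half_small (divr_gt0 e0 c1); exists N.
have h m n : (N <= m)%N -> (m <= n)%N -> rnorm (\sum_(k < n) f k - \sum_(k < m) f k) <= e.
  move=> Nm mn; rewrite -(subnKC mn) (le_trans (geometric_tail _ _ hf c0))//.
  rewrite (le_trans (ler_wpM2l _ (hN _ Nm))) ?mulr_ge0//.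
  rewrite mulrCA ler_piMr ?(ltW e0)// ler_pdivrMr//; lra.
move=> m n Nm Nn; have [mn|/ltnW nm] := leqP m n; last exact: h.
by rewrite rnorm_distC; apply: h.
Qed.

(** The block functions are summed entry by entry. By [block_bound] the convergence is uniform in g,
    so positivity and the continuity of the diagonal survive. *)
Lemma dominated_series (u : nat -> G -> C) (c : R) : 0 <= c ->
  (forall k, dominated (u k) (c * 2^-1 ^+ k)) ->
  exists2 U, dominated U (2 * c) & forall g, seq_lim (fun M => \sum_(k < M) u k g) (U g).
Proof.
move=> c0 hu; have [P hP] := choice hu.
have Pb b d g k : rnorm (P k b d g) <= c * 2^-1 ^+ k.
  by have [p1 p2 p3 p4] := hP k; apply: block_bound.
have Plim b d g : exists l, seq_lim (fun M => \sum_(k < M) P k b d g) l.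
  by apply: cauchy_complex_cvg; apply: geometric_cauchy (Pb b d g) c0.
pose T b d g := xget 0 [set l | seq_lim (fun M => \sum_(k < M) P k b d g) l].
have TP b d g : seq_lim (fun M => \sum_(k < M) P k b d g) (T b d g).
  by have [l hl] := Plim b d g; apply: (xgetI 0 hl).
have Ttail b d g M : rnorm (T b d g - \sum_(k < M) P k b d g) <= 2 * c * 2^-1 ^+ M.
  apply: (@ler_rnorm_lim _ C (fun n => \sum_(k < n) P k b d g - \sum_(k < M) P k b d g)).
    move=> e /(TP b d g)[N hN]; exists N => n /hN.
    by rewrite (_ : _ - _ - _ = \sum_(k < n) P k b d g - T b d g)//; ring.
  move=> e e0; exists M => n Mn; rewrite -(subnKC Mn).
  by rewrite (le_trans (geometric_tail _ _ (Pb b d g) c0))// lerDl ltW.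
exists (T true false); last first.
  move=> g; have := TP true false g; congr seq_lim; apply/funext => M.
  by apply: eq_bigr => k _; have [_ _ <- _] := hP k.
exists T; split => //.
- apply: (@psd_seq_lim R _ (fun M => bker (fun b d g => \sum_(k < M) P k b d g))).
    elim=> [|M IH].
      rewrite (_ : bker _ = (fun _ _ => 0)); first exact: psd0.
      by apply/funext => p; apply/funext => q; rewrite /bker big_ord0.
    rewrite (_ : bker _ = (fun p q =>
      bker (fun b d g => \sum_(k < M) P k b d g) p q + bker (P M) p q)).
      by apply: psdD => //; have [] := hP M.
    by apply/funext => p; apply/funext => q; rewrite /bker big_ord_recr.
  by move=> p q; apply: TP.
- move=> b g e e0; have c1 : 0 < 2 * c + 1 by lra.
  have e3 : 0 < e / 3 by lra.
  have [M /(_ M (leqnn M)) hM] := exp_half_small (divr_gt0 e3 c1).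
  have {}hM : 2 * c * 2^-1 ^+ M <= e / 3.
    rewrite (le_trans (ler_wpM2l _ hM)) ?mulr_ge0//.
    rewrite mulrCA ler_piMr ?(ltW e3)// ler_pdivrMr//; lra.
  have Sc : ccont (fun g => \sum_(k < M) P k b b g).
    elim: {hM}M => [|M IH].
      by move=> h d d0; near=> h'; rewrite !big_ord0 subrr rnorm0 ltW.
    rewrite (_ : (fun g => _) = (fun g => \sum_(k < M) P k b b g) + P M b b).
      by apply: ccontD => //; have [] := hP M.
    by apply/funext => h; rewrite big_ord_recr.
  apply: filterS (Sc g _ e3) => h hh.
  have -> : T b b h - T b b g = (T b b h - \sum_(k < M) P k b b h) +
      (\sum_(k < M) P k b b h - \sum_(k < M) P k b b g) -
      (T b b g - \sum_(k < M) P k b b g) by ring.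
  rewrite (le_trans (rnormB _ _))// (le_trans (lerD (rnormD _ _) (lexx _)))//.
  have h1 := le_trans (Ttail b b h M) hM; have h2 := le_trans (Ttail b b g M) hM.
  by rewrite (le_trans (lerD (lerD h1 hh) h2))//; lra.
- move=> b; rewrite (le_trans (ler_Re_rnorm _))//.
  by have := Ttail b b 1%g 0; rewrite big_ord0 subr0 expr0 mulr1.
Unshelve. all: by end_near. Qed.

End Dominated.

(** Applied below to the coordinate projections, which lift the [a i] to the product, and to the
    endomorphisms [kill]. *)
Lemma dominated_comp (R : realType) (G G' : topologicalGroupType) (t : G -> G')
    (u : G' -> R[i]) r :
  continuous t -> {morph t : x y / (x * y)%g} -> dominated u r -> dominated (u \o t) r.
Proof.
move=> tc tM.
have t1 : t 1%g = 1%g by apply: (mulgI (t 1%g)); rewrite -tM !mulg1.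
have tV x : t x^-1%g = (t x)^-1%g by apply: (mulgI (t x)); rewrite -tM !mulgV.
move=> [P [p1 p2 p3 p4]]; exists (fun b c => P b c \o t); split => //.
- move=> v; have := p1 [seq (p.1, (t p.2.1, p.2.2)) | p <- v].
  congr (0 <= _); rewrite /kpair big_map; apply: eq_bigr => q _ /=; congr (_ * _).
  by rewrite /kcomb big_map; apply: eq_bigr => p _; rewrite /bker /= tM tV.
- by move=> b g e e0; exact: (tc g _ (p2 b (t g) _ e0)).
- by rewrite p3.
- by move=> b /=; rewrite t1.
Qed.

Section Norm.
Variables (R : realType) (G : topologicalGroupType).
Local Notation C := R[i].
Local Notation B := (@fourier_stieltjes R G).
Local Notation N := (@fs_norm R G).
Implicit Types (u v : G -> C) (r s : R).

Lemma fs0 : B 0. Proof. exact: (fs_norm_dominated (dominated0 R G)).1. Qed.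

Lemma fs_norm0 : N 0 = 0.
Proof.
apply/eqP; rewrite eq_le fs_norm_ge0 ?andbT; last exact: fs0.
exact: (fs_norm_dominated (dominated0 R G)).2.
Qed.

Lemma fs_dominated u e : B u -> 0 < e -> dominated u (N u + e).
Proof. by move=> uB e0; apply: fs_norm_lt => //; rewrite ltrDl. Qed.

Lemma fsD u v : B u -> B v -> B (u + v) /\ N (u + v) <= N u + N v.
Proof.
move=> uB vB; have D e (e0 : 0 < e) := dominatedD (fs_dominated uB e0) (fs_dominated vB e0).
split; first exact: (fs_norm_dominated (D 1 ltr01)).1.
apply/ler_addgt0Pr => e e0; have e2 : 0 < e / 2 by lra.
by rewrite (le_trans (fs_norm_dominated (D _ e2)).2)//; lra.
Qed.

Lemma fsM u v : B u -> B v -> B (u * v) /\ N (u * v) <= N u * N v.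
Proof.
move=> uB vB; have D e (e0 : 0 < e) := dominatedM (fs_dominated uB e0) (fs_dominated vB e0).
have u0 := fs_norm_ge0 uB; have v0 := fs_norm_ge0 vB.
split; first exact: (fs_norm_dominated (D 1 ltr01)).1.
apply/ler_addgt0Pr => e e0.
(* Since d <= 1, (N u + d)(N v + d) exceeds N u * N v by at most d (N u + N v + 1) <= e. *)
pose d := e / (N u + N v + 1 + e).
have D0 : 0 < N u + N v + 1 + e by lra.
have d0 : 0 < d by exact: divr_gt0.
have d1 : d <= 1 by rewrite ler_pdivrMr//; lra.
have de : d * (N u + N v + 1) <= e.
  by rewrite /d mulrAC ler_pdivrMr// ler_wpM2l ?(ltW e0)//; lra.
rewrite (le_trans (fs_norm_dominated (D _ d0)).2)//; nra.
Qed.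

Lemma fsZ_le (c : C) u : B u -> B (c *: u) /\ N (c *: u) <= rnorm c * N u.
Proof.
move=> uB; have D e (e0 : 0 < e) := dominatedZ c (fs_dominated uB e0).
split; first exact: (fs_norm_dominated (D 1 ltr01)).1.
apply/ler_addgt0Pr => e e0.
have c1 : 0 < rnorm c + 1 by rewrite ltr_wpDl ?rnorm_ge0.
rewrite (le_trans (fs_norm_dominated (D _ (divr_gt0 e0 c1))).2)//.
rewrite mulrDr lerD2l mulrCA ler_piMr ?(ltW e0)// ler_pdivrMr//; lra.
Qed.

Lemma fsZ (c : C) u : B u -> B (c *: u) /\ N (c *: u) = rnorm c * N u.
Proof.
move=> uB; have [cB h1] := fsZ_le c uB; split => //.
apply/eqP; rewrite eq_le h1 /=.
have [->|c0] := eqVneq c 0; first by rewrite rnorm0 mul0r fs_norm_ge0// scale0r; exact: fs0.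
have [_] := fsZ_le c^-1 cB; rewrite scalerA mulVf// scale1r => h2.
have cn0 : 0 < rnorm c.
  rewrite lt_def rnorm_ge0 andbT; apply: contra_neq c0; exact: rnorm0_eq0.
rewrite -ler_pdivlMl//; apply: le_trans h2 _.
have : rnorm c * rnorm c^-1 = 1 by rewrite -rnormM divff// rnorm1.
by move=> E; rewrite -[rnorm c^-1](mulKf (lt0r_neq0 cn0)) E mulr1.
Qed.

Lemma fsN u : B u -> B (- u) /\ N (- u) = N u.
Proof.
by move=> uB; have [h1 h2] := fsZ (-1) uB; rewrite -scaleN1r h2 rnormN rnorm1 mul1r.
Qed.

Lemma fsB u v : B u -> B v -> B (u - v) /\ N (u - v) <= N u + N v.
Proof. by move=> uB /fsN[vB <-]; apply: fsD. Qed.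

Lemma fs_bound u g : B u -> rnorm (u g) <= N u.
Proof. by move=> uB; apply: fs_norm_leP => // s us; apply: dominated_bound. Qed.

Lemma fs_norm_eq0 u : B u -> N u = 0 -> u = 0.
Proof.
move=> uB u0; apply/funext => g; apply: rnorm0_eq0; apply/eqP.
by rewrite eq_le rnorm_ge0 andbT -u0 fs_bound.
Qed.

(** Along a subsequence the increments are dominated by 2^-k, so their series converges by
    [dominated_series]; the Cauchy property brings in the other terms. *)
Lemma fs_complete (s : nat -> G -> C) : (forall n, B (s n)) ->
  (forall e, 0 < e -> exists n0, forall m n, (n0 <= m)%N -> (n0 <= n)%N ->
    N (s m - s n) < e) ->
  exists2 l, B l & (fun n => N (s n - l)) @ \oo --> (0 : R).
Proof.
move=> sB sc.
have e_gt0 k : 0 < (2^-1 : R) ^+ k by rewrite exprn_gt0.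
have [m hm] := choice (fun k => sc _ (e_gt0 k)).
pose n := fix n k := if k is k'.+1 then maxn (n k') (m k'.+1) else m 0%N.
have nm k : (m k <= n k)%N by case: k => [//|k] /=; rewrite leq_maxr.
have nS k : (n k <= n k.+1)%N by rewrite /= leq_maxl.
pose u k := s (n k.+1) - s (n k).
have uB k : B (u k) by apply: (fsB _ _).1.
have ud k : dominated (u k) (1 * 2^-1 ^+ k).
  rewrite mul1r; apply: fs_norm_lt => //; apply: hm => //.
  exact: leq_trans (nm k) (nS k).
have [U Ud Ul] := dominated_series ler01 ud.
have UB := (fs_norm_dominated Ud).1.
pose l := s (n 0%N) + U.
have lB : B l by apply: (fsD _ _).1.
exists l => //.
have uS K g : \sum_(k < K) u k g = s (n K) g - s (n 0%N) g.
  elim: K => [|K IH]; first by rewrite big_ord0 subrr.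
  by rewrite big_ord_recr /= IH -[u K g]/(s (n K.+1) g - s (n K) g); ring.
(* The shifted series is dominated as well, and its sum is l - s (n K) because pointwise limits are
   unique. This upgrades pointwise convergence to convergence in norm. *)
have hK K : N (l - s (n K)) <= 2 * 2^-1 ^+ K.
  have udK k : dominated (u (K + k)%N) (2^-1 ^+ K * 2^-1 ^+ k).
    by rewrite -exprD -[_ ^+ _]mul1r.
  have [V Vd Vl] := dominated_series (ltW (e_gt0 K)) udK.
  suff -> : l - s (n K) = V by rewrite (fs_norm_dominated Vd).2.
  apply/funext => g; apply: (seq_lim_unique _ (Vl g)) => e e0.
  have [M hM] := Ul g e e0; exists M => j Mj.
  have := hM (K + j)%N (leq_trans Mj (leq_addl _ _)).
  rewrite big_split_ord /= uS => h; apply: le_trans h.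
  rewrite -[(l - s (n K)) g]/(s (n 0%N) g + U g - s (n K) g).
  by rewrite le_eqVlt; apply/orP; left; apply/eqP; congr rnorm; ring.
apply/cvgrPdist_lt => e e0; have e4 : 0 < e / 4 by lra.
have [K hKe] := exp_half_small e4; have {}hKe := hKe K (leqnn K).
exists (m K) => // j /= Kj; rewrite sub0r normrN.
have bj : B (s j - l) by apply: (fsB _ _).1.
rewrite ger0_norm ?fs_norm_ge0//.
have -> : s j - l = (s j - s (n K)) - (l - s (n K)) by rewrite opprB addrA subrK.
have b1 : B (s j - s (n K)) by apply: (fsB _ _).1.
have b2 : B (l - s (n K)) by apply: (fsB _ _).1.
rewrite (le_lt_trans (fsB b1 b2).2)//.
have := hK K; have := hm K j (n K) Kj (nm K).
move: (N (s j - _)) (N (l - _)) => x y; lra.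
Qed.

Hypothesis Gc : compact [set: G].

(** Closed subsets of [G] are compact, so every [u] in [B] is compactly supported and is its own
    approximation. *)
Lemma fourierE : @fourier R G = B.
Proof.
apply/seteqP; split => u; first by case.
move=> uB; split => // e e0; exists u; split => //; last by rewrite subrr fs_norm0.
split.
  move=> g; apply/cvgrPdist_lt => d d0.
  have Ed : d = (complex.Re d)%:C by rewrite RRe_real// gtr0_real.
  have {}d0 : 0 < complex.Re d by rewrite -ltcR -Ed.
  have d2 : 0 < complex.Re d / 2 by lra.
  apply: filterS (coefficient_ccont uB g d2) => h hh.
  rewrite Ed distrC rnormE ltcR (le_lt_trans hh)//; lra.
apply: subclosed_compact Gc _ => //; exact: closed_closure.
Qed.

Lemma fourier_banach : banach_algebra (fourier_algebra R G).
Proof.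
split; rewrite /= ?fourierE.
- exact: fs0.
- by move=> a b aB bB; apply: (fsD _ _).1.
- by move=> c a aB; apply: (fsZ _ _).1.
- by move=> a b aB bB; apply: (fsM _ _).1.
- by move=> a b c _ _ _; rewrite mulrA.
- move=> k a b c _ _ _; apply/funext => g.
  by change ((k * a g + b g) * c g = k * (a g * c g) + b g * c g); ring.
- move=> k a b c _ _ _; apply/funext => g.
  by change (c g * (k * a g + b g) = k * (c g * a g) + c g * b g); ring.
- exact: fs_norm_eq0.
- by move=> c a aB; rewrite (fsZ c aB).2 rnormE rmorphM.
- by move=> a b aB bB; apply: (fsD _ _).2.
- by move=> a b aB bB; apply: (fsM _ _).2.
- exact: fs_complete.
Qed.

End Norm.

(** * Averaging over subgroups *)

Section Weights.
Variables (R : realType) (G : groupType).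
Local Notation C := R[i].
Implicit Types (N : set G) (v w : seq (R * G)).

(* Finitely supported probability measures on [N]. *)
Definition weights N v : Prop :=
  all (fun p => (0 <= p.1) && `[< N p.2 >]) v /\ \sum_(p <- v) p.1 = 1.

Lemma weights1 N g : N g -> weights N [:: (1, g)].
Proof. by move=> Ng; split; rewrite ?big_seq1 //= ler01 andbT; apply/asboolP. Qed.

(** The midpoint of two measures, for the parallelogram argument in [mean_ergodic]. *)
Definition wmid v w : seq (R * G) :=
  [seq (2^-1 * p.1, p.2) | p <- v] ++ [seq (2^-1 * p.1, p.2) | p <- w].

Lemma weights_mid N v w : weights N v -> weights N w -> weights N (wmid v w).
Proof.
have h (x : seq (R * G)) : weights N x ->
    all (fun p => (0 <= p.1) && `[< N p.2 >]) [seq (2^-1 * p.1, p.2) | p <- x] /\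
    \sum_(p <- [seq (2^-1 * p.1, p.2) | p <- x]) p.1 = 2^-1.
  move=> [x0 x1]; split; last by rewrite big_map -mulr_sumr x1 mulr1.
  rewrite all_map; apply: sub_all x0 => p /= /andP[p0 ->]; rewrite andbT.
  by rewrite mulr_ge0// invr_ge0.
move=> /h[v1 v2] /h[w1 w2]; split; first by rewrite all_cat v1.
by rewrite big_cat /= v2 w2; lra.
Qed.

(** Convolution of measures; averages over it are composites of averages. *)
Definition wmul v w : seq (R * G) := [seq (p.1 * q.1, (p.2 * q.2)%g) | p <- v, q <- w].

Lemma big_wmul (V : nmodType) v w (F : R * G -> V) :
  \sum_(r <- wmul v w) F r = \sum_(p <- v) \sum_(q <- w) F (p.1 * q.1, (p.2 * q.2)%g).
Proof. exact: big_allpairs_dep. Qed.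

Lemma weights_mul N v w : (forall g h, N g -> N h -> N (g * h)%g) ->
  weights N v -> weights N w -> weights N (wmul v w).
Proof.
move=> NM [v0 v1] [w0 w1]; split.
  apply/allP => r /allpairsP[[p q] [/= /(allP v0)/andP[p0 /asboolP Np]]].
  move=> /(allP w0)/andP[q0 /asboolP Nq] -> /=.
  by rewrite mulr_ge0//=; apply/asboolP; apply: NM.
rewrite big_wmul -[RHS]v1; apply: eq_bigr => p _.
by rewrite -mulr_sumr w1 mulr1.
Qed.

Definition favg v (f : G -> C) : G -> C := fun g => \sum_(p <- v) p.1%:C * f (g * p.2)%g.

Lemma favg_mul v w f : favg (wmul v w) f = favg v (favg w f).
Proof.
apply/funext => g; rewrite /favg big_wmul; apply: eq_bigr => p _.
rewrite mulr_sumr; apply: eq_bigr => q _ /=.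
by rewrite rmorphM mulrA mulgA.
Qed.

Lemma weighted_sum_le N v (V : normedZmodType C) (F : R * G -> V) (e : R) :
  weights N v -> (forall p, 0 <= p.1 -> N p.2 -> rnorm (F p) <= p.1 * e) ->
  rnorm (\sum_(p <- v) F p) <= e.
Proof.
move=> [v0 v1] h; rewrite (le_trans (rnorm_sum _ _))// -[e]mul1r -v1 mulr_suml.
elim: v v0 {v1} => [|p v IH]; first by rewrite !big_nil.
rewrite !big_cons /= => /andP[/andP[p0 /asboolP Np]] v0.
by apply: lerD; [exact: h|exact: IH].
Qed.

Lemma favg_le N v f (e : R) g : weights N v -> (forall g, rnorm (f g) <= e) ->
  rnorm (favg v f g) <= e.
Proof.
move=> vN fe; apply: (weighted_sum_le vN) => p p0 _.
by rewrite rnormM rnorm_real ger0_norm// ler_wpM2l.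
Qed.

Lemma favg_inv N v f g : weights N v -> (forall g h, N h -> f (g * h)%g = f g) ->
  favg v f g = f g.
Proof.
move=> [v0 v1] fN; rewrite /favg -[RHS]mul1r -[1]/(1%:C) -v1 raddf_sum mulr_suml.
elim: v v0 {v1} => [|p v IH]; first by rewrite !big_nil.
rewrite !big_cons /= => /andP[/andP[p0 /asboolP Np]] v0.
by rewrite fN// IH.
Qed.

End Weights.

Section MeanErgodic.
Variables (R : realType) (G : topologicalGroupType) (H : hilbertType R).
Variables (pi : G -> H -> H) (N : set G).
Local Notation C := R[i].
Hypothesis piU : unitary_rep pi.
Hypothesis N1 : N 1%g.
Hypothesis NM : forall g h, N g -> N h -> N (g * h)%g.
Hypothesis NV : forall g, N g -> N g^-1%g.
Implicit Types (x y z : H) (v w : seq (R * G)).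

Let pl := rep_linear piU.
Let iso := rep_isometry piU.

Lemma repZ g (c : C) x : pi g (c *: x) = c *: pi g x.
Proof.
have h0 : pi g 0 = 0 by have := pl g (-1) 0 0; rewrite scaler0 addr0 scaleN1r addNr.
by rewrite -[c *: x]addr0 pl h0 addr0.
Qed.

Lemma repD g x y : pi g (x + y) = pi g x + pi g y.
Proof. by rewrite -[x]scale1r pl !scale1r. Qed.

Lemma rep0 g : pi g 0 = 0. Proof. by rewrite -(scale0r (0 : H)) repZ !scale0r. Qed.

Lemma repN g x : pi g (- x) = - pi g x.
Proof. by rewrite -scaleN1r repZ scaleN1r. Qed.

Lemma rep_sum g (I : Type) (s : seq I) (F : I -> H) :
  pi g (\sum_(i <- s) F i) = \sum_(i <- s) pi g (F i).
Proof.
elim: s => [|i s IH]; first by rewrite !big_nil rep0.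
by rewrite !big_cons repD IH.
Qed.

Lemma rnorm_rep g x : rnorm (pi g x) = rnorm x.
Proof.
have := iso g x x; rewrite !inner_self => /complexI/eqP.
by rewrite eqrXn2 ?rnorm_ge0// => /eqP.
Qed.

Lemma rep_adj g x y : inner (pi g x) y = inner x (pi g^-1%g y).
Proof. by rewrite -[RHS](iso g) -(repM piU) mulgV (rep1 piU). Qed.

Definition vavg v x : H := \sum_(p <- v) p.1%:C *: pi p.2 x.

Lemma vavg_mul v w x : vavg (wmul v w) x = vavg v (vavg w x).
Proof.
rewrite /vavg big_wmul; apply: eq_bigr => p _.
rewrite rep_sum scaler_sumr; apply: eq_bigr => q _ /=.
by rewrite repZ scalerA (repM piU) rmorphM.
Qed.

Lemma vavg1 g x : vavg [:: (1, g)] x = pi g x.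
Proof. by rewrite /vavg big_seq1 scale1r. Qed.

Lemma vavg_mid v w x : vavg (wmid v w) x = (2^-1)%:C *: (vavg v x + vavg w x).
Proof.
rewrite /vavg big_cat !big_map scalerDr !scaler_sumr.
by congr (_ + _); apply: eq_bigr => p _ /=; rewrite scalerA rmorphM.
Qed.

Lemma favg_coefficient v x y g :
  favg v (fun g => inner (pi g x) y) g = inner (pi g (vavg v x)) y.
Proof.
rewrite /favg /vavg rep_sum inner_suml; apply: eq_bigr => p _.
by rewrite repZ innerZl (repM piU).
Qed.

Definition fixedv x : Prop := forall g, N g -> pi g x = x.

Definition orthfix x : Prop := forall y, fixedv y -> inner x y = 0.

Lemma inner_vavg v x y : weights N v -> fixedv y -> inner (vavg v x) y = inner x y.
Proof.
move=> [v0 v1] yF; rewrite /vavg inner_suml -[RHS]mul1r -[1]/(1%:C) -v1 raddf_sum mulr_suml.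
elim: v v0 {v1} => [|p v IH]; first by rewrite !big_nil.
rewrite !big_cons /= => /andP[/andP[p0 /asboolP Np]] v0.
by rewrite IH// innerZl rep_adj yF//; apply: NV.
Qed.

Lemma orthfix_vavg v x : weights N v -> orthfix x -> orthfix (vavg v x).
Proof. by move=> vN xo y yF; rewrite inner_vavg// xo. Qed.

Lemma hilbert_cauchy_cvg (a : nat -> H) : cauchy_seq a -> exists l, seq_lim a l.
Proof.
move=> ac; have /cvg_ex[l al] : cvgn a.
  apply: cauchy_cvg; apply/cauchy_exP => e e0.
  have Ee : e = (complex.Re e)%:C by rewrite RRe_real// gtr0_real.
  have {}e0 : 0 < complex.Re e by rewrite -ltcR -Ee.
  have [n0 hn] := ac (complex.Re e / 2) (divr_gt0 e0 (ltr0n _ 2)).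
  exists (a n0); exists n0 => // n /= Nn; rewrite Ee -ball_normE /= rnormE ltcR.
  by rewrite (le_lt_trans (hn _ _ _ _))//; lra.
exists l => e e0; rewrite -ltcR in e0.
move/cvgrPdist_le: al => /(_ _ e0)[n0 _ hn].
by exists n0 => n Nn; have := hn n Nn; rewrite /= rnormE lecR rnorm_distC.
Qed.

(* The vector of least norm in the closed convex hull of the [N]-orbit of [x]. *)
Lemma mean_ergodic x : exists z, [/\ fixedv z, orthfix (x - z) &
  forall e : R, 0 < e -> exists2 v, weights N v & rnorm (vavg v x - z) <= e].
Proof.
pose D := [set r | exists2 v, weights N v & r = rnorm (vavg v x)].
have D0 : D !=set0.
  by exists (rnorm (vavg [:: (1, 1%g)] x)), [:: (1, 1%g)] => //; apply: weights1.
have Dlb : lbound D 0 by move=> r [v _ ->]; apply: rnorm_ge0.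
pose d := inf D.
have d0 : 0 <= d by apply: lb_le_inf.
have dD v : weights N v -> d <= rnorm (vavg v x).
  by move=> vN; apply: ge_inf; [exists 0|exists v].
have e_gt0 n : 0 < (2^-1 : R) ^+ n by rewrite exprn_gt0.
have hv n : exists v, weights N v /\ rnorm (vavg v x) < d + 2^-1 ^+ n.
  have [|r [v vN ->] h] := @inf_lt _ D (d + 2^-1 ^+ n) D0; first by rewrite ltrDl.
  by exists v.
have [v {}hv] := choice hv.
pose a n := vavg (v n) x.
(* Parallelogram law: the midpoint has norm at least d, so the squared distance is at most 4 (d +
   e)^2 - 4 d^2 = 8 d e + 4 e^2. *)
have close w w' (e : R) : weights N w -> weights N w' -> 0 <= e -> e <= 1 ->
    rnorm (vavg w x) <= d + e -> rnorm (vavg w' x) <= d + e ->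
    rnorm (vavg w x - vavg w' x) ^+ 2 <= (8 * d + 4) * e.
  move=> wN wN' e0 e1 h h'.
  have := dD _ (weights_mid wN wN'); rewrite vavg_mid rnormZ rnorm_real ger0_norm ?invr_ge0//.
  have := rnorm_sqrD (vavg w x) (vavg w' x); have := rnorm_sqrB (vavg w x) (vavg w' x).
  move: (rnorm_ge0 (vavg w x)) (rnorm_ge0 (vavg w' x)) (rnorm_ge0 (vavg w x + vavg w' x)) h h'.
  move: (rnorm (vavg w x)) (rnorm (vavg w' x)) (rnorm (_ + _)) (rnorm (_ - _)) (complex.Re _).
  move=> p q s t i p0 q0 s0 ph qh Et Es sd.
  have {}sd : 2 * d <= s by lra.
  have s2 : 4 * d ^+ 2 <= s ^+ 2.
    by rewrite (_ : 4 * d ^+ 2 = (2 * d) ^+ 2) ?ler_sqr ?nnegrE ?mulr_ge0//; ring.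
  have p2 : p ^+ 2 <= (d + e) ^+ 2 by rewrite ler_sqr ?nnegrE ?addr_ge0.
  have q2 : q ^+ 2 <= (d + e) ^+ 2 by rewrite ler_sqr ?nnegrE ?addr_ge0.
  have e2 : e ^+ 2 <= e by rewrite expr2 ler_piMl.
  have -> : t ^+ 2 = 2 * p ^+ 2 + 2 * q ^+ 2 - s ^+ 2 by lra.
  rewrite (@le_trans _ _ (4 * (d + e) ^+ 2 - 4 * d ^+ 2))//; first lra.
  by rewrite (_ : _ - _ = 8 * d * e + 4 * e ^+ 2); [lra|ring].
have small (e : R) : 0 < e ->
    exists n0, forall n, (n0 <= n)%N -> (8 * d + 4) * 2^-1 ^+ n <= e ^+ 2.
  move=> e0; have D1 : 0 < 8 * d + 4 by lra.
  have [n0 hn] := exp_half_small (divr_gt0 (exprn_gt0 2 e0) D1); exists n0 => n /hn.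
  by rewrite ler_pdivlMr// mulrC.
have half1 n : (2^-1 : R) ^+ n <= 1 by rewrite exprn_ile1//; lra.
have ac : cauchy_seq a.
  move=> e e0; have [n0 hn] := small e e0; exists n0 => m n nm nn.
  rewrite -ler_sqr ?nnegrE ?rnorm_ge0 ?(ltW e0)//.
  apply: le_trans (hn n0 (leqnn _)); have [vm1 vm2] := hv m; have [vn1 vn2] := hv n.
  have hh j : (n0 <= j)%N -> (2^-1 : R) ^+ j <= 2^-1 ^+ n0.
    by move=> nj; rewrite ler_wiXn2l//; lra.
  apply: close; [exact: vm1|exact: vn1|exact/ltW/e_gt0|exact: half1| |].
    by rewrite (le_trans (ltW vm2))// lerD2l hh.
  by rewrite (le_trans (ltW vn2))// lerD2l hh.
have [z az] := hilbert_cauchy_cvg ac; exists z.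
have piz g : seq_lim (fun n => pi g (a n)) (pi g z).
  by move=> e /az[n0 hn]; exists n0 => n /hn; rewrite -repN -repD rnorm_rep.
have zF : fixedv z.
  (* The vector [pi g (a n)] is again an average of [x], of the same norm as [a n]; two averages of
     nearly minimal norm are close to each other. *)
  move=> g Ng; apply: (seq_lim_unique (piz g)) => e e0.
  have e2 : 0 < e / 2 by lra.
  have [n1 hn1] := az _ e2; have [n2 hn2] := small _ e2.
  exists (maxn n1 n2) => n; rewrite geq_max => /andP[/hn1 h1 /hn2 h2].
  have -> : pi g (a n) - z = (pi g (a n) - a n) + (a n - z) by rewrite addrA subrK.
  rewrite (le_trans (rnormD _ _))// [e]splitr lerD//.
  rewrite -ler_sqr ?nnegrE ?rnorm_ge0 ?(ltW e2)//; apply: le_trans h2.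
  have [vn1 vn2] := hv n.
  have Ea : pi g (a n) = vavg (wmul [:: (1, g)] (v n)) x by rewrite vavg_mul vavg1.
  rewrite Ea; apply: close; [|exact: vn1|exact/ltW/e_gt0|exact: half1| |].
  - by apply: weights_mul => //; apply: weights1.
  - by rewrite -Ea rnorm_rep ltW.
  - exact: ltW.
split => //.
- move=> y yF; rewrite innerDl innerNl; apply/eqP; rewrite subr_eq0; apply/eqP.
  apply: eq_rnorm_small => e e0.
  have y1 : 0 < rnorm y + 1 by rewrite ltr_wpDl ?rnorm_ge0.
  have [n0 /(_ n0 (leqnn _)) hn] := az _ (divr_gt0 e0 y1).
  rewrite -(inner_vavg x (hv n0).1 yF) -innerNl -innerDl (le_trans (inner_cs _ _))//.
  rewrite (le_trans (ler_wpM2r (rnorm_ge0 _) hn))// -mulrA ler_piMr ?(ltW e0)//.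
  by rewrite mulrC ler_pdivrMr//; lra.
- move=> e /az[n0 hn]; exists (v n0); first exact: (hv n0).1.
  exact: hn.
Qed.

(** The projection of [x] onto the fixed vectors is both fixed and orthogonal to the fixed vectors,
    hence zero, and it is a limit of averages. *)
Lemma orthfix_small x (e : R) : orthfix x -> 0 < e ->
  exists2 v, weights N v & rnorm (vavg v x) <= e.
Proof.
move=> xo e0; have [z [zF zo hz]] := mean_ergodic x.
suff z0 : z = 0 by have [v vN h] := hz e e0; exists v => //; rewrite z0 subr0 in h.
have := zo _ zF; rewrite innerDl xo// add0r innerNl inner_self => /eqP.
rewrite oppr_eq0 => /eqP/complexI/eqP; rewrite sqrf_eq0 => /eqP; exact: rnorm0_eq0.
Qed.

End MeanErgodic.

(** * Additivity of the norm and approximation by invariant functions *)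

Section NormalSubgroup.
Variables (R : realType) (G : topologicalGroupType) (K : set G).
Local Notation C := R[i].
Local Notation B := (@fourier_stieltjes R G).
Local Notation N := (@fs_norm R G).
Hypothesis K1 : K 1%g.
Hypothesis KM : forall g h, K g -> K h -> K (g * h)%g.
Hypothesis KV : forall g, K g -> K g^-1%g.
Hypothesis KJ : forall g h, K h -> K (g^-1 * h * g)%g.
Implicit Types (f h u : G -> C).

Definition rinvariant f : Prop := forall g k, K k -> f (g * k)%g = f g.

(** Vanishing mean over [K] on every coset g K, expressed by finite convex combinations of right
    translates instead of an integral. *)
Definition null_mean h : Prop := forall e : R, 0 < e ->
  exists2 v, weights K v & forall g, rnorm (favg v h g) <= e.

Lemma fixedv_rep (H : hilbertType R) (pi : G -> H -> H) g x : unitary_rep pi ->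
  fixedv pi K x -> fixedv pi K (pi g x).
Proof.
move=> piU xF k Kk; rewrite -(repM piU) -[(k * g)%g]mul1g -(mulgV g) -!mulgA (repM piU).
by rewrite !mulgA xF//; apply: KJ.
Qed.

(* The projection [z] of [x] onto the [K]-fixed vectors commutes with [pi], so that
   the coefficient splits along fixed vectors and their orthogonal complement; by
   averaging, the two parts can only be [f] and [h]. *)
Lemma fs_norm_additive f h : B f -> B h -> rinvariant f -> null_mean h ->
  N f + N h <= N (f + h).
Proof.
move=> fB hB fK hK; apply: fs_norm_leP; first exact: (fsD fB hB).1.
move=> s /dominated_coefficient[H [pi [x [y [[piU E] xs ys]]]]].
have [z [zF zo _]] := mean_ergodic piU K1 KM KV x.
have [t [tF to _]] := mean_ergodic piU K1 KM KV y.
pose f1 : G -> C := fun g => inner (pi g z) t.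
pose f2 : G -> C := fun g => inner (pi g (x - z)) (y - t).
have perp a b : fixedv pi K a -> orthfix pi K b -> inner a b = 0.
  by move=> aF bo; rewrite inner_conj bo// conjC0.
have E12 g : f g + h g = f1 g + f2 g.
  rewrite -[f g + h g]/((f + h) g) E /f1 /f2 (repD piU) (repN piU).
  have h1 : inner (pi g z) (y - t) = 0 by apply: perp => //; apply: fixedv_rep.
  have h2 : inner (pi g (x - z)) t = 0.
    by rewrite (rep_adj piU) zo//; apply: fixedv_rep.
  move: h1 h2; rewrite (repD piU) (repN piU) !innerDl !innerDr !innerNl !innerNr.
  move=> h1 h2.
  have -> : inner (pi g z) y = inner (pi g z) t by apply/eqP; rewrite -subr_eq0 h1.
  have -> : inner (pi g x) t = inner (pi g z) t by apply/eqP; rewrite -subr_eq0 h2.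
  ring.
have f1K : rinvariant f1 by move=> g k Kk; rewrite /f1 (repM piU) zF.
have ff1 : f = f1.
  apply/funext => g; apply: eq_rnorm_small => e e0.
  have D1 : 0 < rnorm (y - t) + 1 by rewrite ltr_wpDl ?rnorm_ge0.
  have e1 : 0 < e / 2 by lra.
  (* The invariant function f - f1 = f2 - h equals each of its averages over [K]. First [v1] makes
     the average of [h] small; then [v2] is chosen for the already averaged vector x - z. Averaging
     by [v2] cannot enlarge the bound for [h]. *)
  have [v1 v1K hv1] := hK _ e1.
  have q'o := orthfix_vavg piU KV v1K zo.
  have [v2 v2K hv2] := orthfix_small piU K1 KM KV q'o (divr_gt0 e1 D1).
  have vK := weights_mul KM v2K v1K.
  have w0 g' : f g' - f1 g' = f2 g' - h g'.
    by apply/eqP; rewrite subr_eq addrAC eq_sym subr_eq addrC -E12 addrC.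
  have wK : rinvariant (fun g' => f g' - f1 g') by move=> g' k Kk; rewrite fK// f1K.
  rewrite -(favg_inv g vK wK) (_ : (fun g' => _) = (fun g' => f2 g' - h g')); last exact/funext.
  have favgB (a b : G -> C) w : favg w (fun g' => a g' - b g') g = favg w a g - favg w b g.
    by rewrite /favg -sumrB; apply: eq_bigr => p _; rewrite mulrBr.
  rewrite favgB (le_trans (rnormB _ _))// [e]splitr lerD//.
    rewrite (favg_coefficient piU) (vavg_mul piU) (le_trans (inner_cs _ _))// (rnorm_rep piU).
    rewrite (le_trans (ler_wpM2r (rnorm_ge0 _) hv2))// -mulrA ler_piMr ?(ltW e1)//.
    by rewrite mulrC ler_pdivrMr//; lra.
  by rewrite favg_mul; apply: (favg_le _ v2K).
have hf2 : h = f2.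
  by apply/funext => g; have := E12 g; rewrite ff1 => /addrI.
have Nf : N f <= rnorm z * rnorm t.
  by rewrite ff1; apply: (fs_norm_dominated _).2; apply: (@coefficient_dominated _ _ _ H pi).
have Nh : N h <= rnorm (x - z) * rnorm (y - t).
  by rewrite hf2; apply: (fs_norm_dominated _).2; apply: (@coefficient_dominated _ _ _ H pi).
have pyth a b : fixedv pi K b -> orthfix pi K (a - b) ->
    rnorm a ^+ 2 = rnorm b ^+ 2 + rnorm (a - b) ^+ 2.
  move=> bF ab; have := rnorm_sqrD b (a - b).
  by rewrite addrC subrK perp// mulr0 addr0.
have Ex := pyth _ _ zF zo; have Ey := pyth _ _ tF to.
rewrite (le_trans (lerD Nf Nh))//.
(* By 2 a b <= a^2 + b^2 and Pythagoras, the sum is at most half of |x|^2 + |y|^2, which is at most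
   [s]. *)
have := sqr_ge0 (rnorm z - rnorm t); have := sqr_ge0 (rnorm (x - z) - rnorm (y - t)).
move: Ex Ey xs ys => -> ->; move: (rnorm z) (rnorm t) (rnorm _) (rnorm _) => a b c d.
by rewrite !sqrrB; lra.
Qed.

End NormalSubgroup.

(** [W] is chosen before [K]: there [pi] moves [x] by at most e / (|y| + 1). The projection of [x]
    is a limit of averages over [K], so it is no farther from [x] than the translates are. *)
Lemma fs_approx_rinvariant (R : realType) (G : topologicalGroupType) (u : G -> R[i]) (e : R) :
  fourier_stieltjes u -> 0 < e -> exists2 W, nbhs (1%g : G) W &
  forall K : set G, K 1%g -> (forall g h, K g -> K h -> K (g * h)%g) ->
    (forall g, K g -> K g^-1%g) -> K `<=` W ->
    exists b, [/\ fourier_stieltjes b, rinvariant K b & fs_norm (u - b) <= e].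
Proof.
move=> [H [pi [x [y [piU ->]]]]] e0.
have y1 : 0 < rnorm y + 1 by rewrite ltr_wpDl ?rnorm_ge0.
have d0 := divr_gt0 e0 y1; set d := e / _ in d0.
have dC : 0 < d%:C by rewrite ltcR.
have /cvgrPdist_le/(_ _ dC) := @rep_continuous _ _ _ _ piU x 1%g.
rewrite (rep1 piU) => nW; exists [set g | `|x - pi g x| <= d%:C] => // K K1 KM KV KW.
have [z [zF zo hz]] := mean_ergodic piU K1 KM KV x.
exists (fun g => inner (pi g z) y); split.
- by exists H, pi, z, y.
- by move=> g k Kk; rewrite (repM piU) zF.
have xz : rnorm (x - z) <= d.
  apply/ler_addgt0Pr => r r0; have [v vK vz] := hz r r0.
  have -> : x - z = - (vavg pi v x - x) + (vavg pi v x - z) by rewrite opprB addrA subrK.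
  rewrite (le_trans (rnormD _ _))// lerD// rnormN.
  have -> : vavg pi v x - x = \sum_(p <- v) p.1%:C *: (pi p.2 x - x).
    rewrite /vavg -[X in _ - X]scale1r -[1]/(1%:C) -vK.2 raddf_sum scaler_suml -sumrB.
    by apply: eq_bigr => p _; rewrite scalerBr.
  apply: (weighted_sum_le vK) => p p0 /KW /=; rewrite rnormE lecR => hp.
  by rewrite rnormZ rnorm_real ger0_norm// ler_wpM2l// rnorm_distC.
have : is_coefficient ((fun g => inner (pi g x) y) - (fun g => inner (pi g z) y)) pi (x - z) y.
  split => //; apply/funext => g.
  by rewrite (repD piU) (repN piU) innerDl innerNl.
move=> /coefficient_dominated/fs_norm_dominated[_ /le_trans]; apply.
rewrite (le_trans (ler_wpM2r (rnorm_ge0 _) xz))// /d -mulrA ler_piMr ?(ltW e0)//.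
by rewrite mulrC ler_pdivrMr//; lra.
Qed.

(** * The invariant mean of a compact group *)

Section HaarMean.
Variables (R : realType) (G : topologicalGroupType).
Hypothesis Gc : compact [set: G].
Implicit Types (f : G -> R) (v w : seq (R * G)) (e : R).
Local Notation wts := (@weights R G [set: G]).

Definition rcont f : Prop :=
  forall g e, 0 < e -> \forall h \near g, `|f h - f g| <= e.

Definition ravg v f : G -> R := fun g => \sum_(p <- v) p.1 * f (g * p.2)%g.
Definition lavg v f : G -> R := fun g => \sum_(p <- v) p.1 * f (p.2 * g)%g.

Lemma weightsT_mul v w : wts v -> wts w -> wts (wmul v w).
Proof. by apply: weights_mul. Qed.

Lemma ravg_mul v w f : ravg (wmul v w) f = ravg v (ravg w f).
Proof.
apply/funext => g; rewrite /ravg big_wmul; apply: eq_bigr => p _.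
by rewrite mulr_sumr; apply: eq_bigr => q _ /=; rewrite mulrA mulgA.
Qed.

Lemma lavg_mul v w f : lavg (wmul v w) f = lavg w (lavg v f).
Proof.
apply/funext => g; rewrite /lavg big_wmul exchange_big /=; apply: eq_bigr => p _.
by rewrite mulr_sumr; apply: eq_bigr => q _ /=; rewrite mulrAC mulrC mulgA.
Qed.

(** Left and right translations commute; the uniqueness and the invariance of the mean rest on
    this. *)
Lemma ravg_lavg v w f : ravg v (lavg w f) = lavg w (ravg v f).
Proof.
apply/funext => g; rewrite /lavg /ravg.
under eq_bigr do rewrite mulr_sumr; rewrite exchange_big /=; apply: eq_bigr => p _.
by rewrite mulr_sumr; apply: eq_bigr => q _ /=; rewrite mulrCA mulgA.
Qed.

Lemma wsum_le v (F F' : G -> R) : wts v -> (forall g, F g <= F' g) ->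
  \sum_(p <- v) p.1 * F p.2 <= \sum_(p <- v) p.1 * F' p.2.
Proof.
move=> [v0 _] h; elim: v v0 => [|p v IH]; first by rewrite !big_nil.
rewrite !big_cons /= => /andP[/andP[p0 _] v0].
by apply: lerD; [exact: ler_wpM2l|exact: IH].
Qed.

Lemma wsum_cst v (c : R) : wts v -> \sum_(p <- v) p.1 * c = c.
Proof. by move=> [_ v1]; rewrite -mulr_suml v1 mul1r. Qed.

Lemma ravg_le v f c : wts v -> (forall g, f g <= c) -> forall g, ravg v f g <= c.
Proof.
move=> vw h g; rewrite -(wsum_cst c vw) /ravg.
exact: (wsum_le (F := fun k => f (g * k)%g) (F' := fun=> c)).
Qed.

Lemma ravg_ge v f c : wts v -> (forall g, c <= f g) -> forall g, c <= ravg v f g.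
Proof.
move=> vw h g; rewrite -(wsum_cst c vw) /ravg.
exact: (wsum_le (F' := fun k => f (g * k)%g) (F := fun=> c)).
Qed.

Lemma lavg_le v f c : wts v -> (forall g, f g <= c) -> forall g, lavg v f g <= c.
Proof.
move=> vw h g; rewrite -(wsum_cst c vw) /lavg.
exact: (wsum_le (F := fun k => f (k * g)%g) (F' := fun=> c)).
Qed.

Lemma lavg_ge v f c : wts v -> (forall g, c <= f g) -> forall g, c <= lavg v f g.
Proof.
move=> vw h g; rewrite -(wsum_cst c vw) /lavg.
exact: (wsum_le (F' := fun k => f (k * g)%g) (F := fun=> c)).
Qed.

Lemma translates_cover (U : set G) : nbhs 1%g U ->
  exists l : seq G, forall g, exists2 t, t \in l & U (t^-1 * g)%g.
Proof.
move=> U1.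
(* The filter of sets containing all large enough finite lists turns the near-covering form of
   compactness into a finite list of translates. *)
pose F : set_system (seq G) := [set S | exists l0 : seq G,
  forall l : seq G, {subset l0 <= l} -> S l].
have FF : Filter F.
  split.
  - by exists [::].
  - move=> P Q [l hl] [l' hl']; exists (l ++ l') => m hm; split.
      by apply: hl => x xl; apply: hm; rewrite mem_cat xl.
    by apply: hl' => x xl; apply: hm; rewrite mem_cat xl orbT.
  - by move=> P Q PQ [l hl]; exists l => m /hl/PQ.
have /compact_near_coveringP nc := Gc.
have [|l hl] := nc _ F (fun l x => exists2 t, t \in l & U (t^-1 * x)%g) FF.
  move=> x _; exists ([set x' | U (x^-1 * x')%g], [set m : seq G | x \in m]).
    split => /=; last by exists [:: x] => l /(_ x); rewrite inE eqxx; apply.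
    have c : {for x, continuous (fun x' => (x^-1 * x')%g)} by exact: lmulg_continuous.
    by apply: c; rewrite mulVg.
  by move=> [x' m] [/= Ux' xm]; exists x.
by exists l => g; apply: (hl l).
Qed.

Lemma mulg_near1 (x : G) (A : set G) : nbhs x A ->
  \forall x' \near x & u \near (1%g : G), A (x' * u)%g.
Proof. by rewrite -{1}[x]mulg1 => xA; apply: (@mulg_continuous G (x, 1%g)). Qed.

Lemma uniform_right f e : rcont f -> 0 < e ->
  \forall u \near (1%g : G), forall x, `|f (x * u)%g - f x| <= e.
Proof.
move=> fc e0; have e2 : 0 < e / 2 by lra.
have /compact_near_coveringP nc := Gc.
pose P (u x : G) : Prop := `|f (x * u)%g - f x| <= e.
have := nc _ (nbhs (1%g : G)) P (nbhs_filter _) _.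
suff H : forall x, [set: G] x -> \forall x' \near x & u \near nbhs (1%g : G), P u x'.
  by move=> /(_ H); apply: filterS => u h x; apply: h.
move=> x _; have [[V W] /= [xV W1] VW] := mulg_near1 (fc x _ e2).
exists (V `&` [set x' | `|f x' - f x| <= e / 2], W) => /=.
  by split => //; apply: filterI => //; apply: fc.
move=> [x' u] [/= [Vx' h2] Wu]; have /= h1 := VW (x', u) (conj Vx' Wu); rewrite /P.
have -> : f (x' * u)%g - f x' = (f (x' * u)%g - f x) - (f x' - f x) by ring.
by rewrite (le_trans (ler_normB _ _))// [e]splitr lerD.
Qed.

Lemma rcont_bounded f : rcont f -> exists2 M, 0 < M & forall g, `|f g| <= M.
Proof.
move=> fc; have /compact_near_coveringP nc := Gc.
pose P (M : R) (x : G) : Prop := `|f x| <= M.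
have FF : Filter (pinfty_nbhs R) by typeclasses eauto.
have := nc _ (pinfty_nbhs R) P FF.
suff H : forall x, [set: G] x -> \forall x' \near x & M \near pinfty_nbhs R, P M x'.
  move=> /(_ H); move=> [M0 [_ hM]]; exists (Num.max M0 0 + 1).
    by rewrite ltr_wpDl// le_max lexx orbT.
  move=> g; apply: hM => //; rewrite ltr_pwDr// le_max lexx//.
move=> x _; exists ([set x' | `|f x' - f x| <= 1], [set M : R | `|f x| + 1 < M]) => /=.
  by split; [exact: fc|exact: nbhs_pinfty_gt].
move=> [x' M] [/= h1 h2]; rewrite /P.
have -> : f x' = (f x' - f x) + f x by rewrite subrK.
rewrite (le_trans (ler_normD _ _))// (le_trans (lerD h1 (lexx _)))// addrC; exact: ltW.
Qed.

(* A left average with values below [inf + d] must be close to [inf]: otherwise,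
   translating by finitely many elements and averaging once more would bring its
   maximum below the infimum. *)
Lemma left_mean_exists f : rcont f -> exists s, forall e, 0 < e ->
  exists2 v, wts v & forall g, `|lavg v f g - s| <= e.
Proof.
move=> fc; have [M M0 fM] := rcont_bounded fc.
pose D := [set r | exists2 v, wts v & forall g, lavg v f g <= r].
have fl g : - M <= f g by have := fM g; rewrite ler_norml => /andP[].
have fu g : f g <= M by have := fM g; rewrite ler_norml => /andP[].
have Dlb : lbound D (- M).
  by move=> r [v vw hv]; rewrite (le_trans (lavg_ge vw fl 1%g)).
have D0 : D !=set0.
  exists M, [:: (1, 1%g)]; first exact: weights1.
  by apply: lavg_le => //; exact: weights1.
exists (inf D) => e e0; set s := inf D.
have e2 : 0 < e / 2 by lra.
have [l hl] := translates_cover (uniform_right fc e2).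
have l0 : (0 < size l)%N by have [t] := hl 1%g; case: (l).
pose n : R := (size l)%:R; have n0 : 0 < n by rewrite ltr0n.
have n1 : 1 <= n by rewrite ler1n.
(* If one of [n] values that are at most r < s + d is lowered to s - e / 2, their average falls
   below [s]. *)
pose d := e / (2 * n); have d0 : 0 < d by rewrite divr_gt0// mulr_gt0.
have nd : n * d = e / 2 by rewrite /d; field; rewrite gt_eqF.
have [|r [v vw hv] rs] := @inf_lt _ D (s + d) D0; first by rewrite ltrDl.
have sr : s <= r by apply: ge_inf; [exists (- M)|exists v].
exists v => // x0; have de : d <= e / 2 by rewrite -nd ler_peMl// ltW.
suff h : s - e <= lavg v f x0.
  by rewrite ler_norml; have := hv x0; lra.
rewrite leNgt; apply/negP => hx0.
(* For every g some t in [l] puts t^-1 g near 1, and there the value at x0 t^-1 g is within e / 2 of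
   the small value at [x0]. *)
pose w := [seq (n^-1, (x0 * t^-1)%g) | t <- l].
have ww : wts w.
  split; first by apply/allP => p /mapP[t _ ->] /=; rewrite invr_ge0 ltW//=; apply/asboolP.
  by rewrite big_map /= big_const_seq count_predT iter_addr addr0 -mulr_natl mulfV// gt_eqF.
pose c := r - n^-1 * (r - (s - e / 2)).
suff : s <= c.
  have : n * (r - s) < e / 2 by rewrite -nd ltr_pM2l//; lra.
  rewrite /c => h1 h2; have {}h2 : n^-1 * (r - (s - e / 2)) <= r - s by lra.
  by rewrite ler_pdivrMl// in h2; lra.
apply: ge_inf; first by exists (- M).
exists (wmul v w); first exact: weightsT_mul.
move=> g; rewrite lavg_mul /lavg big_map /= -/(lavg _ _) -mulr_sumr.
have [t0 t0l Ut0] := hl g.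
have h0 : lavg v f (x0 * t0^-1 * g)%g <= s - e / 2.
  have hu : lavg v f (x0 * (t0^-1 * g))%g - lavg v f x0 <= e / 2.
    rewrite /lavg -sumrB -[e / 2](wsum_cst _ vw).
    under eq_bigr do rewrite -mulrBr.
    apply: (wsum_le (F' := fun=> e / 2)
      (F := fun k => f (k * (x0 * (t0^-1 * g)))%g - f (k * x0)%g)) => // k.
    by rewrite mulgA (le_trans (ler_norm _)).
  by rewrite -mulgA; lra.
have : \sum_(t <- l) lavg v f (x0 * t^-1 * g)%g <= n * r - (r - (s - e / 2)).
  have -> : n * r = \sum_(t <- l) r.
    by rewrite big_const_seq count_predT iter_addr addr0 mulr_natl.
  rewrite lerBrDr -lerBrDl -sumrB (big_rem t0)//=.
  rewrite -[X in X <= _]addr0 lerD//; first by lra.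
  by apply: sumr_ge0 => t _; rewrite subr_ge0.
move=> hs; have ni : 0 <= n^-1 by rewrite invr_ge0 ltW.
apply: le_trans (ler_wpM2l ni hs) _.
by rewrite mulrBr mulKf ?gt_eqF// /c.
Qed.

Lemma rcont_inv f : rcont f -> rcont (fun g => f g^-1%g).
Proof. by move=> fc g e e0; exact: (@invg_continuous G g _ (fc g^-1%g _ e0)). Qed.

Lemma right_mean_exists f : rcont f -> exists s, forall e, 0 < e ->
  exists2 v, wts v & forall g, `|ravg v f g - s| <= e.
Proof.
move=> /rcont_inv/left_mean_exists[s hs]; exists s => e /hs[v [v0 v1] hv].
exists [seq (p.1, p.2^-1%g) | p <- v].
  split; last by rewrite big_map.
  rewrite all_map; apply: sub_all v0 => p /andP[p0 _] /=.
  by rewrite p0; apply/asboolP.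
move=> g; have := hv g^-1%g; rewrite /ravg /lavg big_map /=.
by under eq_bigr do rewrite invgM invgK.
Qed.

Lemma ravg_near v f c e : wts v -> (forall g, `|f g - c| <= e) ->
  forall g, `|ravg v f g - c| <= e.
Proof.
move=> vw h g; rewrite ler_distl; apply/andP; split.
  by apply: ravg_ge => // k; have := h k; rewrite ler_distl => /andP[].
by apply: ravg_le => // k; have := h k; rewrite ler_distl => /andP[].
Qed.

Lemma lavg_near v f c e : wts v -> (forall g, `|f g - c| <= e) ->
  forall g, `|lavg v f g - c| <= e.
Proof.
move=> vw h g; rewrite ler_distl; apply/andP; split.
  by apply: lavg_ge => // k; have := h k; rewrite ler_distl => /andP[].
by apply: lavg_le => // k; have := h k; rewrite ler_distl => /andP[].
Qed.

Definition lmean f (m : R) : Prop := forall e, 0 < e ->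
  exists2 v, wts v & forall g, `|lavg v f g - m| <= e.
Definition rmean f (m : R) : Prop := forall e, 0 < e ->
  exists2 v, wts v & forall g, `|ravg v f g - m| <= e.

(** Applying a left and a right average to [f] gives a function close to [a] and to [b] at once.
    Hence both kinds of mean are unique. *)
Lemma lmean_rmean_eq f a b : lmean f a -> rmean f b -> a = b.
Proof.
move=> ha hb; apply/eqP; rewrite -subr_eq0 -normr_le0; apply/ler_addgt0Pl => e e0.
have e2 : 0 < e / 2 by lra.
have [v vw hv] := ha _ e2; have [w ww hw] := hb _ e2.
have := ravg_near ww hv 1%g; have := lavg_near vw hw 1%g.
rewrite ravg_lavg addr0 !ler_norml; lra.
Qed.

Definition mean f : R := xget 0 [set m | lmean f m /\ rmean f m].

Lemma meanP f : rcont f -> lmean f (mean f) /\ rmean f (mean f).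
Proof.
move=> fc; have [a ha] := left_mean_exists fc; have [b hb] := right_mean_exists fc.
have ab := lmean_rmean_eq ha hb; rewrite -ab in hb.
exact: (xgetI 0 (conj ha hb : [set m | lmean f m /\ rmean f m] a)).
Qed.

Lemma lmean_eq f m : rcont f -> lmean f m -> mean f = m.
Proof. by move=> /meanP[_ h2] h; rewrite (lmean_rmean_eq h h2). Qed.

Lemma rmean_eq f m : rcont f -> rmean f m -> mean f = m.
Proof. by move=> /meanP[h1 _] h; rewrite -(lmean_rmean_eq h1 h). Qed.

Lemma rcontD f f' : rcont f -> rcont f' -> rcont (f + f').
Proof.
move=> fc fc' g e e0; have e2 : 0 < e / 2 by lra.
apply: filterS2 (fc g _ e2) (fc' g _ e2) => h h1 h2.
rewrite -[(f + f') h]/(f h + f' h) -[(f + f') g]/(f g + f' g) opprD addrACA [e]splitr.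
by rewrite (le_trans (ler_normD _ _))// lerD.
Qed.

Lemma rcontZ (c : R) f : rcont f -> rcont (fun g => c * f g).
Proof.
move=> fc g e e0; have c1 : 0 < `|c| + 1 by rewrite ltr_wpDl.
apply: filterS (fc g _ (divr_gt0 e0 c1)) => h h1.
rewrite -mulrBr normrM (le_trans (ler_wpM2l (normr_ge0 _) h1))//.
by rewrite mulrCA ler_piMr ?(ltW e0)// ler_pdivrMr//; lra.
Qed.

Lemma rcont_rtrans f k : rcont f -> rcont (fun g => f (g * k)%g).
Proof.
move=> fc g e e0.
have c : {for g, continuous (fun x => (x * k)%g)} by exact: rmulg_continuous.
exact: (c _ (fc (g * k)%g _ e0)).
Qed.

Lemma rcont_ravg v f : rcont f -> rcont (ravg v f).
Proof.
move=> fc; elim: v => [|p v IH].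
  by move=> g e e0; near=> h; rewrite /ravg !big_nil subrr normr0 ltW.
rewrite (_ : ravg _ _ = (fun g => p.1 * f (g * p.2)%g) + ravg v f).
  by apply: rcontD => //; apply: (rcontZ _ (rcont_rtrans _ fc)).
by apply/funext => g; rewrite /ravg big_cons.
Unshelve. all: by end_near. Qed.

Lemma mean_ravg v f : wts v -> rcont f -> mean (ravg v f) = mean f.
Proof.
move=> vw fc; apply: lmean_eq; first exact: rcont_ravg.
move=> e /((meanP fc).1 e)[w ww hw]; exists w => // g.
by rewrite -ravg_lavg; apply: ravg_near.
Qed.

Lemma mean_rtrans f k : rcont f -> mean (fun g => f (g * k)%g) = mean f.
Proof.
move=> fc; rewrite -[RHS](mean_ravg (weights1 R (I : [set: G] k)))//; congr mean.
by apply/funext => g; rewrite /ravg big_seq1 mul1r.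
Qed.

(** One measure must serve both functions: [v] suits [f], and [w] is then chosen for [ravg v f'],
    which has the same mean as [f']. A nearly constant function stays so under [w]. *)
Lemma meanD f f' : rcont f -> rcont f' -> mean (f + f') = mean f + mean f'.
Proof.
move=> fc fc'; apply: rmean_eq; first exact: rcontD.
move=> e e0; have e2 : 0 < e / 2 by lra.
have [v vw hv] := (meanP fc).2 _ e2.
have [w ww hw] := (meanP (rcont_ravg v fc')).2 _ e2; rewrite mean_ravg// in hw.
exists (wmul w v); first exact: weightsT_mul.
move=> g; have -> : ravg (wmul w v) (f + f') g = ravg w (ravg v f) g + ravg w (ravg v f') g.
  rewrite -!ravg_mul /ravg -big_split; apply: eq_bigr => p _ /=.
  by rewrite -[(f + f') _]/(f (g * p.2)%g + f' (g * p.2)%g) mulrDr.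
rewrite opprD addrACA (le_trans (ler_normD _ _))// [e]splitr lerD//.
exact: ravg_near.
Qed.

Lemma meanZ (c : R) f : rcont f -> mean (fun g => c * f g) = c * mean f.
Proof.
move=> fc; apply: rmean_eq; first exact: rcontZ.
move=> e e0; have c1 : 0 < `|c| + 1 by rewrite ltr_wpDl.
have [v vw hv] := (meanP fc).2 _ (divr_gt0 e0 c1); exists v => // g.
have -> : ravg v (fun g => c * f g) g = c * ravg v f g.
  by rewrite /ravg mulr_sumr; apply: eq_bigr => p _; rewrite mulrCA.
rewrite -mulrBr normrM (le_trans (ler_wpM2l (normr_ge0 _) (hv g)))//.
by rewrite mulrCA ler_piMr ?(ltW e0)// ler_pdivrMr//; lra.
Qed.

Lemma mean_ge0 f : rcont f -> (forall g, 0 <= f g) -> 0 <= mean f.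
Proof.
move=> fc f0; rewrite -oppr_le0; apply/ler_addgt0Pl => e e0; rewrite addr0.
have [v vw hv] := (meanP fc).2 _ e0; have := hv 1%g; have := ravg_ge vw f0 1%g.
rewrite ler_norml; lra.
Qed.

Lemma mean_le f c : rcont f -> (forall g, `|f g| <= c) -> `|mean f| <= c.
Proof.
move=> fc f0; apply/ler_addgt0Pl => e e0.
have [v vw hv] := (meanP fc).2 _ e0; have := hv 1%g.
have h g : `|f g - 0| <= c by rewrite subr0.
have := ravg_near vw h 1%g; rewrite subr0 !ler_norml; lra.
Qed.

Lemma mean_cst c : mean (fun=> c) = c.
Proof.
apply: rmean_eq; first by move=> g e e0; near=> h; rewrite subrr normr0 ltW.
move=> e e0; exists [:: (1, 1%g)]; first exact: weights1.
by move=> g; rewrite /ravg big_seq1 mul1r subrr normr0 ltW.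
Unshelve. all: by end_near. Qed.

(** Finitely many translates of the set where [f] is at least f x0 / 2 cover the group, so some left
    average of [f] has a positive lower bound. *)
Lemma mean_gt0 f x0 : rcont f -> (forall g, 0 <= f g) -> 0 < f x0 -> 0 < mean f.
Proof.
move=> fc f0 fx0; have d0 : 0 < f x0 / 2 by lra.
have /translates_cover[l hl] : nbhs (1%g : G) [set u | f x0 / 2 <= f (x0 * u)%g].
  have c : {for (1%g : G), continuous (fun u => (x0 * u)%g)} by exact: lmulg_continuous.
  have hn : \forall u \near (1%g : G), `|f (x0 * u)%g - f (x0 * 1)%g| <= f x0 / 2.
    exact: (c _ (fc (x0 * 1)%g _ d0)).
  by apply: filterS hn => u; rewrite mulg1 ler_norml /=; lra.
have l0 : (0 < size l)%N by have [t] := hl 1%g; case: (l).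
pose n : R := (size l)%:R; have n0 : 0 < n by rewrite ltr0n.
pose w := [seq (n^-1, (x0 * t^-1)%g) | t <- l].
have ww : wts w.
  split; first by apply/allP => p /mapP[t _ ->] /=; rewrite invr_ge0 ltW//=; apply/asboolP.
  by rewrite big_map /= big_const_seq count_predT iter_addr addr0 -mulr_natl mulfV// gt_eqF.
have h g : n^-1 * (f x0 / 2) <= lavg w f g.
  rewrite /lavg big_map /= -mulr_sumr ler_wpM2l ?invr_ge0 ?(ltW n0)//.
  have [t tl ht] := hl g; rewrite (big_rem t)//= -[leLHS]addr0 lerD//.
    by rewrite -mulgA.
  by apply: sumr_ge0.
have c0 : 0 < n^-1 * (f x0 / 2) / 2 by rewrite divr_gt0// mulr_gt0// invr_gt0.
have [v vw hv] := (meanP fc).2 _ c0.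
have := lavg_near ww hv 1%g; have := ravg_ge vw h 1%g; rewrite ravg_lavg.
by move: c0; move: (n^-1 * _) (lavg _ _ _) => a b; rewrite ler_norml; lra.
Qed.

End HaarMean.

(** * The complex mean and a positive definite function of mean zero *)

Section ComplexMean.
Variables (R : realType) (G : topologicalGroupType).
Hypothesis Gc : compact [set: G].
Local Notation C := R[i].
Implicit Types (h : G -> C) (e : R).

Definition cmean h : C :=
  mean (fun g => complex.Re (h g)) +i* mean (fun g => complex.Im (h g)).

Lemma ccont_Re h : ccont h -> rcont (fun g => complex.Re (h g)).
Proof.
move=> hc g e e0; apply: filterS (hc g e e0) => k; apply: le_trans.
by rewrite -raddfB ler_normRe_rnorm.
Qed.

Lemma ccont_Im h : ccont h -> rcont (fun g => complex.Im (h g)).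
Proof.
move=> hc g e e0; apply: filterS (hc g e e0) => k; apply: le_trans.
by rewrite -raddfB ler_normIm_rnorm.
Qed.

Lemma ccont_real (f : G -> R) : rcont f -> ccont (fun g => (f g)%:C).
Proof.
move=> fc g e e0; apply: filterS (fc g e e0) => k; apply: le_trans.
by rewrite -rmorphB rnorm_real.
Qed.

Lemma ccont_cst (c : C) : ccont (fun _ : G => c).
Proof. by move=> g e e0; near=> k; rewrite subrr rnorm0 ltW.
Unshelve. all: by end_near. Qed.

Lemma ccont_conj h : ccont h -> ccont (fun g => (h g)^*).
Proof.
by move=> hc g e e0; apply: filterS (hc g e e0) => k; rewrite -rmorphB rnorm_conj.
Qed.

Lemma ccont_sum (I : Type) (s : seq I) (F : I -> G -> C) :
  (forall i, ccont (F i)) -> ccont (fun g => \sum_(i <- s) F i g).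
Proof.
move=> Fc; elim: s => [|i s IH].
  rewrite (_ : (fun g => _) = (fun=> 0)); first exact: ccont_cst.
  by apply/funext => g; rewrite big_nil.
rewrite (_ : (fun g => _) = F i + (fun g => \sum_(j <- s) F j g)); first exact: ccontD.
by apply/funext => g; rewrite big_cons.
Qed.

Lemma ccont_rtrans h k : ccont h -> ccont (fun g => h (g * k)%g).
Proof.
move=> hc g e e0.
have c : {for g, continuous (fun x => (x * k)%g)} by exact: rmulg_continuous.
exact: (c _ (hc (g * k)%g _ e0)).
Qed.

Lemma cmeanD h h' : ccont h -> ccont h' -> cmean (h + h') = cmean h + cmean h'.
Proof.
move=> hc hc'; rewrite /cmean.
have -> : (fun g => complex.Re ((h + h') g)) =
    (fun g => complex.Re (h g)) + (fun g => complex.Re (h' g)).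
  by apply/funext => g; rewrite -[(h + h') g]/(h g + h' g) raddfD.
have -> : (fun g => complex.Im ((h + h') g)) =
    (fun g => complex.Im (h g)) + (fun g => complex.Im (h' g)).
  by apply/funext => g; rewrite -[(h + h') g]/(h g + h' g) raddfD.
by rewrite !meanD//; do ?[exact: ccont_Re|exact: ccont_Im].
Qed.

Lemma cmeanZ (c : C) h : ccont h -> cmean (fun g => c * h g) = c * cmean h.
Proof.
case: c => a b hc; rewrite /cmean.
have hR := ccont_Re hc; have hI := ccont_Im hc.
have -> : (fun g => complex.Re ((a +i* b) * h g)) =
    (fun g => a * complex.Re (h g)) + (fun g => - b * complex.Im (h g)).
  apply/funext => g.
  change (complex.Re ((a +i* b) * h g) = a * complex.Re (h g) + - b * complex.Im (h g)).
  by case: (h g) => x y /=; ring.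
have -> : (fun g => complex.Im ((a +i* b) * h g)) =
    (fun g => a * complex.Im (h g)) + (fun g => b * complex.Re (h g)).
  apply/funext => g.
  change (complex.Im ((a +i* b) * h g) = a * complex.Im (h g) + b * complex.Re (h g)).
  by case: (h g) => x y /=; ring.
rewrite !(meanD Gc) ?(meanZ Gc)//; do ?exact: rcontZ.
by apply/eqP; rewrite eq_complex /=; apply/andP; split; apply/eqP; ring.
Qed.

Lemma cmean0 : cmean (fun=> 0) = 0.
Proof. by rewrite /cmean /= (mean_cst Gc). Qed.

Lemma cmean_sum (I : Type) (s : seq I) (F : I -> G -> C) :
  (forall i, ccont (F i)) -> cmean (fun g => \sum_(i <- s) F i g) = \sum_(i <- s) cmean (F i).
Proof.
move=> Fc; elim: s => [|i s IH].
  rewrite (_ : (fun g => _) = (fun=> 0)) ?cmean0 ?big_nil//.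
  by apply/funext => g; rewrite big_nil.
rewrite (_ : (fun g => _) = F i + (fun g => \sum_(j <- s) F j g)).
  by rewrite cmeanD ?IH ?big_cons//; exact: ccont_sum.
by apply/funext => g; rewrite big_cons.
Qed.

Lemma cmean_rtrans h k : ccont h -> cmean (fun g => h (g * k)%g) = cmean h.
Proof.
by move=> hc; rewrite /cmean; congr (_ +i* _);
  apply: (mean_rtrans Gc k (f := fun g => _ (h g))); [exact: ccont_Re|exact: ccont_Im].
Qed.

Lemma cmean_ge0 h : ccont h -> (forall g, 0 <= h g) -> 0 <= cmean h.
Proof.
move=> hc h0; rewrite /cmean.
have -> : (fun g => complex.Im (h g)) = (fun=> 0).
  by apply/funext => g; have := h0 g; rewrite lecE /= => /andP[/eqP].
rewrite (mean_cst Gc) -[_ +i* 0]/(_%:C) ler0c; apply: (mean_ge0 Gc); first exact: ccont_Re.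
by move=> g; have := h0 g; rewrite lecE /= => /andP[].
Qed.

(** The factor 2 comes from treating real and imaginary parts separately; it is absorbed where the
    lemma is used, in estimates with arbitrarily small bounds. *)
Lemma cmean_le h e : ccont h -> (forall g, rnorm (h g) <= e) -> rnorm (cmean h) <= 2 * e.
Proof.
move=> hc he; rewrite (le_trans (rnorm_le_Re_Im _))// mulr_natl mulr2n lerD//=.
  apply: (mean_le Gc); first exact: ccont_Re.
  by move=> g; rewrite (le_trans (ler_normRe_rnorm _)).
apply: (mean_le Gc); first exact: ccont_Im.
by move=> g; rewrite (le_trans (ler_normIm_rnorm _)).
Qed.

(** A compact Hausdorff space is normal, so Urysohn gives a function separating 1 from [g0]. Minus
    its mean, it cannot vanish at both points. *)
Lemma nonconstant_rcont : hausdorff_space G -> (exists g : G, g <> 1%g) ->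
  exists (f : G -> R) x0, [/\ rcont f, mean f = 0 & f x0 != 0].
Proof.
move=> Gh [g0 g01].
have [r [rc _ r0 r1]] : exists r : G -> R, [/\ continuous r, range r `<=` `[0, 1],
    r @` [set 1%g] `<=` [set 0] & r @` [set g0] `<=` [set 1]].
  apply/uniform_separatorP.
  have /(normal_completely_regular (R := R)) := compact_normal Gh Gc.
  apply; first exact: hausdorff_accessible.
    by apply: accessible_closed_set1; exact: hausdorff_accessible.
  by move=> /= /esym.
have {}r0 : r 1%g = 0 by apply: r0; exists 1%g.
have {}r1 : r g0 = 1 by apply: r1; exists g0.
have rr : rcont r.
  move=> g e e0; have /cvgrPdist_le/(_ _ e0) := rc g.
  by apply: filterS => h; rewrite distrC.
pose f := r + (fun=> - mean r).
have cc (c : R) : rcont (fun _ : G => c).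
  by move=> g e e0; near=> h; rewrite subrr normr0 ltW.
have fc : rcont f by apply: rcontD.
have f0 : mean f = 0 by rewrite (meanD Gc)// (mean_cst Gc) subrr.
have [h|h] := eqVneq (f 1%g) 0; last by exists f, 1%g.
exists f, g0; split => //; apply/eqP => h'.
have : r g0 - mean r = r 1%g - mean r by rewrite -[LHS]/(f g0) -[RHS]/(f 1%g) h h'.
by move/addIr; rewrite r0 r1 => /eqP; rewrite oner_eq0.
Unshelve. all: by end_near. Qed.

(* [phi g] is the normalized mean of [x |-> f (x * g) * f x], for a nonzero continuous
   real [f] of mean zero. *)
Lemma null_mean_pd_exists : hausdorff_space G -> (exists g : G, g <> 1%g) ->
  exists phi : G -> C, [/\ dominated phi 1, phi 1%g = 1 & null_mean [set: G] phi].
Proof.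
move=> Gh Gn; have [f [x0 [fc f0 fx0]]] := nonconstant_rcont Gh Gn.
pose F g : C := (f g)%:C; have Fc : ccont F by apply: ccont_real.
have FJ g : (F g)^* = F g by apply/CrealP/complex_realP; exists (f g).
have FFc k : ccont (fun x => F (x * k)%g * F x).
  exact: (ccontM (ccont_rtrans k Fc) Fc).
pose m2 := complex.Re (cmean (fun x => F x * F x)).
have Em2 : cmean (fun x => F x * F x) = m2%:C.
  apply/esym/RRe_real/ger0_real/cmean_ge0; first exact: (ccontM Fc Fc).
  by move=> g; rewrite /F -rmorphM ler0c -expr2 sqr_ge0.
have m2_gt0 : 0 < m2.
  rewrite /m2 /cmean /=.
  have -> : (fun g => f g * f g - 0 * 0) = (fun g => f g ^+ 2) by apply/funext => g; ring.
  apply: (mean_gt0 Gc (x0 := x0)).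
  - have := ccont_Re (ccontM Fc Fc); congr rcont; apply/funext => g.
    by rewrite -[(F * F) g]/(F g * F g) /F -rmorphM expr2.
  - by move=> g; rewrite sqr_ge0.
  - by rewrite lt_def sqrf_eq0 fx0 sqr_ge0.
pose phi g : C := (m2^-1)%:C * cmean (fun x => F (x * g)%g * F x).
have [M M0 fM] := rcont_bounded Gc fc.
have FM g : rnorm (F g) <= M by rewrite rnorm_real.
have bound h e : ccont h -> (forall x, rnorm (h x) <= e) -> 0 <= e ->
    rnorm ((m2^-1)%:C * cmean (fun x => h x * F x)) <= m2^-1 * (2 * (e * M)).
  move=> hc he e0; rewrite rnormM rnorm_real ger0_norm ?invr_ge0 ?(ltW m2_gt0)//.
  rewrite ler_wpM2l ?invr_ge0 ?(ltW m2_gt0)//; apply: cmean_le; first exact: (ccontM hc Fc).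
  by move=> x; rewrite rnormM ler_pM ?rnorm_ge0.
have small e : 0 < e -> exists2 d, 0 < d & m2^-1 * (2 * (d * M)) <= e.
  move=> e0; exists (e * m2 / (2 * M)); first by rewrite divr_gt0// mulr_gt0.
  by rewrite le_eqVlt; apply/orP; left; apply/eqP; field; rewrite !gt_eqF.
have phi1 : phi 1%g = 1.
  rewrite /phi (_ : (fun x => _) = (fun x => F x * F x)); last by apply/funext => x; rewrite mulg1.
  by rewrite Em2 -rmorphM mulVf ?gt_eqF.
exists phi; split => //.
- exists (fun _ _ => phi); split => //; last by move=> _; rewrite phi1.
    (* Right invariance of the mean allows replacing x by x q in each term, which turns the form
       into the normalized mean of |S|^2. *)
    move=> v; pose S x := \sum_(p <- v) p.1 * F (x * p.2.1)%g.
    have Sc : ccont S.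
      by apply: ccont_sum => p; exact: (ccontM (ccont_cst p.1) (ccont_rtrans p.2.1 Fc)).
    suff -> : kpair (kcomb (bker (fun _ _ => phi)) v) v =
        (m2^-1)%:C * cmean (fun x => S x * (S x)^*).
      rewrite mulr_ge0 ?ler0c ?invr_ge0 ?(ltW m2_gt0)//.
      by apply: cmean_ge0; [exact: (ccontM Sc (ccont_conj Sc))|move=> x; exact: mul_conjC_ge0].
    have -> : (fun x => S x * (S x)^*) = (fun x => \sum_(q <- v) \sum_(p <- v)
        (q.1^* * p.1) * (F (x * p.2.1)%g * F (x * q.2.1)%g)).
      apply/funext => x; rewrite {2}/S rmorph_sum mulr_sumr; apply: eq_bigr => q _.
      rewrite /S mulr_suml; apply: eq_bigr => p _; rewrite rmorphM /= FJ; ring.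
    have tc p q : ccont (fun x => F (x * p)%g * F (x * q)%g).
      exact: (ccontM (ccont_rtrans p Fc) (ccont_rtrans q Fc)).
    have tc' (c : C) p q : ccont (fun x => c * (F (x * p)%g * F (x * q)%g)).
      exact: (ccontM (ccont_cst c) (tc p q)).
    rewrite cmean_sum; last by move=> q; apply: ccont_sum => p; apply: tc'.
    rewrite /kpair mulr_sumr; apply: eq_bigr => q _.
    rewrite cmean_sum; last by move=> p; apply: tc'.
    rewrite /kcomb !mulr_sumr; apply: eq_bigr => p _; rewrite cmeanZ//.
    rewrite /bker /phi -(cmean_rtrans q.2.1 (FFc _)).
    have -> : (fun g => F (g * q.2.1 * (q.2.1^-1 * p.2.1))%g * F (g * q.2.1)%g) =
        (fun g => F (g * p.2.1)%g * F (g * q.2.1)%g).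
      by apply/funext => g; rewrite -mulgA (mulgA q.2.1) mulgV mul1g.
    ring.
  (* Continuity of the correlation comes from the uniform continuity of [f] under right
     translation. *)
  move=> _ g e e0; have [d d0 hd] := small e e0.
  have hc : {for g, continuous (fun k : G => (g^-1 * k)%g)} by exact: lmulg_continuous.
  have ur := uniform_right Gc fc d0.
  have hn : \forall k \near g, forall x, `|f (x * (g^-1 * k))%g - f x| <= d.
    by rewrite -(mulVg g) in ur; exact: (hc _ ur).
  apply: filterS hn => k hh.
  have -> : phi k - phi g = (m2^-1)%:C * cmean (fun x => (F (x * k)%g - F (x * g)%g) * F x).
    rewrite /phi -mulrBr; congr (_ * _).
    rewrite (_ : (fun x => (_ - _) * _) =
      (fun x => F (x * k)%g * F x) + (fun x => -1 * (F (x * g)%g * F x))).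
      rewrite cmeanD// ?cmeanZ ?mulN1r//.
      exact: (ccontM (ccont_cst (-1)) (FFc g)).
    apply/funext => x.
    change ((F (x * k)%g - F (x * g)%g) * F x =
      F (x * k)%g * F x + -1 * (F (x * g)%g * F x)).
    ring.
  apply: le_trans hd; apply: bound => //; last exact: ltW.
    rewrite (_ : (fun x => _) = (fun x => F (x * k)%g) + (fun x => -1 * F (x * g)%g)).
      apply: ccontD; first exact: ccont_rtrans.
      exact: (ccontM (ccont_cst (-1)) (ccont_rtrans g Fc)).
    by apply/funext => x; rewrite -[RHS]/(F (x * k)%g + -1 * F (x * g)%g) mulN1r.
  move=> x; rewrite /F -rmorphB rnorm_real.
  by have := hh (x * g)%g; rewrite -mulgA (mulgA g) mulgV mul1g.
(* Averaging [phi] amounts to averaging the first factor [F] of the correlation, and [f] has right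
   averages uniformly close to its mean 0. *)
- move=> e e0; have [d d0 hd] := small e e0.
  have [v vw hv] := (meanP Gc fc).2 _ d0; rewrite f0 in hv.
  exists v => // g; apply: le_trans hd.
  have -> : favg v phi g = (m2^-1)%:C * cmean (fun x => favg v F (x * g)%g * F x).
    rewrite (_ : (fun x => _) = (fun x => \sum_(p <- v) p.1%:C * (F (x * (g * p.2))%g * F x))).
      rewrite cmean_sum; last by move=> p; exact: (ccontM (ccont_cst p.1%:C) (FFc _)).
      rewrite /favg mulr_sumr; apply: eq_bigr => p _.
      by rewrite cmeanZ// /phi mulrCA.
    apply/funext => x; rewrite /favg mulr_suml; apply: eq_bigr => p _.
    by rewrite mulgA mulrA.
  apply: bound; last exact: ltW.
    apply: ccont_rtrans; apply: ccont_sum => p.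
    exact: (ccontM (ccont_cst p.1%:C) (ccont_rtrans p.2 Fc)).
  move=> x; have := hv (x * g)%g; rewrite subr0; apply: le_trans.
  rewrite -rnorm_real /ravg raddf_sum /favg; set a := rnorm _; set b := rnorm _.
  by rewrite (_ : a = b)// /a /b; congr rnorm; apply: eq_bigr => p _; rewrite /F -rmorphM.
Qed.

End ComplexMean.

(** If [m] were largest, Hilbert's hotel would inject [I] into the elements below [m]: [m] takes the
    first place of a sequence below [m], whose terms move up by one. An initial ordinal forbids
    this. *)
Lemma infinite_cardinal_no_max (d : Order.disp_t) (I : orderType d) (m : I) :
  infinite_cardinal I -> exists j : I, (m < j)%O.
Proof.
move=> [_ Iinf Icard]; apply: contrapT => /forallNP mmax.
have mlt j : j <> m -> (j < m)%O.
  by move=> jm; rewrite lt_neqAle; apply/andP; split; [exact/eqP|rewrite leNgt; exact/negP].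
apply: (Icard m).
have /infiniteP/card_leP[f] : infinite_set [set j : I | (j < m)%O].
  have := infinite_setD Iinf (finite_set1 m); apply: sub_infinite_set => j [_ /= jm].
  exact: mlt.
pose e n : I := set_val (f (to_setT n)).
have em n : (e n < m)%O by exact: (set_valP (f (to_setT n))).
have einj : injective e.
  move=> n n' /val_inj E.
  have := @inj _ _ _ f _ _ (mem_set Logic.I) (mem_set Logic.I) E.
  by move/(congr1 set_val).
pose h j : I := if pselect (j = m) then e 0%N else
  if pselect (exists n, e n = j) is left H then e (sval (cid H)).+1 else j.
have hm : h m = e 0%N by rewrite /h; case: pselect.
have he n : h (e n) = e n.+1.
  rewrite /h; case: pselect => [E|nE] /=; first by have := em n; rewrite E ltxx.
  case: pselect => [H|nH] /=; last by exfalso; apply: nH; exists n.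
  by rewrite (einj _ _ (svalP (cid H))).
have ho j : j <> m -> (forall n, e n <> j) -> h j = j.
  move=> jm jn; rewrite /h; case: pselect => // nE /=; case: pselect => // H /=.
  by case: (jn _ (svalP (cid H))).
have cases j : j = m \/ (exists n, j = e n) \/ (j <> m /\ forall n, e n <> j).
  have [->|jm] := pselect (j = m); first by left.
  have [[n <-]|jn] := pselect (exists n, e n = j); first by right; left; exists n.
  by right; right; split => // n En; apply: jn; exists n.
suff : $|{injfun [set: I] >-> [set j : I | (j < m)%O]}| by case => g; exact: inj_card_le.
apply/injfunPex; exists h.
  move=> j _ /=; case: (cases j) => [->|[[n ->]|[jm jn]]]; rewrite ?hm ?he ?em//.
  by rewrite ho//; apply: mlt.
move=> j j' _ _.
case: (cases j) => [->|[[n ->]|[jm jn]]]; case: (cases j') => [->|[[n' ->]|[jm' jn']]] //.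
- by rewrite hm he => /einj.
- by rewrite hm ho// => E; case: (jn' _ E).
- by rewrite he hm => /einj.
- by rewrite !he => /einj [->].
- by rewrite he ho// => E; case: (jn' _ E).
- by rewrite ho// hm => E; case: (jn _ (esym E)).
- by rewrite ho// he => E; case: (jn _ (esym E)).
- by rewrite !ho.
Qed.

(** The sets that contain a cylinder around [x] form a filter. It converges to [x] in each
    coordinate, hence in the product topology, so it contains every neighborhood. *)
Lemma prod_nbhs_cylinder (I : eqType) (G : I -> topologicalGroupType) (x : prod_topology G)
    (W : set (prod_topology G)) : nbhs x W ->
  exists s : seq I, forall y : prod_topology G, (forall i, i \in s -> y i = x i) -> W y.
Proof.
pose F : set_system (prod_topology G) := [set V | exists s : seq I,
  forall y : prod_topology G, (forall i, i \in s -> y i = x i) -> V y].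
have FF : Filter F.
  split.
  - by exists [::].
  - move=> P Q [s hs] [s' hs']; exists (s ++ s') => y hy; split.
      by apply: hs => i si; apply: hy; rewrite mem_cat si.
    by apply: hs' => i si; apply: hy; rewrite mem_cat si orbT.
  - by move=> P Q PQ [s hs]; exists s => y /hs/PQ.
suff : F --> x by apply.
apply/cvg_sup => i N [V [[U oU <-] VfN] VN].
exists [:: i] => y /(_ i); rewrite inE eqxx => /(_ erefl) yi.
by apply: VN; rewrite /preimage /= yi.
Qed.

(** * Functions on the product group that depend on initial coordinates *)

Section ProductFourier.
Variables (R : realType) (d : Order.disp_t) (I : orderType d).
Variable (G : I -> topologicalGroupType).
Local Notation P := (prod_topology G).
Local Notation C := R[i].
Local Notation B := (@fourier_stieltjes R P).
Local Notation N := (@fs_norm R P).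
Implicit Types (b u : P -> C) (i j : I) (g h : P).

(** Strictness keeps the coordinate [i] free for the multiplier; the products then depend only on
    the coordinates up to [i]. *)
Definition depends_below i b : Prop :=
  forall g h, (forall j, (j < i)%O -> g j = h j) -> b g = b h.

Definition factor i : set P := [set g | forall j, j != i -> g j = 1%g].

Lemma factor1 i : factor i 1%g. Proof. by []. Qed.

Lemma factorM i g h : factor i g -> factor i h -> factor i (g * h)%g.
Proof. by move=> gi hi j ji; rewrite -[(g * h)%g j]/(g j * h j)%g gi// hi// mulg1. Qed.

Lemma factorV i g : factor i g -> factor i g^-1%g.
Proof. by move=> gi j ji; rewrite -[(g^-1)%g j]/((g j)^-1)%g gi// invg1. Qed.

Lemma factorJ i g h : factor i h -> factor i (g^-1 * h * g)%g.
Proof.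
move=> hi j ji; rewrite -[LHS]/((g j)^-1 * h j * g j)%g hi// mulg1 mulVg//.
Qed.

Lemma depends_below_rinvariant i b : depends_below i b -> rinvariant (factor i) b.
Proof.
move=> bi g k ki; apply: bi => j ji.
by rewrite -[LHS]/(g j * k j)%g ki ?mulg1//; rewrite lt_eqF.
Qed.

Lemma depends_belowW i j b : (i <= j)%O -> depends_below i b -> depends_below j b.
Proof. by move=> ij bi g h gh; apply: bi => k ki; apply: gh; apply: lt_le_trans ij. Qed.

Lemma depends_belowM i j (b : P -> C) (a : G i -> C) : (i < j)%O -> depends_below i b ->
  depends_below j (b * (fun g => a (g i))).
Proof.
move=> ij bi g h gh; rewrite -[LHS]/(b g * a (g i)) -[RHS]/(b h * a (h i)).
rewrite (gh i ij); congr (_ * _); apply: bi => k ki; apply: gh; exact: lt_trans ij.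
Qed.

Lemma depends_below_lin (c : C) i b b' : depends_below i b -> depends_below i b' ->
  depends_below i (c *: b + b').
Proof.
move=> bi bi' g h gh; rewrite -[LHS]/(c * b g + b' g) -[RHS]/(c * b h + b' h).
by rewrite (bi g h gh) (bi' g h gh).
Qed.

(** Finitely many indices have a strict upper bound because there is no largest index. *)
Lemma depends_below_fin (s : seq I) b : infinite_cardinal I ->
  (forall g h, (forall j, j \in s -> g j = h j) -> b g = b h) -> exists i, depends_below i b.
Proof.
move=> Ic hb.
suff [i hi] : exists i : I, forall j, j \in s -> (j < i)%O.
  by exists i => g h gh; apply: hb => j /hi; apply: gh.
elim: s {hb} => [|j s [i hi]].
  by have [_ /infinite_setN0[i _] _] := Ic; exists i.
have [k hk] := infinite_cardinal_no_max (Order.max i j) Ic; exists k => j'.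
move: hk; rewrite gt_max => /andP[ik jk].
rewrite inE => /orP[/eqP ->//|/hi ji]; exact: lt_trans ik.
Qed.

(** The retraction onto the subgroup g_i = 1, seen as an endomorphism, so that restriction to it
    stays within functions on the same group. *)
Definition kill i (g : P) : P := fun j => if j == i then 1%g else g j.

Lemma kill_continuous i : continuous (kill i).
Proof.
apply: continuous_into_prod => j; rewrite /kill; have [_|_] := eqVneq j i.
  exact: cst_continuous.
exact: (@continuous_coord _ G j).
Qed.

Lemma killM i : {morph kill i : g h / (g * h)%g}.
Proof.
move=> g h; apply: functional_extensionality_dep => j.
rewrite -[RHS]/(kill i g j * kill i h j)%g /kill; case: eqP => //.
by rewrite mulg1.
Qed.

Definition embed i (k : G i) : P := eqtype.dfwith (1%g : P) k.

Lemma factor_embed i (k : G i) : factor i (embed k).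
Proof. by move=> j ji; rewrite /embed dfwith_out// eq_sym. Qed.

Variables (i : I) (a : G i -> C).
Hypothesis aD : dominated a 1.
Hypothesis a1 : a 1%g = 1.
Hypothesis a0 : null_mean [set: G i] a.
Let ai : P -> C := fun g => a (g i).

Lemma coord_dominated : dominated ai 1.
Proof.
apply: (dominated_comp (t := fun g : P => g i) _ _ aD) => //.
exact: continuous_coord.
Qed.

Lemma coord_fs : B ai /\ N ai <= 1.
Proof. exact: fs_norm_dominated coord_dominated. Qed.

(** Since [b] is constant along the factor [i], averaging over the embedded copy of [G i] only
    averages [a]. *)
Lemma null_mean_mul b : B b -> depends_below i b -> null_mean (factor i) (b * ai).
Proof.
move=> bB bi e e0; have b1 : 0 < N b + 1 by rewrite ltr_wpDl ?fs_norm_ge0.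
have [v [v0 v1] hv] := a0 (divr_gt0 e0 b1).
exists [seq (p.1, embed p.2) | p <- v].
  split; last by rewrite big_map.
  rewrite all_map; apply: sub_all v0 => p /andP[p0 _] /=; rewrite p0.
  by apply/asboolP/factor_embed.
move=> g; have -> : favg [seq (p.1, embed p.2) | p <- v] (b * ai) g = b g * favg v a (g i).
  rewrite /favg big_map mulr_sumr; apply: eq_bigr => p _ /=.
  rewrite -[(b * ai) _]/(b (g * embed p.2)%g * a (g i * embed p.2 i)%g).
  have -> : embed p.2 i = p.2 by exact: dfwith_in.
  have bE := depends_below_rinvariant bi g (factor_embed p.2).
  by rewrite bE mulrCA.
rewrite rnormM (le_trans (ler_pM (rnorm_ge0 _) (rnorm_ge0 _) (fs_bound g bB) (hv _)))//.
by rewrite mulrCA ler_piMr ?(ltW e0)// ler_pdivrMr//; lra.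
Qed.

Lemma product_norm_additive Y b : B Y -> depends_below i Y -> B b -> depends_below i b ->
  N Y + N (b * ai) <= N (Y + b * ai).
Proof.
move=> YB Yi bB bi.
apply: (fs_norm_additive (@factor1 i) (@factorM i) (@factorV i) (@factorJ i)) => //.
- exact: (fsM bB coord_fs.1).1.
- exact: depends_below_rinvariant.
- exact: null_mean_mul.
Qed.

Lemma product_norm_lower b : B b -> depends_below i b -> N b <= N (b * ai).
Proof.
move=> bB bi; apply: fs_norm_leP; first exact: (fsM bB coord_fs.1).1.
move=> s /(dominated_comp (@kill_continuous i) (@killM i)).
have -> : (b * ai) \o kill i = b.
  apply/funext => g; rewrite -[LHS]/(b (kill i g) * a (kill i g i)).
  have -> : kill i g i = 1%g by rewrite /kill eqxx.
  by rewrite a1 mulr1; apply: bi => j ji; rewrite /kill lt_eqF.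
by move=> /fs_norm_dominated[].
Qed.

End ProductFourier.

Lemma linear_span_sub (R : realType) (X : lmodType R[i]) (E F : set X) :
  F 0 -> (forall (c : R[i]) x y, F x -> F y -> F (c *: x + y)) -> E `<=` F ->
  linear_span E `<=` F.
Proof.
move=> F0 FL EF x [n [c [v [vE ->]]]].
elim/big_ind : _ => //; last by move=> i _; rewrite -[_ *: _]addr0; apply: FL => //; apply: EF.
by move=> y z Fy Fz; rewrite -[y]scale1r; apply: FL.
Qed.

Lemma linear_span1 (R : realType) (X : lmodType R[i]) (E : set X) (c : R[i]) x :
  E x -> linear_span E (c *: x).
Proof.
by move=> Ex; exists 1%N, (fun=> c), (fun=> x); split => //; rewrite big_ord1.
Qed.

(** * The base of the Fourier algebra *)

Section Base.
Variables (R : realType) (d : Order.disp_t) (I : orderType d).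
Variable (G : I -> topologicalGroupType).
Local Notation P := (prod_topology G).
Local Notation C := R[i].
Local Notation B := (@fourier_stieltjes R P).
Local Notation N := (@fs_norm R P).
Hypothesis Ic : infinite_cardinal I.
Variable a : forall i, G i -> C.
Hypothesis aD : forall i, dominated (@a i) 1.
Hypothesis a1 : forall i, @a i 1%g = 1.
Hypothesis a0 : forall i, null_mean [set: G i] (@a i).

Definition base_set (i : I) : set (P -> C) := [set b | [/\ B b, N b <= 1 & depends_below i b]].

Definition base_factor (i : I) : P -> C := fun g => @a i (g i).

Definition base_op (i : I) (b : P -> C) : P -> C := b * base_factor i.

Lemma base_factor_fs i : B (base_factor i) /\ N (base_factor i) <= 1.
Proof. exact: coord_fs (aD i). Qed.

Lemma base_op_linear i (c : C) b b' : base_op i (c *: b + b') = c *: base_op i b + base_op i b'.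
Proof.
apply/funext => g.
by change ((c * b g + b' g) * @a i (g i) = c * (b g * @a i (g i)) + b' g * @a i (g i)); ring.
Qed.

Lemma base_op_fs i b : B b -> B (base_op i b) /\ N (base_op i b) <= N b.
Proof.
move=> bB; have [aB aN] := base_factor_fs i; have [bB' h] := fsM bB aB; split => //.
by rewrite (le_trans h)// ler_piMr// fs_norm_ge0.
Qed.

Lemma base_set_fs i b : linear_span (base_set i) b -> B b /\ depends_below i b.
Proof.
move: b; apply: (@linear_span_sub R _ _ [set b | B b /\ depends_below i b]).
- by split; [exact: fs0|].
- move=> c x y [xB xi] [yB yi]; split; last exact: depends_below_lin.
  exact: (fsD (fsZ c xB).1 yB).1.
- by move=> b [].
Qed.

Lemma base_image_fs i x : linear_span (base_op i @` base_set i) x ->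
  exists b, [/\ B b, depends_below i b & x = base_op i b].
Proof.
move: x; apply: (@linear_span_sub R _ _
  [set x | exists b, [/\ B b, depends_below i b & x = base_op i b]]).
- exists 0; split => //; first exact: fs0.
  by apply/funext => g; change (0 = 0 * @a i (g i) :> C); rewrite mul0r.
- move=> c x y [b [bB bi ->]] [b' [bB' bi' ->]]; exists (c *: b + b'); split.
  + exact: (fsD (fsZ c bB).1 bB').1.
  + exact: depends_below_lin.
  + by rewrite base_op_linear.
- by move=> x [b [bB _ bi] <-]; exists b.
Qed.

(** Stated for subsets of ['I_p], so that the induction can remove a term that is not the last in
    the enumeration. *)
Lemma base_norm_additive (p : nat) (al : 'I_p -> I) (x : 'I_p -> P -> C) (A : {set 'I_p}) :
  injective al -> (forall n, linear_span (base_op (al n) @` base_set (al n)) (x n)) ->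
  \sum_(n in A) N (x n) <= N (\sum_(n in A) x n).
Proof.
move=> ali xS; have xB n : B (x n).
  by have [b [bB _ ->]] := base_image_fs (xS n); apply: (base_op_fs _ bB).1.
have [k kA] := ubnP #|A|; elim: k A kA => // k IH A kA.
have [->|[n0 n0A]] := set_0Vmem A; first by rewrite !big_set0 fs_norm0.
(* All other terms have smaller indices by injectivity of [al], so their sum [Y] depends only on the
   coordinates below [al m]. *)
case: (@Order.TotalTheory.arg_maxP _ _ _ n0 (fun n => n \in A) al n0A) => m mA mmax.
have [b [bB bm xm]] := base_image_fs (xS m).
pose Y := \sum_(n in A :\ m) x n.
have -> : \sum_(n in A) x n = Y + x m by rewrite (big_setD1 m)//= addrC.
rewrite (big_setD1 m)//= addrC.
have [YB Ym] : B Y /\ depends_below (al m) Y.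
  rewrite /Y; elim/big_ind : _; first by split; [exact: fs0|].
    move=> u v [uB ui] [vB vi]; split; first exact: (fsD uB vB).1.
    by rewrite -[u]scale1r; apply: depends_below_lin.
  move=> n; rewrite in_setD1 => /andP[nm nA]; split => //.
  have [b' [_ bn ->]] := base_image_fs (xS n); apply: depends_belowM bn.
  rewrite lt_neqAle; apply/andP; split; last exact: (mmax n nA).
  by apply: contra_neq nm; apply: ali.
rewrite xm; apply: le_trans (product_norm_additive (aD (al m)) (@a0 (al m)) YB Ym bB bm).
rewrite lerD2r; apply: IH.
by have := kA; rewrite (cardsD1 m) mA.
Qed.

Hypothesis Gc : compact [set: P].

Lemma base_total u (e : R) : B u -> 0 < e ->
  exists2 b, linear_span (\bigcup_i base_set i) b & N (u - b) < e.
Proof.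
move=> uB e0; have e2 : 0 < e / 2 by lra.
have [W W1 hW] := fs_approx_rinvariant uB e2.
have [s hs] := prod_nbhs_cylinder W1.
pose K : set P := [set g | forall i, i \in s -> g i = 1%g].
have KM g h : K g -> K h -> K (g * h)%g.
  by move=> gK hK i si; rewrite -[LHS]/(g i * h i)%g gK// hK// mulg1.
have KV g : K g -> K g^-1%g.
  by move=> gK i si; rewrite -[LHS]/((g i)^-1)%g gK// invg1.
have K1 : K 1%g by [].
have KW : K `<=` W by move=> g gK; apply: hs.
have [b [bB bK bu]] := hW K K1 KM KV KW.
have [i bi] : exists i, depends_below i b.
  apply: (@depends_below_fin _ _ _ _ s) => // g h gh.
  (* If g and h agree on [s], then g^-1 h lies in [K], so a [K]-invariant function depends only on
     the coordinates in [s]. *)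
  have -> : h = (g * (g^-1 * h))%g by rewrite mulgA mulgV mul1g.
  rewrite bK// => i si; rewrite -[LHS]/((g i)^-1 * h i)%g gh// mulVg//.
exists b; last by rewrite (le_lt_trans bu)//; lra.
have c0 : 0 < N b + 1 by rewrite ltr_wpDl ?fs_norm_ge0.
have c0' : (N b + 1)%:C != 0 :> C by apply/eqP => /complexI/eqP; rewrite gt_eqF.
(* Scaling puts [b] into the unit ball; adding 1 covers the case of norm 0. *)
have -> : b = (N b + 1)%:C *: ((N b + 1)%:C^-1 *: b) by rewrite scalerA mulfV// scale1r.
apply: linear_span1; exists i => //; have [h1 h2] := fsZ (N b + 1)%:C^-1 bB; split => //.
  rewrite h2 -(fmorphV (real_complex R)) rnorm_real ger0_norm ?invr_ge0 ?(ltW c0)//.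
  by rewrite ler_pdivrMl// mulr1; lra.
by move=> g h gh; change ((N b + 1)%:C^-1 * b g = (N b + 1)%:C^-1 * b h); rewrite (bi g h).
Qed.

Lemma base_data : Fl1_base_data (fourier_algebra R P) 1 1 base_set base_op.
Proof.
have E : carrier (fourier_algebra R P) = B by rewrite /= (fourierE R Gc).
split; rewrite ?E.
- by move=> i b [].
- by move=> i; exists 0; split; rewrite ?fs_norm0//; exact: fs0.
- by move=> i j ij b [bB bN bi]; split => //; apply: depends_belowW bi.
- by move=> i b [].
- by move=> u uB e e0; apply: base_total.
- move=> i; split; rewrite ?E.
  + by move=> b bB; apply: (base_op_fs i bB).1.
  + by move=> c b b' _ _; apply: base_op_linear.
  + by exists 1 => b; rewrite E mul1r => bB; apply: (base_op_fs i bB).2.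
  + by move=> b b' _ _; apply/esym/mulrA.
- by exists 1 => i b; rewrite E mul1r => bB; apply: (base_op_fs i bB).2.
- move=> i j ij; apply/seteqP; split; last first.
    move=> _ ->; split; exists 0%N, (fun=> 0), (fun=> 0); split; rewrite ?big_ord0//; by case.
  move=> x [xi xj].
  wlog : i j ij xi xj / (i < j)%O.
    move=> H; have [lt|] := boolP (i < j)%O; first exact: (H i j).
    by rewrite -leNgt le_eqVlt eq_sym (negPf ij) => ji; apply: (H j i); rewrite 1?eq_sym.
  move=> lt; have [b [bB bi xb]] := base_image_fs xi.
  have [b' [bB' bj xb']] := base_image_fs xj.
  have xB : B x by rewrite xb; apply: (base_op_fs i bB).1.
  have xj' : depends_below j x by rewrite xb; apply: depends_belowM bi.
  (* A common element x depends on the coordinates below [j] and equals b' a_j. Additivity for x and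
     -x = (-b') a_j gives N x + N (-x) <= N 0 = 0. *)
  have nB := (fsZ (-1) bB').1.
  have nj : depends_below j (-1 *: b').
    by move=> g h gh; change (-1 * b' g = -1 * b' h); rewrite (bj g h).
  have := product_norm_additive (aD j) (@a0 j) xB xj' nB nj.
  have -> : (-1 *: b') * (fun g => @a j (g j)) = - x.
    apply/funext => g; rewrite xb'.
    by change ((-1 * b' g) * @a j (g j) = - (b' g * @a j (g j))); ring.
  rewrite subrr fs_norm0 => h; apply: (fs_norm_eq0 xB); apply/eqP.
  rewrite eq_le fs_norm_ge0// andbT; apply: le_trans h; rewrite lerDl.
  exact/fs_norm_ge0/(fsN xB).1.
- move=> p al x ali xS; rewrite mul1r.
  have sumT (V : nmodType) (F : 'I_p -> V) :
      \sum_(n in [set: 'I_p]%SET) F n = \sum_(n < p) F n.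
    by apply: eq_bigl => n; rewrite inE.
  by have := base_norm_additive [set: 'I_p]%SET ali xS; rewrite !sumT.
- move=> i b /base_set_fs[bB bi]; rewrite mul1r.
  exact: (product_norm_lower (aD i) (@a1 i)).
Qed.

End Base.

Lemma dominated_const1 (R : realType) (G : topologicalGroupType) :
  dominated (1 : G -> R[i]) 1.
Proof.
exists (fun _ _ => 1); split => //.
  move=> v; have -> : kpair (kcomb (bker (fun _ _ => 1 : G -> R[i])) v) v =
      (\sum_(p <- v) p.1) * (\sum_(p <- v) p.1)^*.
    rewrite /kpair rmorph_sum mulrC mulr_suml; apply: eq_bigr => q _; congr (_ * _).
    by rewrite /kcomb; apply: eq_bigr => p _; rewrite mulr1.
  exact: mul_conjC_ge0.
by move=> _; apply: ccont_cst.
Qed.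

Theorem theorem8p7 (R : realType) (d : Order.disp_t) (eta : orderType d)
    (G : eta -> topologicalGroupType) :
  infinite_cardinal eta ->
  (forall i, compact_group (G i)) ->
  (forall i, exists g : G i, g <> 1%g) ->
  exists L : set (prod_topology G -> R[i]),
    Fl1_base_type2 (fourier_algebra R (prod_topology G)) eta 1%R 1%R L.
Proof.
move=> Ic Gc Gn.
have Pc : compact [set: prod_topology G].
  have := tychonoff (fun i => (Gc i).1); congr compact.
  by apply/seteqP; split.
pose H i := cid (null_mean_pd_exists R (Gc i).1 (Gc i).2 (Gn i)).
pose a i : G i -> R[i] := sval (H i).
have aP i : [/\ dominated (@a i) 1, @a i 1%g = 1 & null_mean [set: G i] (@a i)].
  exact: svalP (H i).
have aD i : dominated (@a i) 1 by have [] := aP i.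
have a1 i : @a i 1%g = 1 by have [] := aP i.
have a0 i : null_mean [set: G i] (@a i) by have [] := aP i.
exists (\bigcup_i (@base_op R _ _ G a i @` @base_set R _ _ G i)); split.
- exact: fourier_banach Pc.
- have [oB _] := fs_norm_dominated (dominated_const1 R (prod_topology G)).
  (* The constant function 1 is a unit, so the constant net at 1 is the approximate identity. *)
  exists [set 1], (principal_filter 1); split.
  + by move=> _ ->; rewrite /= (fourierE R Pc).
  + by exists (fs_norm (1 : prod_topology G -> R[i])) => _ ->.
  + exact: principal_filter_proper.
  + by apply/principal_filterP.
  + move=> u _; have h0 e : 0 < e -> `|0 - fs_norm (u - u)| < e.
      by rewrite subrr fs_norm0 subrr normr0.
    by split; apply/cvgrPdist_lt => e e0; apply/principal_filterP => /=;
      rewrite ?mul1r ?mulr1; apply: h0.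
- by split.
- exists 1 => b [i _ [b' [bB bN bi] <-]]; apply: le_trans bN.
  exact: (base_op_fs aD i bB).2.
- exists (@base_set R _ _ G), (@base_op R _ _ G a); split => //.
  exact: base_data.
Qed.
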